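(* Let $p$ be a prime and let $\mathcal{O}$ be a complete local principal ideal domain of characteristic $0$ with residue field $k$ of characteristic $p$ and with $J(\mathcal{O})=\pi\mathcal{O}$. Let $G$ be a finite group and $B$ a block of $\mathcal{O}G$ with a defect group $P$. Set $\bar B=k\otimes_{\mathcal{O}}B$. We have a canonical exact sequence of groups $$1\to\mathrm{Out}_1(B)\to\mathrm{Pic}(B)\to\mathrm{Pic}(\bar B)$$ with the following properties. (i) The group $\mathrm{Out}_1(B)$ has a finite $p$-power exponent dividing $p^d$, where $d$ is the positive integer satisfying $\pi^d\mathcal{O}=|P|\mathcal{O}$. (ii) If $k$ is finite, then $\mathrm{Pic}(B)$ is finite, and $\mathrm{Out}_1(B)$ is a finite $p$-group. (iii) If $k$ is an algebraic closure of $\mathbb{F}_p$, then every element in $\mathrm{Pic}(B)$ has finite order.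
   Context: A block (algebra) $B$ of $\mathcal{O}G$ is $\mathcal{O}Gb$ for a primitive idempotent $b$ of $Z(\mathcal{O}G)$; a defect group is a maximal $p$-subgroup $P$ of $G$ such that the image of $b$ under the Brauer homomorphism $(\mathcal{O}G)^P\to kC_G(P)$ is nonzero. $\mathrm{Pic}(B)$ is the group of isomorphism classes of $(B,B)$-bimodules inducing a Morita equivalence, with product induced by $\otimes_B$. For an $\mathcal{O}$-algebra $A$ that is free of finite rank over $\mathcal{O}$ and an integer $r\ge1$, $\mathrm{Aut}_r(A)$ is the group of $\mathcal{O}$-algebra automorphisms of $A$ inducing the identity on $A/\pi^rA$, and $\mathrm{Out}_r(A)$ is its image in $\mathrm{Out}(A)=\mathrm{Aut}(A)/\mathrm{Inn}(A)$. The map $\mathrm{Out}_1(B)\to\mathrm{Pic}(B)$ sends the class of $\alpha$ to the class of the bimodule $B_\alpha$ ($B$ with right action twisted by $\alpha$), and $\mathrm{Pic}(B)\to\mathrm{Pic}(\bar B)$ is induced by $k\otimes_{\mathcal{O}}-$. *)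

(* Defs.v *)
From HB Require Import structures.
From mathcomp Require Import all_boot all_fingroup all_algebra all_solvable.
From mathcomp Require Import boolp classical_sets.
Set Implicit Arguments.
Unset Strict Implicit.
Unset Printing Implicit Defensive.
Import GRing.Theory.
Local Open Scope ring_scope.

(* The carrier of a [groupType] (or of any [choiceType]) lives in the universe
   of the carriers of the algebraic structures, so a group whose elements are
   classes of modules cannot be a [groupType]; hence this record.             *)
Record grp := Grp {
  gcar :> Type;
  gmul : gcar -> gcar -> gcar;
  gone : gcar;
  ginv : gcar -> gcar;
  gmulA : associative gmul;
  gmul1l : left_id gone gmul;
  gmulVl : left_inverse gone ginv gmul }.
Arguments gmul {_}.
Arguments gone {_}.
Arguments ginv {_}.

Definition gexp (G : grp) (x : G) (n : nat) : G := iter n (gmul x) gone.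

Definition group_hom (G H : grp) (f : G -> H) : Prop :=
  {morph f : x y / gmul x y}.

(* Exactness of 1 -> G -f-> H -g-> K. *)
Definition exact_seq (G H K : grp) (f : G -> H) (g : H -> K) : Prop :=
  injective f /\ forall y, g y = gone <-> exists x, f x = y.

Definition exponent_is (G : grp) (e : nat) : Prop :=
  [/\ (0 < e)%N, forall x : G, gexp x e = gone
    & forall n, (0 < n)%N -> (forall x : G, gexp x n = gone) -> (e <= n)%N].

Definition has_card (T : Type) (n : nat) : Prop :=
  exists f : 'I_n -> T, bijective f.

Definition finite_type (T : Type) : Prop := exists n, has_card T n.

Section Quotient.
Variables (T : Type) (E : T -> T -> Prop).

Definition quot := {C : T -> Prop | exists x, C = E x}.
Definition cls (x : T) : quot := exist _ (E x) (ex_intro _ x erefl).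
Definition rep (q : quot) : T := projT1 (cid (proj2_sig q)).

Lemma clsK q : cls (rep q) = q.
Proof.
rewrite /cls /rep; case: q => C hC /=; case: (cid hC) => x /= eC.
by apply: eq_exist; rewrite -eC.
Qed.

Hypotheses (Er : forall x, E x x) (Es : forall x y, E x y -> E y x)
           (Et : forall x y z, E x y -> E y z -> E x z).

Lemma cls_eq x y : E x y -> cls x = cls y.
Proof.
move=> xy; apply: eq_exist; apply/funext => z; apply/propext.
by split=> [xz|]; [apply: Et (Es xy) xz | apply: Et].
Qed.

Lemma cls_inj x y : cls x = cls y -> E x y.
Proof. by move=> [->]. Qed.

Lemma rep_cls x : E (rep (cls x)) x.
Proof. by apply: cls_inj; rewrite clsK. Qed.
End Quotient.

Section Ideals.
Variable R : comNzRingType.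

Definition ideal (I : set R) : Prop :=
  [/\ I 0, forall x y, I x -> I y -> I (x + y) & forall a x, I x -> I (a * x)].

Definition principal_ideal (a : R) : set R := [set x | exists y, x = a * y].

Definition principal_ideal_ring : Prop :=
  forall I, ideal I -> exists a, I = principal_ideal a.

Definition maximal_ideal (m : set R) : Prop :=
  [/\ ideal m, m <> setT &
      forall I, ideal I -> (m `<=` I)%classic -> I = m \/ I = setT].

Definition local_ring : Prop := exists! m, maximal_ideal m.

Definition jacobson_radical : set R :=
  [set x | forall m, maximal_ideal m -> m x].

(* Every Cauchy sequence for the a-adic topology has exactly one limit. *)
Definition adically_complete (a : R) : Prop :=
  (forall x, (forall r, principal_ideal (a ^+ r) x) -> x = 0) /\
  (forall u : nat -> R,
     (forall r, exists N, forall m n, (N <= m)%N -> (N <= n)%N ->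
        principal_ideal (a ^+ r) (u m - u n)) ->
     exists l, forall r, exists N, forall n, (N <= n)%N ->
        principal_ideal (a ^+ r) (u n - l)).
End Ideals.
Arguments jacobson_radical : clear implicits.

(* An R-algebra is a ring with a central structure map from R.  The library's
   [algType] requires 1 != 0, which cannot be decided for a scalar extension
   without further hypotheses.                                                *)
Record algebra (R : comNzRingType) := Algebra {
  alg_car :> pzRingType;
  alg_map : {rmorphism R -> alg_car};
  alg_centr : forall c a, alg_map c * a = a * alg_map c }.
Arguments alg_map {R} _.

Section Tensor.
Variables (S : Type) (M N : zmodType) (ra : M -> S -> M) (la : S -> N -> N).

(* [:: (x1, y1); ..; (xn, yn)] stands for x1 (x) y1 + ... + xn (x) yn; the
   opposite of x (x) y is (- x) (x) y.                                        *)
Inductive tens_rel : seq (M * N) -> seq (M * N) -> Prop :=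
| tens_rel_refl s : tens_rel s s
| tens_rel_sym s t : tens_rel s t -> tens_rel t s
| tens_rel_trans s t u : tens_rel s t -> tens_rel t u -> tens_rel s u
| tens_rel_cat s s' t t' :
    tens_rel s s' -> tens_rel t t' -> tens_rel (s ++ t) (s' ++ t')
| tens_rel_comm s t : tens_rel (s ++ t) (t ++ s)
| tens_rel_0l y : tens_rel [:: (0, y)] [::]
| tens_rel_Dl x x' y : tens_rel [:: (x + x', y)] [:: (x, y); (x', y)]
| tens_rel_Dr x y y' : tens_rel [:: (x, y + y')] [:: (x, y); (x, y')]
| tens_rel_bal x c y : tens_rel [:: (ra x c, y)] [:: (x, la c y)].

Definition tensor := quot tens_rel.

Definition tens (x : M) (y : N) : tensor := cls tens_rel [:: (x, y)].

Let opp_seq (s : seq (M * N)) := [seq (- p.1, p.2) | p <- s].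

Definition tens_add (u v : tensor) : tensor := cls _ (rep u ++ rep v).
Definition tens_opp (u : tensor) : tensor := cls _ (opp_seq (rep u)).

Let ceq s t : tens_rel s t -> cls tens_rel s = cls tens_rel t.
Proof. by apply: cls_eq; [apply: tens_rel_sym | apply: tens_rel_trans]. Qed.

Let cinj s t : cls tens_rel s = cls tens_rel t -> tens_rel s t.
Proof. by apply: cls_inj; apply: tens_rel_refl. Qed.

Let repc s : tens_rel (rep (cls tens_rel s)) s.
Proof. by apply: rep_cls; apply: tens_rel_refl. Qed.

Let addc s t : tens_add (cls _ s) (cls _ t) = cls _ (s ++ t).
Proof. by apply: ceq; apply: tens_rel_cat; apply: repc. Qed.

Let addA : associative tens_add.
Proof.
by move=> u v w; rewrite -(clsK u) -(clsK v) -(clsK w) !addc catA.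
Qed.
Let addC : commutative tens_add.
Proof.
move=> u v; rewrite -(clsK u) -(clsK v) !addc; apply: ceq.
exact: tens_rel_comm.
Qed.
Let opp_can s : cls tens_rel (opp_seq s ++ s) = cls tens_rel [::].
Proof.
elim: s => [|[x y] s IH] //.
have -> : opp_seq ((x, y) :: s) ++ (x, y) :: s =
  ([:: (- x, y)] ++ opp_seq s) ++ ([:: (x, y)] ++ s) by [].
rewrite -!addc -addA (addA (cls _ (opp_seq s))) (addC (cls _ (opp_seq s))).
rewrite -(addA (cls _ [:: (x, y)])) (addc (opp_seq s)) IH addA addc.
have -> : cls tens_rel ([:: (- x, y)] ++ [:: (x, y)]) = cls _ [::].
  apply: ceq; apply: tens_rel_trans (tens_rel_sym (tens_rel_Dl _ _ _)) _.
  by rewrite addNr; apply: tens_rel_0l.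
by rewrite addc.
Qed.

Let add0 : left_id (cls tens_rel [::]) tens_add.
Proof. by move=> u; rewrite -(clsK u) addc. Qed.
Let addN : left_inverse (cls tens_rel [::]) tens_opp tens_add.
Proof.
move=> u; rewrite -{2}(clsK u) /tens_opp addc; exact: opp_can.
Qed.

HB.instance Definition _ := gen_eqMixin tensor.
HB.instance Definition _ := gen_choiceMixin tensor.
HB.instance Definition _ := GRing.isZmodule.Build tensor addA addC add0 addN.

Lemma tensDl x x' y : tens (x + x') y = tens x y + tens x' y.
Proof. rewrite /tens [RHS]addc; apply: ceq; exact: tens_rel_Dl. Qed.

Lemma tensDr x y y' : tens x (y + y') = tens x y + tens x y'.
Proof. rewrite /tens [RHS]addc; apply: ceq; exact: tens_rel_Dr. Qed.

Lemma tens_bal x c y : tens (ra x c) y = tens x (la c y).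
Proof. apply: ceq; exact: tens_rel_bal. Qed.

Lemma tens_ind (Q : tensor -> Prop) :
  (forall x y, Q (tens x y)) -> (forall u v, Q u -> Q v -> Q (u + v)) ->
  forall u, Q u.
Proof.
move=> Qt QD u; rewrite -(clsK u).

elim: (rep u) => [|[x y] s IH].
  rewrite (_ : cls _ _ = tens 0 0) //.
  by apply: ceq; apply: tens_rel_sym; apply: tens_rel_0l.
by rewrite -cat1s -addc; apply: (QD (tens x y) (cls _ s)).
Qed.

Definition balanced (V : zmodType) (f : M -> N -> V) : Prop :=
  [/\ forall x x' y, f (x + x') y = f x y + f x' y,
      forall x y y', f x (y + y') = f x y + f x y'
    & forall x c y, f (ra x c) y = f x (la c y)].

Definition tens_lift (V : zmodType) (f : M -> N -> V) (u : tensor) : V :=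
  \sum_(p <- rep u) f p.1 p.2.

Section Lift.
Variables (V : zmodType) (f : M -> N -> V).
Hypothesis hf : balanced f.

Let liftc s : tens_lift f (cls _ s) = \sum_(p <- s) f p.1 p.2.
Proof.
rewrite /tens_lift; case: hf => fDl fDr fb.
move: (repc s); set r := rep _; clearbody r; elim=> {s r} //=.
- by move=> s t u _ -> _ ->.
- by move=> s s' t t' _ e _ e'; rewrite !big_cat /= e e'.
- by move=> s t; rewrite !big_cat /= addrC.
- move=> y; rewrite big_nil big_seq1 /=.
  by apply: (@addrI _ (f 0 y)); rewrite -fDl !addr0.
- by move=> x x' y; rewrite !big_cons !big_nil !addr0 /= fDl.
- by move=> x x' y; rewrite !big_cons !big_nil !addr0 /= fDr.
- by move=> x c y; rewrite !big_seq1 /= fb.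
Qed.

Lemma tens_liftE x y : tens_lift f (tens x y) = f x y.
Proof. by rewrite liftc big_seq1. Qed.

Lemma tens_liftD u v : tens_lift f (u + v) = tens_lift f u + tens_lift f v.
Proof.
by rewrite -(clsK u) -(clsK v) [_ + _]addc !liftc big_cat.
Qed.
End Lift.
End Tensor.

Section TensorExt.
Variables (S : Type) (M N : zmodType) (ra : M -> S -> M) (la : S -> N -> N).

Lemma tens_ext (V : zmodType) (f g : tensor ra la -> V) :
  {morph f : u v / u + v} -> {morph g : u v / u + v} ->
  (forall x y, f (tens ra la x y) = g (tens ra la x y)) -> f =1 g.
Proof. by move=> fD gD fg; apply: tens_ind => // u v eu ev; rewrite fD gD eu ev. Qed.
End TensorExt.

Section LinearFacts.
Variables (A : pzRingType) (X Y Z : lmodType A).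

Lemma linD (f : X -> Y) : linear f -> {morph f : u v / u + v}.
Proof. by move=> hf u v; have := hf 1 u v; rewrite !scale1r. Qed.

Lemma linZ (f : X -> Y) a u : linear f -> f (a *: u) = a *: f u.
Proof.
move=> hf; have f0 : f 0 = 0.
  by apply: (@addrI _ (f 0)); rewrite -(linD hf) !addr0.
by have := hf a u 0; rewrite !addr0 f0 addr0.
Qed.

Lemma linDZ (f : X -> Y) :
  {morph f : u v / u + v} -> (forall a u, f (a *: u) = a *: f u) -> linear f.
Proof. by move=> fD fZ a u v; rewrite fD fZ. Qed.

Lemma lin_comp (f : Y -> Z) (g : X -> Y) : linear f -> linear g -> linear (f \o g).
Proof. by move=> hf hg a u v /=; rewrite hg hf. Qed.

Lemma lin_inv (f : X -> Y) g : linear f -> cancel f g -> cancel g f -> linear g.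
Proof. by move=> hf fK gK a u v; rewrite -{1}(gK u) -{1}(gK v) -hf fK. Qed.
End LinearFacts.

Section Bimodules.
Variables (R : comNzRingType) (A : algebra R).

(* R acts in the same way on both sides. *)
Record bimod := Bimod {
  bm_car :> lmodType A;
  ract : bm_car -> A -> bm_car;
  ractDl : forall x y a, ract (x + y) a = ract x a + ract y a;
  ractDr : forall x a b, ract x (a + b) = ract x a + ract x b;
  ract1 : forall x, ract x 1 = x;
  ractM : forall x a b, ract x (a * b) = ract (ract x a) b;
  ractZ : forall x a b, ract (a *: x) b = a *: ract x b;
  ract_centr : forall x c, alg_map A c *: x = ract x (alg_map A c) }.

Definition bimod_iso (M N : bimod) : Prop :=
  exists f : M -> N,
    [/\ linear f, bijective f & forall x a, f (ract x a) = ract (f x) a].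

Lemma bimod_iso_refl M : bimod_iso M M.
Proof. by exists idfun; split=> //; exists idfun. Qed.

Lemma bimod_iso_sym M N : bimod_iso M N -> bimod_iso N M.
Proof.
case=> f [fl [g fK gK] fr]; exists g; split; first exact: lin_inv fK gK.
  by exists f.
by move=> x a; apply: (can_inj fK); rewrite fr !gK.
Qed.

Lemma bimod_iso_trans M N Q : bimod_iso M N -> bimod_iso N Q -> bimod_iso M Q.
Proof.
case=> f [fl fb fr] [g [gl gb gr]]; exists (g \o f).
split; [exact: lin_comp | exact: bij_comp | by move=> x a /=; rewrite fr gr].
Qed.

Definition reg_bimod : bimod.
Proof.
apply: (@Bimod A^o (fun x a => x * a)) => /=.
- by move=> x y a; rewrite mulrDl.
- by move=> x a b; rewrite mulrDr.
- by move=> x; rewrite mulr1.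
- by move=> x a b; rewrite mulrA.
- by move=> x a b; apply: (esym (mulrA a x b)).
- by move=> x c; apply: alg_centr.
Defined.

Definition btens (M : bimod) (X : lmodType A) : Type :=
  tensor (@ract M) (fun (a : A) (x : X) => a *: x).
HB.instance Definition _ M X := GRing.Zmodule.on (btens M X).

Definition bt (M : bimod) (X : lmodType A) (m : M) (x : X) : btens M X :=
  tens _ _ m x.

Section Btens.
Variables (M : bimod) (X : lmodType A).

Let bal (V : zmodType) := @balanced _ _ _ (@ract M) (fun a (x : X) => a *: x) V.

Definition bt_scale (a : A) : btens M X -> btens M X :=
  tens_lift (fun m x => bt (a *: m) x).

Let scale_bal a : bal (fun m x => bt (a *: m) x).
Proof.
split=> *; first by rewrite scalerDr [LHS]tensDl.
  by rewrite [LHS]tensDr.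
by rewrite -ractZ [LHS]tens_bal.
Qed.

Let scE a m x : bt_scale a (bt m x) = bt (a *: m) x.
Proof. exact: (tens_liftE (scale_bal a)). Qed.

Let scD a : {morph bt_scale a : u v / u + v}.
Proof. exact: (tens_liftD (scale_bal a)). Qed.

Let scA a b u : bt_scale a (bt_scale b u) = bt_scale (a * b) u.
Proof.
move: u; apply: tens_ext => [u v|u v|m x]; rewrite ?scD //.
by rewrite !scE scalerA.
Qed.

Let sc1 : left_id 1 bt_scale.
Proof.
apply: tens_ext => [u v|u v|m x]; rewrite ?scD //.
by rewrite scE scale1r.
Qed.

Let scDl u : {morph bt_scale^~ u : a b / a + b}.
Proof.
move=> a b; move: u; apply: tens_ext => [u v|u v|m x]; rewrite ?scD //.
  by rewrite addrACA.
by rewrite !scE scalerDl [LHS]tensDl.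
Qed.

HB.instance Definition _ :=
  GRing.Zmodule_isLmodule.Build A (btens M X) scA sc1 scD scDl.

Lemma btZ a m x : a *: bt m x = bt (a *: m) x :> btens M X.
Proof. exact: scE. Qed.
End Btens.

Lemma btDl (M : bimod) (X : lmodType A) (m m' : M) (x : X) : bt (m + m') x = bt m x + bt m' x.
Proof. exact: tensDl. Qed.
Lemma btDr (M : bimod) (X : lmodType A) (m : M) (x x' : X) : bt m (x + x') = bt m x + bt m x'.
Proof. exact: tensDr. Qed.
Lemma bt_bal (M : bimod) (X : lmodType A) (m : M) a (x : X) : bt (ract m a) x = bt m (a *: x).
Proof. exact: tens_bal. Qed.

Definition bt_lift (M : bimod) (X : lmodType A) (V : zmodType) (f : M -> X -> V) : btens M X -> V :=
  tens_lift f.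

Definition bt_balanced (M : bimod) (X : lmodType A) (V : zmodType) (f : M -> X -> V) : Prop :=
  balanced (@ract M) (fun a (x : X) => a *: x) f.

Lemma bt_liftE (M : bimod) (X : lmodType A) (V : zmodType) (f : M -> X -> V) m x :
  bt_balanced f -> bt_lift f (bt m x) = f m x.
Proof. by move=> hf; apply: (tens_liftE hf). Qed.

Lemma bt_liftD (M : bimod) (X : lmodType A) (V : zmodType) (f : M -> X -> V) :
  bt_balanced f -> {morph bt_lift f : u v / u + v}.
Proof. by move=> hf u v; apply: (tens_liftD hf). Qed.

Lemma bt_ext (M : bimod) (X : lmodType A) (V : zmodType) (f g : btens M X -> V) :
  {morph f : u v / u + v} -> {morph g : u v / u + v} ->
  (forall m x, f (bt m x) = g (bt m x)) -> f =1 g.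
Proof. exact: tens_ext. Qed.

Lemma bt_lift_lin (M : bimod) (X : lmodType A) (V : lmodType A) (f : M -> X -> V) :
  bt_balanced f -> (forall a m x, f (a *: m) x = a *: f m x) ->
  linear (bt_lift f).
Proof.
move=> hf fZ; apply: linDZ (bt_liftD hf) _ => a.
apply: bt_ext => [u v|u v|m x]; rewrite ?scalerDr ?bt_liftD ?scalerDr //.
by rewrite btZ !bt_liftE.
Qed.

Definition btens_map (M : bimod) (X Y : lmodType A) (h : X -> Y) : btens M X -> btens M Y :=
  bt_lift (fun m x => bt m (h x)).
Arguments btens_map M {X Y} h.

Section BtensMap.
Variables (M : bimod) (X Y : lmodType A) (h : X -> Y).
Hypothesis hl : linear h.

Let map_bal : bt_balanced (fun (m : M) x => bt m (h x)).
Proof.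
split=> [m m' x|m x x'|m a x].
- exact: btDl.
- by rewrite (linD hl) btDr.
- by rewrite (linZ _ _ hl) bt_bal.
Qed.

Lemma btens_mapE (m : M) (x : X) : btens_map M h (bt m x) = bt m (h x).
Proof. exact: bt_liftE. Qed.

Lemma btens_map_lin : linear (btens_map M h).
Proof. by apply: bt_lift_lin => // a m x; rewrite btZ. Qed.
End BtensMap.

Lemma btens_map_comp (M : bimod) (X Y Z : lmodType A) (h : Y -> Z) (g : X -> Y) :
  linear h -> linear g ->
  btens_map M (h \o g) =1 btens_map M h \o btens_map M g.
Proof.
move=> hl gl; have cl := lin_comp hl gl.
apply: bt_ext => [||m x]; rewrite /= ?btens_mapE //;
  by apply: linD; do ?apply: lin_comp; apply: btens_map_lin.
Qed.

Lemma btens_map_id (M : bimod) (X : lmodType A) : @btens_map M X X idfun =1 idfun.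
Proof.
have il : linear (@idfun X) by [].
apply: bt_ext => [||m x] //; last by rewrite btens_mapE.
by apply: linD; apply: btens_map_lin.
Qed.

Lemma eq_btens_map (M : bimod) (X Y : lmodType A) (h h' : X -> Y) :
  h =1 h' -> btens_map M h =1 btens_map M h'.
Proof. by move=> /funext ->. Qed.

Arguments btens_map_comp M {X Y Z h g}.
Arguments btens_map_lin M {X Y h}.
Arguments eq_btens_map M {X Y h}.

(* The functor M (x)_A - from Mod(A) to Mod(A) is an equivalence. *)
Definition induces_morita (M : bimod) : Prop :=
  [/\ forall (X Y : lmodType A) (h h' : X -> Y), linear h -> linear h' ->
        btens_map M h =1 btens_map M h' -> h =1 h',
      forall (X Y : lmodType A) (g : btens M X -> btens M Y), linear g ->
        exists2 h : X -> Y, linear h & btens_map M h =1 g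
    & forall Y : lmodType A, exists (X : lmodType A) (g : btens M X -> Y),
        linear g /\ bijective g].

Definition lin_iso (X Y : lmodType A) (f : X -> Y) := linear f /\ bijective f.

Let lin_iso_comp (X Y Z : lmodType A) (f : Y -> Z) (g : X -> Y) :
  lin_iso f -> lin_iso g -> lin_iso (f \o g).
Proof. by case=> fl fb [gl gb]; split; [apply: lin_comp | apply: bij_comp]. Qed.

Let lin_iso_inv (X Y : lmodType A) (f : X -> Y) :
  lin_iso f -> exists g, [/\ lin_iso g, cancel f g & cancel g f].
Proof.
case=> fl [g fK gK]; exists g; split=> //; split; last by exists f.
exact: lin_inv fK gK.
Qed.

Let btens_map_lin_iso (M : bimod) (X Y : lmodType A) (h : X -> Y) :
  lin_iso h -> lin_iso (btens_map M h).
Proof.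
case=> hl [g hK gK]; split; first exact: btens_map_lin.
have gl := lin_inv hl hK gK.
exists (btens_map M g) => u.
  rewrite -[LHS](btens_map_comp M gl hl) (eq_btens_map M idfun) //.
  exact: btens_map_id.
rewrite -[LHS](btens_map_comp M hl gl) (eq_btens_map M idfun) //.
exact: btens_map_id.
Qed.

Section Product.
Variables (M N : bimod).

Let ra (a : A) (u : btens M N) : btens M N := btens_map M (fun n => ract n a) u.

Let rl a : linear (fun n : N => ract n a).
Proof. by apply: linDZ => [u v|b u]; rewrite (ractDl, ractZ). Qed.

Let raD a : {morph ra a : u v / u + v}.
Proof. by apply: linD; apply: btens_map_lin. Qed.

Let raE a (m : M) (n : N) : ra a (bt m n) = bt m (ract n a).
Proof. exact: btens_mapE (rl a) _ _. Qed.

Definition bimod_mul : bimod.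
Proof.
apply: (@Bimod (btens M N) (fun u a => ra a u)) => [u v a|u a b|u|u a b|u a b|u c].
- exact: raD.
- move: u; apply: bt_ext => [u v|u v|m n]; rewrite ?raD //.
    by rewrite addrACA.
  by rewrite !raE ractDr btDr.
- move: u; apply: bt_ext => [u v|u v|m n]; rewrite ?raD //.
  by rewrite raE ract1.
- move: u; apply: bt_ext => [u v|u v|m n]; rewrite ?raD //.
  by rewrite !raE ractM.
- exact: linZ (btens_map_lin M (rl b)).
- move: u; apply: bt_ext => [u v|u v|m n]; rewrite ?raD ?scalerDr //.
  by rewrite raE btZ ract_centr bt_bal ract_centr.
Defined.

Lemma bimod_mulE (m : M) (n : N) a :
  @ract bimod_mul (bt m n) a = bt m (ract n a).
Proof. exact: raE. Qed.
End Product.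

Section Unitors.

Let ul (X : lmodType A) : btens reg_bimod X -> X := bt_lift (M := reg_bimod) (fun (a : A) x => a *: x).

Let ul_bal (X : lmodType A) : bt_balanced (M := reg_bimod) (fun (a : A) (x : X) => a *: x).
Proof.
by split=> [a b x|a x y|a c x] /=; rewrite ?scalerDl ?scalerDr ?scalerA.
Qed.

Lemma unitl_lin_iso (X : lmodType A) : exists f : btens reg_bimod X -> X,
  lin_iso f /\ forall (a : A) x, f (bt (a : reg_bimod) x) = a *: x.
Proof.
have ulE (a : A) x : @ul X (bt (a : reg_bimod) x) = a *: x by apply: bt_liftE (ul_bal X).
have ll : linear (@ul X).
  by apply: bt_lift_lin => [|a b x]; [apply: ul_bal | rewrite scalerA].
exists (@ul X); split=> //; split=> //.
exists (fun x => bt (1 : reg_bimod) x) => [u|x]; last by rewrite ulE scale1r.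
move: u; apply: bt_ext => [u v|//|a x]; first by rewrite (linD ll) btDr.
by rewrite ulE -bt_bal /= mul1r.
Qed.

Lemma unitr_lin_iso (M : bimod) : exists f : btens M reg_bimod -> M,
  lin_iso f /\ forall m (a : A), f (bt m (a : reg_bimod)) = ract m a.
Proof.
pose f : btens M reg_bimod -> M := bt_lift (X := reg_bimod) (fun m (a : A) => ract m a).
have fb : bt_balanced (X := reg_bimod) (fun (m : M) (a : A) => ract m a).
  by split=> [m m' a|m a a'|m a b]; rewrite ?ractDl ?ractDr -?ractM.
have fE m (a : A) : f (bt m (a : reg_bimod)) = ract m a by apply: bt_liftE.
have fl : linear f by apply: bt_lift_lin => // a m x; apply: ractZ.
exists f; split=> //; split=> //.
exists (fun m => bt m (1 : reg_bimod)) => [u|m]; last by rewrite fE ract1.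
move: u; apply: bt_ext => [u v|//|m a]; first by rewrite (linD fl) btDl.
rewrite fE bt_bal; congr bt; exact: mulr1.
Qed.
End Unitors.

Lemma assoc_lin_iso (M N : bimod) (X : lmodType A) :
  exists f : btens (bimod_mul M N) X -> btens M (btens N X),
    lin_iso f /\ forall m n x,
      f (bt (bt m n : bimod_mul M N) x) = bt m (bt n x).
Proof.
pose f1 (x : X) : btens M N -> btens M (btens N X) :=
  bt_lift (fun m n => bt m (bt n x)).
have b1 (x : X) : bt_balanced (fun (m : M) (n : N) => bt m (bt n x)).
  by split=> *; rewrite ?btDl ?btDr // bt_bal btZ.
have f1E x m n : f1 x (bt m n) = bt m (bt n x).
  exact: bt_liftE (b1 x).
have f1l x : linear (f1 x).
  by apply: bt_lift_lin (b1 x) _ => a m n; rewrite btZ.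
pose f : btens (bimod_mul M N) X -> btens M (btens N X) :=
  bt_lift (M := bimod_mul M N) (fun (u : btens M N) x => f1 x u).
have fb : bt_balanced (M := bimod_mul M N) (fun (u : btens M N) x => f1 x u).
  split=> [u v x|u x y|u a x]; first exact: (linD (f1l x)).
    move: u; apply: bt_ext => [u v|u v|m n]; rewrite ?(linD (f1l _)) //.
      by rewrite addrACA.
    by rewrite !f1E !btDr.
  move: u; apply: bt_ext => [u v|u v|m n]; rewrite ?ractDl ?(linD (f1l _)) //.
  by rewrite bimod_mulE !f1E bt_bal.
have fE m n x : f (bt (bt m n : bimod_mul M N) x) = bt m (bt n x).
  by rewrite [LHS](bt_liftE _ _ fb) f1E.
have fl : linear f.
  by apply: bt_lift_lin => // a u x; apply: (linZ _ _ (f1l x)).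
pose g1 (m : M) : btens N X -> btens (bimod_mul M N) X :=
  bt_lift (fun n x => bt (bt m n : bimod_mul M N) x).
have c1 m : bt_balanced (fun (n : N) (x : X) => bt (bt m n : bimod_mul M N) x).
  split=> [n n' x|n x y|n a x]; first by rewrite btDr btDl.
    by rewrite btDr.
  by rewrite -bimod_mulE bt_bal.
have g1E m n x : g1 m (bt n x) = bt (bt m n : bimod_mul M N) x.
  exact: bt_liftE (c1 m).
have g1D m : {morph g1 m : u v / u + v} by apply: bt_liftD (c1 m).
pose g : btens M (btens N X) -> btens (bimod_mul M N) X := bt_lift g1.
have gb : bt_balanced g1.
  split=> [m m' u|m u v|m a u]; last 2 first.
  - exact: g1D.
  - move: u; apply: bt_ext => [u v|u v|n x]; rewrite ?scalerDr ?g1D //.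
    by rewrite btZ !g1E bt_bal.
  move: u; apply: bt_ext => [u v|u v|n x]; rewrite ?g1D //.
    by rewrite addrACA.
  by rewrite !g1E btDl btDl.
have gE m u : g (bt m u) = g1 m u by apply: bt_liftE.
have gD : {morph g : u v / u + v} by apply: bt_liftD.
exists f; split=> //; split=> //; exists g.
- apply: bt_ext => [u v|//|w x]; first by rewrite (linD fl) gD.
  move: w; apply: (@bt_ext M N) => [w w'|w w'|m n].
  + by rewrite btDl (linD fl) gD.
  + by rewrite btDl.
  + by rewrite fE gE g1E.
- apply: bt_ext => [u v|//|m u]; first by rewrite gD (linD fl).
  move: u; apply: bt_ext => [w w'|w w'|n x].
  + by rewrite btDr gD (linD fl).
  + by rewrite btDr.
  + by rewrite gE g1E fE.
Qed.

#[local] Arguments bimod_mul : simpl never.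
#[local] Arguments reg_bimod : simpl never.
#[local] Arguments ract : simpl never.

Lemma bimod_mulA (M N Q : bimod) :
  bimod_iso (bimod_mul (bimod_mul M N) Q) (bimod_mul M (bimod_mul N Q)).
Proof.
have [f [[fl fb] fE]] := assoc_lin_iso M N Q; exists f; split=> // u a.
have D1 : {morph f \o (@ract (bimod_mul (bimod_mul M N) Q))^~ a : u v / u + v}.
  by move=> v w /=; rewrite ractDl (linD fl).
have D2 : {morph (@ract (bimod_mul M (bimod_mul N Q)))^~ a \o f : u v / u + v}.
  by move=> v w /=; rewrite (linD fl) ractDl.
apply: (bt_ext D1 D2) => w q /=; rewrite bimod_mulE; move: w.
apply: (@bt_ext M N) => [v w|v w|m n].
- by rewrite btDl (linD fl).
- by rewrite btDl (linD fl) ractDl.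
- by rewrite !fE !bimod_mulE.
Qed.

Lemma bimod_mul1l (M : bimod) : bimod_iso (bimod_mul reg_bimod M) M.
Proof.
have [f [[fl fb] fE]] := unitl_lin_iso M; exists f; split=> // u a.
have D1 : {morph f \o (@ract (bimod_mul reg_bimod M))^~ a : u v / u + v}.
  by move=> v w /=; rewrite ractDl (linD fl).
have D2 : {morph (@ract M)^~ a \o f : u v / u + v}.
  by move=> v w /=; rewrite (linD fl) ractDl.
by apply: (bt_ext D1 D2) => b m /=; rewrite bimod_mulE !fE ractZ.
Qed.

Lemma bimod_mul1r (M : bimod) : bimod_iso (bimod_mul M reg_bimod) M.
Proof.
have [f [[fl fb] fE]] := unitr_lin_iso M; exists f; split=> // u a.
have D1 : {morph f \o (@ract (bimod_mul M reg_bimod))^~ a : u v / u + v}.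
  by move=> v w /=; rewrite ractDl (linD fl).
have D2 : {morph (@ract M)^~ a \o f : u v / u + v}.
  by move=> v w /=; rewrite (linD fl) ractDl.
by apply: (bt_ext D1 D2) => m b /=; rewrite bimod_mulE !fE ractM.
Qed.

Lemma bimod_mul_isor (M N N' : bimod) :
  bimod_iso N N' -> bimod_iso (bimod_mul M N) (bimod_mul M N').
Proof.
case=> f [fl fb fr]; have [hl hb] := btens_map_lin_iso M (conj fl fb : lin_iso f).
exists (btens_map M f); split; [exact: hl | exact: hb | move=> u a].
have D1 : {morph btens_map M f \o (@ract (bimod_mul M N))^~ a : u v / u + v}.
  by move=> v w /=; rewrite ractDl (linD hl).
have D2 : {morph (@ract (bimod_mul M N'))^~ a \o btens_map M f : u v / u + v}.
  by move=> v w /=; rewrite (linD hl) ractDl.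
apply: (bt_ext D1 D2) => m b /=.
by rewrite bimod_mulE !btens_mapE // bimod_mulE fr.
Qed.

Lemma btens_isol (M M' : bimod) : bimod_iso M M' ->
  exists f : forall X, btens M X -> btens M' X,
    [/\ forall X, lin_iso (f X),
        forall (X Y : lmodType A) (h : X -> Y), linear h ->
          btens_map M' h \o f X =1 f Y \o btens_map M h
      & forall (N : bimod) u a,
          f N (@ract (bimod_mul M N) u a) = @ract (bimod_mul M' N) (f N u) a].
Proof.
pose F (M M' : bimod) (g : M -> M') X : btens M X -> btens M' X :=
  bt_lift (fun m x => bt (g m) x).
have bal (M1 M2 : bimod) (g : M1 -> M2) (X : lmodType A) : linear g ->
    (forall m a, g (ract m a) = ract (g m) a) ->
    bt_balanced (fun m (x : X) => bt (g m) x).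
  move=> gl gr; split=> [m m' x|m x x'|m a x].
  - by rewrite (linD gl) btDl.
  - by rewrite btDr.
  - by rewrite gr bt_bal.
case=> g [gl [g' gK g'K] gr]; have gl' := lin_inv gl gK g'K.
have gr' m a : g' (ract m a) = ract (g' m) a.
  by apply: (can_inj gK); rewrite gr !g'K.
have FE (X : lmodType A) m (x : X) : F _ _ g X (bt m x) = bt (g m) x.
  exact: bt_liftE (bal _ _ _ _ gl gr).
have FE' (X : lmodType A) m (x : X) : F _ _ g' X (bt m x) = bt (g' m) x.
  exact: bt_liftE (bal _ _ _ _ gl' gr').
have Fl X : linear (F _ _ g X).
  by apply: bt_lift_lin (bal _ _ _ _ gl gr) _ => a m x; rewrite btZ (linZ _ _ gl).
have FD' X : {morph F _ _ g' X : u v / u + v}.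
  exact: bt_liftD (bal _ _ _ _ gl' gr').
exists (F _ _ g); split=> [X|X Y h hl|N].
- split; first exact: Fl.
  exists (F _ _ g' X) => u; move: u; apply: bt_ext => [u v|//|m x].
  + by rewrite (linD (Fl X)) FD'.
  + by rewrite FE FE' gK.
  + by rewrite FD' (linD (Fl X)).
  + by rewrite FE' FE g'K.
- have ml := btens_map_lin M hl; have ml' := btens_map_lin M' hl.
  apply: bt_ext => [u v|u v|m x] /=.
  + by rewrite (linD (Fl X)) (linD ml').
  + by rewrite (linD ml) (linD (Fl Y)).
  + by rewrite !(FE, btens_mapE).
- move=> u a; have D1 : {morph F _ _ g N \o
      (@ract (bimod_mul M N))^~ a : u v / u + v}.
    by move=> v w /=; rewrite ractDl (linD (Fl N)).
  have D2 : {morph (@ract (bimod_mul M' N))^~ a \o F _ _ g N : u v / u + v}.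
    by move=> v w /=; rewrite (linD (Fl N)) ractDl.
  apply: (bt_ext D1 D2) => m b /=.
  by rewrite bimod_mulE !FE bimod_mulE.
Qed.

Lemma bimod_mul_isol (M M' N : bimod) :
  bimod_iso M M' -> bimod_iso (bimod_mul M N) (bimod_mul M' N).
Proof.
case/btens_isol=> f [fl _ fr]; have [hl hb] := fl N.
by exists (f N); split=> //; apply: fr.
Qed.

Lemma bimod_mul_iso (M M' N N' : bimod) :
  bimod_iso M M' -> bimod_iso N N' ->
  bimod_iso (bimod_mul M N) (bimod_mul M' N').
Proof.
move=> /(bimod_mul_isol N) iM /(bimod_mul_isor M') iN.
exact: bimod_iso_trans iM iN.
Qed.

Lemma assoc_nat (M N : bimod) :
  exists f : forall X, btens (bimod_mul M N) X -> btens M (btens N X),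
    (forall X, lin_iso (f X)) /\
    forall (X Y : lmodType A) (h : X -> Y), linear h ->
      btens_map M (btens_map N h) \o f X =1
      f Y \o btens_map (bimod_mul M N) h.
Proof.
pose f X := projT1 (cid (assoc_lin_iso M N X)).
have fP X : lin_iso (f X) /\ forall m n x,
    f X (bt (bt m n : bimod_mul M N) x) = bt m (bt n x).
  exact: projT2 (cid (assoc_lin_iso M N X)).
exists f; split=> [X|X Y h hl]; first by case: (fP X).
have [[fXl _] fXE] := fP X; have [[fYl _] fYE] := fP Y.
have nl := btens_map_lin N hl; have ml := btens_map_lin M nl.
have pl := btens_map_lin (bimod_mul M N) hl.
apply: bt_ext => [u v|u v|w x] /=.
- by rewrite (linD fXl) (linD ml).
- by rewrite (linD pl) (linD fYl).
move: w; apply: (@bt_ext M N) => [v w|v w|m n].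
- by rewrite btDl (linD fXl) (linD ml).
- by rewrite btDl (linD pl) (linD fYl).
by rewrite fXE !btens_mapE // fYE.
Qed.

Lemma unitl_nat : exists f : forall X, btens reg_bimod X -> X,
  (forall X, lin_iso (f X)) /\
  forall (X Y : lmodType A) (h : X -> Y), linear h ->
    h \o f X =1 f Y \o btens_map reg_bimod h.
Proof.
pose f X := projT1 (cid (unitl_lin_iso X)).
have fP X : lin_iso (f X) /\ forall (a : A) x, f X (bt (a : reg_bimod) x) = a *: x.
  exact: projT2 (cid (unitl_lin_iso X)).
exists f; split=> [X|X Y h hl]; first by case: (fP X).
have [[fXl _] fXE] := fP X; have [[fYl _] fYE] := fP Y.
have pl := btens_map_lin reg_bimod hl.
apply: bt_ext => [u v|u v|a x] /=.
- by rewrite (linD fXl) (linD hl).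
- by rewrite (linD pl) (linD fYl).
by rewrite fXE btens_mapE // fYE (linZ _ _ hl).
Qed.

Lemma morita_reg : induces_morita reg_bimod.
Proof.
have [f [fl fn]] := unitl_nat; split=> [X Y h h' hl hl' e x|X Y g gl|Y].
- have [_ [fi fK fiK]] := fl X.
  by rewrite -(fiK x) [LHS](fn X Y h) // [RHS](fn X Y h') //= e.
- have [fi [[fil _] fK fiK]] := lin_iso_inv (fl X).
  exists (f Y \o g \o fi).
    by apply: lin_comp => //; apply: lin_comp => //; case: (fl Y).
  have hl : linear (f Y \o g \o fi).
    by apply: lin_comp => //; apply: lin_comp => //; case: (fl Y).
  move=> u; apply: (bij_inj (proj2 (fl Y))).
  by rewrite -[LHS](fn _ _ _ hl) /= fK.
- by exists Y, (f Y); apply: fl.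
Qed.

Lemma morita_mul (M N : bimod) :
  induces_morita M -> induces_morita N -> induces_morita (bimod_mul M N).
Proof.
move=> [Mi Ms Me] [Ni Ns Ne]; have [f [fl fn]] := assoc_nat M N.
split=> [X Y h h' hl hl' e|X Y g gl|Y].
- apply: Ni => //; apply: Mi; try exact: btens_map_lin.
  have [_ [fi fK fiK]] := fl X => u.
  by rewrite -(fiK u) [LHS](fn X Y h) // [RHS](fn X Y h') //= e.
- have [fi [[fil _] fK fiK]] := lin_iso_inv (fl X).
  have [h1 h1l e1] : exists2 h, linear h & btens_map M h =1 f Y \o g \o fi.
    by apply: Ms; apply: lin_comp => //; apply: lin_comp => //; case: (fl Y).
  have [h hl e] := Ns _ _ _ h1l; exists h => // u.
  apply: (bij_inj (proj2 (fl Y))).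
  rewrite -[LHS](fn _ _ _ hl) /= (eq_btens_map M _ e) e1 /= fK.
  by [].
- have [Z [g [gl gb]]] := Me Y; have [X [h [hl hb]]] := Ne Z.
  have mi : lin_iso (btens_map M h) by apply: btens_map_lin_iso.
  exists X, (g \o btens_map M h \o f X).
  by apply: lin_iso_comp (fl X); apply: lin_iso_comp mi.
Qed.

Lemma morita_lift_iso (M : bimod) (X Y : lmodType A)
    (g : btens M X -> btens M Y) : induces_morita M -> lin_iso g ->
  exists2 h : X -> Y, lin_iso h & btens_map M h =1 g.
Proof.
move=> [Mi Ms _] gi; have [g' [[gl' _] gK g'K]] := lin_iso_inv gi.
have [h hl e] := Ms _ _ _ (proj1 gi); have [h' hl' e'] := Ms _ _ _ gl'.
exists h => //; split=> //; exists h'.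
  apply: Mi => //; first exact: lin_comp.
  by move=> u; rewrite btens_map_id (btens_map_comp M hl' hl) /= e e' gK.
apply: Mi => //; first exact: lin_comp.
by move=> u; rewrite btens_map_id (btens_map_comp M hl hl') /= e e' g'K.
Qed.

Lemma morita_cancel (M N Q : bimod) : induces_morita M ->
  bimod_iso (bimod_mul M N) (bimod_mul M Q) -> bimod_iso N Q.
Proof.
move=> hM [g [gl gb gr]].
have [h [hl hb] e] := morita_lift_iso hM (conj gl gb : lin_iso (g : btens M N -> btens M Q)).
exists h; split=> // n a; case: hM => Mi _ _.
have rl (T : bimod) : linear (fun n : T => ract n a).
  by apply: linDZ => [u v|b u]; rewrite (ractDl, ractZ).
apply: (Mi _ _ (h \o (fun n => ract n a)) ((fun n => ract n a) \o h)).
- exact: lin_comp.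
- exact: lin_comp.
move=> u; rewrite (btens_map_comp M hl (rl N)) (btens_map_comp M (rl Q) hl) /=.
rewrite !e; exact: gr.
Qed.

Lemma morita_rinv (M : bimod) : induces_morita M ->
  exists N, bimod_iso (bimod_mul M N) reg_bimod.
Proof.
move=> [Mi Ms Me]; have [X [g [gl gb]]] := Me A^o.
have [g' [[gl' _] gK g'K]] := lin_iso_inv (conj gl gb : lin_iso g).
have rl (a : A) : linear (fun x : A^o => (x : A) * a : A^o).
  by apply: linDZ => [u v|b u]; [exact: mulrDl | exact: esym (mulrA _ _ _)].
have /boolp.choice [r rP] : forall a : A, exists h : X -> X, linear h /\
    btens_map M h =1 g' \o (fun x : A^o => (x : A) * a : A^o) \o g.
  move=> a; have [|h hl e] := Ms X X (g' \o (fun x : A^o => (x : A) * a : A^o) \o g).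
    by apply: lin_comp => //; apply: lin_comp.
  by exists h.
have r_lin a : linear (r a) by case: (rP a).
have rE a : btens_map M (r a) =1 g' \o (fun x : A^o => (x : A) * a : A^o) \o g.
  by case: (rP a).
have il : linear (@idfun X) by [].
have zl c : linear (fun x : X => alg_map A c *: x).
  apply: linDZ => [u v|b u]; first exact: scalerDr.
  by rewrite !scalerA alg_centr.
have aDl x y a : r a (x + y) = r a x + r a y by apply: (linD (r_lin a)).
have aDr x a b : r (a + b) x = r a x + r b x.
  have sl : linear (fun x => r a x + r b x).
    by move=> c u v; rewrite !r_lin scalerDr addrACA.
  move: x; apply: Mi => // u; rewrite rE /= mulrDr (linD gl').
  have -> : btens_map M (fun x => r a x + r b x) u =
      btens_map M (r a) u + btens_map M (r b) u.
    move: u; apply: bt_ext => [|u v|m x]; first exact: linD (btens_map_lin M sl).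
      by rewrite !(linD (btens_map_lin M (r_lin _))) addrACA.
    by rewrite !btens_mapE // btDr.
  by rewrite !rE.
have a1 x : r 1 x = x.
  move: x; apply: Mi => // u; rewrite rE btens_map_id /= mulr1; exact: gK.
have aM x a b : r (a * b) x = r b (r a x).
  move: x; apply: (Mi _ _ _ (r b \o r a)) => //.
    exact: lin_comp (r_lin b) (r_lin a).
  move=> u; rewrite (btens_map_comp M (r_lin b) (r_lin a)) /= !rE /= g'K.
  by rewrite mulrA.
have aZ x a b : r b (a *: x) = a *: r b x by apply: (linZ _ _ (r_lin b)).
have ac x c : alg_map A c *: x = r (alg_map A c) x.
  move: x; apply: (Mi _ _ _ (r (alg_map A c))) => // u; rewrite rE /= -alg_centr.
  rewrite [RHS](linZ (alg_map A c) (g u) gl') gK.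
  move: u; apply: bt_ext => [|u v|m x]; first exact: linD (btens_map_lin M (zl c)).
    by rewrite scalerDr.
  by rewrite btens_mapE // -bt_bal btZ ract_centr.
pose N := Bimod aDl aDr a1 aM aZ ac.
exists N, g; split=> // u a.
by have := congr1 g (rE a u); rewrite /= g'K.
Qed.

Lemma morita_of_rinv (M N : bimod) : induces_morita M ->
  bimod_iso (bimod_mul M N) reg_bimod -> induces_morita N.
Proof.
move=> hM iMN; have [Mi Ms Me] := hM.
have [f [fl fn]] := assoc_nat M N; have [p [pl pn _]] := btens_isol iMN.
have [q [ql qn]] := unitl_nat.
pose fi X := projT1 (cid (lin_iso_inv (fl X))).
have fiP X : [/\ linear (fi X), cancel (f X) (fi X) & cancel (fi X) (f X)].
  by have [[? _] ? ?] := projT2 (cid (lin_iso_inv (fl X))).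
pose t X : btens M (btens N X) -> X := q X \o p X \o fi X.
have tl X : lin_iso (t X).
  have [fl' fK' fiK'] := fiP X.
  have fii : lin_iso (fi X) by split=> //; exists (f X).
  exact: lin_iso_comp (lin_iso_comp (ql X) (pl X)) fii.
have tn (X Y : lmodType A) (h : X -> Y) : linear h ->
    h \o t X =1 t Y \o btens_map M (btens_map N h).
  move=> hl u; have [_ fKX fiKX] := fiP X; have [_ fKY fiKY] := fiP Y.
  rewrite -(fiKX u) /t /= fKX [LHS](qn X Y h hl) /= [btens_map _ _ _](pn X Y h hl) /=.
  by rewrite [btens_map M _ _](fn X Y h hl) /= fKY.
split=> [X Y h h' hl hl' e x|X Y g gl|Y].
- have [_ [ti tK tiK]] := tl X.
  rewrite -(tiK x) [LHS](tn X Y h hl) [RHS](tn X Y h' hl') /=.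
  by rewrite (eq_btens_map M _ e).
- have [ti [[til _] tK tiK]] := lin_iso_inv (tl X).
  have gl' := btens_map_lin M gl.
  have hl : linear (t Y \o btens_map M g \o ti).
    by apply: lin_comp => //; apply: lin_comp => //; case: (tl Y).
  exists (t Y \o btens_map M g \o ti) => //.
  apply: Mi => //; first exact: btens_map_lin.
  move=> u; apply: (bij_inj (proj2 (tl Y))).
  by rewrite -[LHS](tn X Y _ hl) /= tK.
- exists (btens M Y).
  have [h hi _] := morita_lift_iso hM (tl (btens M Y)).
  by exists h.
Qed.

Lemma morita_inv (M : bimod) : induces_morita M ->
  exists N, induces_morita N /\ bimod_iso (bimod_mul N M) reg_bimod.
Proof.
move=> hM; have [N iN] := morita_rinv hM; exists N; split.
  exact: morita_of_rinv iN.
apply: (morita_cancel hM).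
apply: bimod_iso_trans (bimod_iso_sym (bimod_mulA _ _ _)) _.
apply: bimod_iso_trans (bimod_mul_isol _ iN) _.
apply: bimod_iso_trans (bimod_mul1l _) _.
exact: bimod_iso_sym (bimod_mul1r _).
Qed.

(* The elements are the isomorphism classes themselves, as predicates. *)
Definition picard_car :=
  {C : bimod -> Prop | exists M, induces_morita M /\ C = bimod_iso M}.

Definition pic_mem (M : bimod) (x : picard_car) : Prop := proj1_sig x M.

Definition pic_class (M : bimod) (hM : induces_morita M) : picard_car :=
  exist _ (bimod_iso M) (ex_intro _ M (conj hM erefl)).

Definition pic_rep (x : picard_car) : bimod := projT1 (cid (proj2_sig x)).

Lemma pic_rep_morita x : induces_morita (pic_rep x).
Proof. by rewrite /pic_rep; case: cid => M []. Qed.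

Lemma pic_repE x : proj1_sig x = bimod_iso (pic_rep x).
Proof. by rewrite /pic_rep; case: cid => M []. Qed.

Lemma pic_eq M N (hM : induces_morita M) (hN : induces_morita N) :
  bimod_iso M N -> pic_class hM = pic_class hN.
Proof.
move=> iMN; apply: eq_exist; apply/funext => Q; apply/propext.
split; last exact: bimod_iso_trans.
by apply: bimod_iso_trans; apply: bimod_iso_sym.
Qed.

Lemma pic_repK x : pic_class (pic_rep_morita x) = x.
Proof.
by case: x (pic_repE x) (pic_rep_morita x) => C hC e hM; apply: eq_exist.
Qed.

Lemma pic_rep_class M (hM : induces_morita M) :
  bimod_iso (pic_rep (pic_class hM)) M.
Proof.
have /(congr1 (fun x => pic_mem M x)) : pic_class (pic_rep_morita (pic_class hM))
  = pic_class hM by apply: pic_repK.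
by rewrite /pic_mem /= => ->; apply: bimod_iso_refl.
Qed.

Definition pic_mul (x y : picard_car) : picard_car :=
  pic_class (morita_mul (pic_rep_morita x) (pic_rep_morita y)).

Definition pic_inv (x : picard_car) : picard_car :=
  pic_class (proj1 (projT2 (cid (morita_inv (pic_rep_morita x))))).

Lemma pic_mulE M N (hM : induces_morita M) (hN : induces_morita N) :
  pic_mul (pic_class hM) (pic_class hN) = pic_class (morita_mul hM hN).
Proof. by apply: pic_eq; apply: bimod_mul_iso; apply: pic_rep_class. Qed.

Fact pic_mulA : associative pic_mul.
Proof.
move=> x y z; rewrite -(pic_repK x) -(pic_repK y) -(pic_repK z) !pic_mulE.
apply: pic_eq; apply: bimod_iso_sym; exact: bimod_mulA.
Qed.

Fact pic_mul1l : left_id (pic_class morita_reg) pic_mul.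
Proof.
by move=> x; rewrite -(pic_repK x) pic_mulE; apply: pic_eq; apply: bimod_mul1l.
Qed.

Fact pic_mulVl : left_inverse (pic_class morita_reg) pic_inv pic_mul.
Proof.
move=> x; rewrite -{2}(pic_repK x) /pic_inv pic_mulE; apply: pic_eq.
by case: cid => N [].
Qed.

Definition Pic : grp := Grp pic_mulA pic_mul1l pic_mulVl.

End Bimodules.

Section Automorphisms.
Variables (R : comNzRingType) (A : algebra R).

Definition is_alg_aut (f : A -> A) : Prop :=
  [/\ {morph f : x y / x + y}, {morph f : x y / x * y},
      forall c, f (alg_map A c) = alg_map A c & bijective f].

Record alg_aut := AlgAut { alg_aut_fun :> A -> A; alg_autP : is_alg_aut alg_aut_fun }.

Lemma alg_autD (f : alg_aut) : {morph f : x y / x + y}. Proof. by case: (alg_autP f). Qed.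
Lemma alg_autM (f : alg_aut) : {morph f : x y / x * y}. Proof. by case: (alg_autP f). Qed.
Lemma alg_autC (f : alg_aut) c : f (alg_map A c) = alg_map A c.
Proof. by case: (alg_autP f). Qed.
Lemma alg_aut1 (f : alg_aut) : f 1 = 1.
Proof. by rewrite -(rmorph1 (alg_map A)) alg_autC. Qed.

Definition alg_aut_id : alg_aut.
Proof. by exists idfun; split=> //; exists idfun. Defined.

Definition alg_aut_comp (f g : alg_aut) : alg_aut.
Proof.
exists (f \o g); split=> [x y|x y|c|] /=; rewrite ?alg_autD ?alg_autM ?alg_autC //.
by apply: bij_comp; [case: (alg_autP f) | case: (alg_autP g)].
Defined.

Lemma alg_aut_inv_ex (f : alg_aut) : exists g : alg_aut, cancel g f /\ cancel f g.
Proof.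
have [fD fM fC [g fK gK]] := alg_autP f.
have gP : is_alg_aut g.
  split=> [x y|x y|c|]; last by exists f.
  - by apply: (can_inj fK); rewrite fD !gK.
  - by apply: (can_inj fK); rewrite fM !gK.
  - by apply: (can_inj fK); rewrite fC gK.
by exists (AlgAut gP).
Qed.

Definition alg_aut_inv (f : alg_aut) : alg_aut := projT1 (cid (alg_aut_inv_ex f)).

Lemma alg_aut_invK (f : alg_aut) : cancel (alg_aut_inv f) f.
Proof. by case: (projT2 (cid (alg_aut_inv_ex f))). Qed.
Lemma alg_autK (f : alg_aut) : cancel f (alg_aut_inv f).
Proof. by case: (projT2 (cid (alg_aut_inv_ex f))). Qed.

(* f and g differ by an inner automorphism, x |-> u * x * u^-1. *)
Definition inner_eq (f g : alg_aut) : Prop :=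
  exists u v : A, [/\ u * v = 1, v * u = 1 & forall x, f x = u * g x * v].

Lemma inner_eq_refl f : inner_eq f f.
Proof. by exists 1, 1; split=> [||x]; rewrite ?mul1r ?mulr1. Qed.

Lemma inner_eq_sym f g : inner_eq f g -> inner_eq g f.
Proof.
case=> u [v [uv vu e]]; exists v, u; split=> // x.
by rewrite e !mulrA vu mul1r -mulrA vu mulr1.
Qed.

Lemma inner_eq_trans f g h : inner_eq f g -> inner_eq g h -> inner_eq f h.
Proof.
case=> u [v [uv vu e]] [u' [v' [uv' vu' e']]]; exists (u * u'), (v' * v).
split=> [||x]; last by rewrite e e' !mulrA.
- by rewrite mulrA -(mulrA u) uv' mulr1.
- by rewrite mulrA -(mulrA v') vu mulr1.
Qed.

Lemma inner_eq_comp f f' g g' :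
  inner_eq f f' -> inner_eq g g' -> inner_eq (alg_aut_comp f g) (alg_aut_comp f' g').
Proof.
case=> u [v [uv vu e]] [u' [v' [uv' vu' e']]].
exists (u * f' u'), (f' v' * v); split=> [||x] /=.
- by rewrite mulrA -(mulrA u) -alg_autM uv' alg_aut1 mulr1.
- by rewrite mulrA -(mulrA (f' v')) vu mulr1 -alg_autM vu' alg_aut1.
- by rewrite e' e !alg_autM !mulrA.
Qed.

Definition out_class (f : alg_aut) : quot inner_eq := cls inner_eq f.

Let class_eq f g : inner_eq f g -> out_class f = out_class g.
Proof. by apply: cls_eq; [apply: inner_eq_sym | apply: inner_eq_trans]. Qed.

Definition out_mul (x y : quot inner_eq) := out_class (alg_aut_comp (rep x) (rep y)).
Definition out_inv (x : quot inner_eq) := out_class (alg_aut_inv (rep x)).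

Lemma out_mulE f g :
  out_mul (out_class f) (out_class g) = out_class (alg_aut_comp f g).
Proof.
by apply: class_eq; apply: inner_eq_comp; apply: rep_cls; apply: inner_eq_refl.
Qed.

Let alg_aut_eq (f g : alg_aut) : f =1 g -> f = g.
Proof.
case: f g => [f hf] [g hg] /= /funext e; subst g; congr AlgAut.
exact: Prop_irrelevance.
Qed.

Let outP x : exists f, x = out_class f.
Proof. by exists (rep x); rewrite [RHS]clsK. Qed.

Fact out_mulA : associative out_mul.
Proof.
move=> x y z; have [[f ->] [g ->] [h ->]] := And3 (outP x) (outP y) (outP z).
by rewrite !out_mulE; congr out_class; apply: alg_aut_eq.
Qed.

Fact out_mul1l : left_id (out_class alg_aut_id) out_mul.
Proof.
by move=> x; have [f ->] := outP x; rewrite out_mulE; congr out_class; apply: alg_aut_eq.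
Qed.

Fact out_mulVl : left_inverse (out_class alg_aut_id) out_inv out_mul.
Proof.
move=> x; have {2}-> : x = out_class (rep x) by rewrite [RHS]clsK.
rewrite out_mulE; congr out_class.
by apply: alg_aut_eq => a /=; apply: alg_autK.
Qed.

Lemma out_invE f : out_inv (out_class f) = out_class (alg_aut_inv f).
Proof.
have fV : out_mul (out_class f) (out_class (alg_aut_inv f)) = out_class alg_aut_id.
  by rewrite out_mulE; congr out_class; apply: alg_aut_eq => b /=; apply: alg_aut_invK.
have e1 x : out_mul x (out_class alg_aut_id) = x.
  by have [g ->] := outP x; rewrite out_mulE; congr out_class; apply: alg_aut_eq.
by rewrite -[LHS]e1 -fV out_mulA out_mulVl out_mul1l.
Qed.

Definition Out : grp := Grp out_mulA out_mul1l out_mulVl.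

Section Congruence.
Variables (a : R) (r : nat).

Definition alg_aut_congr (f : alg_aut) : Prop :=
  forall x, exists y, f x - x = alg_map A (a ^+ r) * y.

Definition out_congr_car :=
  {x : Out | exists f, alg_aut_congr f /\ x = out_class f}.

Definition out_congr_class (f : alg_aut) (hf : alg_aut_congr f) : out_congr_car :=
  exist _ (out_class f) (ex_intro _ f (conj hf erefl)).

Lemma alg_aut_congr_id : alg_aut_congr alg_aut_id.
Proof. by move=> x; exists 0; rewrite subrr mulr0. Qed.

Lemma alg_aut_congr_comp f g :
  alg_aut_congr f -> alg_aut_congr g -> alg_aut_congr (alg_aut_comp f g).
Proof.
move=> hf hg x; have [y ey] := hf (g x); have [z ez] := hg x.
by exists (y + z); rewrite mulrDr -ey -ez addrA subrK.
Qed.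

Lemma alg_aut_congr_inv f : alg_aut_congr f -> alg_aut_congr (alg_aut_inv f).
Proof.
move=> hf x; have [y ey] := hf (alg_aut_inv f x).
by exists (- y); rewrite mulrN -ey alg_aut_invK opprB.
Qed.

Fact out_congr_mulP (x y : out_congr_car) : exists f,
  alg_aut_congr f /\ gmul (sval x) (sval y) = out_class f.
Proof.
have [f [hf ->]] := proj2_sig x; have [g [hg ->]] := proj2_sig y.
by exists (alg_aut_comp f g); split; [apply: alg_aut_congr_comp | apply: out_mulE].
Qed.

Fact out_congr_invP (x : out_congr_car) : exists f,
  alg_aut_congr f /\ ginv (sval x) = out_class f.
Proof.
have [f [hf ->]] := proj2_sig x; exists (alg_aut_inv f).
by split; [apply: alg_aut_congr_inv | apply: out_invE].
Qed.

Definition out_congr_mul (x y : out_congr_car) : out_congr_car :=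
  exist _ _ (out_congr_mulP x y).
Definition out_congr_inv (x : out_congr_car) : out_congr_car :=
  exist _ _ (out_congr_invP x).

Fact out_congr_mulA : associative out_congr_mul.
Proof. by move=> x y z; apply: eq_exist; apply: gmulA. Qed.

Fact out_congr_mul1l :
  left_id (out_congr_class alg_aut_congr_id) out_congr_mul.
Proof. by move=> [x hx]; apply: eq_exist; apply: out_mul1l. Qed.

Fact out_congr_mulVl :
  left_inverse (out_congr_class alg_aut_congr_id) out_congr_inv out_congr_mul.
Proof. by move=> x; apply: eq_exist; apply: out_mulVl. Qed.

(* The image in Out(A) of the automorphisms inducing the identity on A/a^rA. *)
Definition Out_congr : grp :=
  Grp out_congr_mulA out_congr_mul1l out_congr_mulVl.
End Congruence.

Definition twisted_bimod (f : alg_aut) : bimod A.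
Proof.
apply: (@Bimod _ A A^o (fun x b => (x : A) * f b)) => /=.
- by move=> x y b; rewrite mulrDl.
- by move=> x b c; rewrite alg_autD mulrDr.
- by move=> x; rewrite alg_aut1 mulr1.
- by move=> x b c; rewrite alg_autM mulrA.
- by move=> x b c; apply: (esym (mulrA b x (f c))).
- by move=> x c; rewrite alg_autC; apply: alg_centr.
Defined.
End Automorphisms.

Section BaseChange.
Variables (O k : comNzRingType) (res : {rmorphism O -> k}) (A : algebra O).

(* k (x)_O M, where O acts on M through A. *)
Definition bc (M : lmodType A) : Type :=
  tensor (fun (x : k) c => x * res c) (fun c (m : M) => alg_map A c *: m).
HB.instance Definition _ M := GRing.Zmodule.on (bc M).

Definition bct (M : lmodType A) (x : k) (m : M) : bc M := tens _ _ x m.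

Lemma bctDl (M : lmodType A) x y (m : M) : bct (x + y) m = bct x m + bct y m.
Proof. exact: tensDl. Qed.
Lemma bctDr (M : lmodType A) x (m n : M) : bct x (m + n) = bct x m + bct x n.
Proof. exact: tensDr. Qed.
Lemma bct_bal (M : lmodType A) x c (m : M) :
  bct (x * res c) m = bct x (alg_map A c *: m).
Proof. exact: tens_bal. Qed.

Lemma bc_ext (M : lmodType A) (V : zmodType) (f g : bc M -> V) :
  {morph f : u v / u + v} -> {morph g : u v / u + v} ->
  (forall x m, f (bct x m) = g (bct x m)) -> f =1 g.
Proof. exact: tens_ext. Qed.

Section Op.
Variables (M N P : lmodType A) (op : M -> N -> P).

Definition bc_op (u : bc M) (v : bc N) : bc P :=
  tens_lift (fun x m => tens_lift (fun y n => bct (x * y) (op m n)) v) u.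

Definition O_bilinear : Prop :=
  [/\ forall m m' n, op (m + m') n = op m n + op m' n,
      forall m n n', op m (n + n') = op m n + op m n',
      forall c m n, op (alg_map A c *: m) n = alg_map A c *: op m n
    & forall c m n, op m (alg_map A c *: n) = alg_map A c *: op m n].
Hypothesis opP : O_bilinear.

Let in_bal x m : balanced (fun (x : k) c => x * res c)
  (fun c (n : N) => alg_map A c *: n) (fun y n => bct (x * y) (op m n)).
Proof.
case: opP => opDl opDr opZl opZr; split=> [y y' n|y n n'|y c n].
- by rewrite mulrDr bctDl.
- by rewrite opDr bctDr.
- by rewrite mulrA bct_bal opZr.
Qed.

Let inD x m : {morph tens_lift (fun y n => bct (x * y) (op m n))
  : u v / (u : bc N) + v >-> u + v}.
Proof. exact: tens_liftD (in_bal x m). Qed.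

Let inE x m y (n : N) :
  tens_lift (fun y n => bct (x * y) (op m n)) (bct y n) = bct (x * y) (op m n).
Proof. exact: tens_liftE (in_bal x m) _ _. Qed.

Let out_bal (v : bc N) : balanced (fun (x : k) c => x * res c)
  (fun c (m : M) => alg_map A c *: m)
  (fun x m => tens_lift (fun y n => bct (x * y) (op m n)) v).
Proof.
case: opP => opDl opDr opZl opZr; split=> [x x' m|x m m'|x c m].
- move: v; apply: bc_ext => [u v|u v|y n]; rewrite ?inD //.
    by rewrite addrACA.
  by rewrite !inE mulrDl bctDl.
- move: v; apply: bc_ext => [u v|u v|y n]; rewrite ?inD //.
    by rewrite addrACA.
  by rewrite !inE opDl bctDr.
- move: v; apply: bc_ext => [u v|u v|y n]; rewrite ?inD //.
  by rewrite !inE opZl -bct_bal mulrAC.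
Qed.

Lemma bc_opDl v : {morph bc_op^~ v : u u' / u + u'}.
Proof. exact: tens_liftD (out_bal v). Qed.

Let bc_opE_out x m v :
  bc_op (bct x m) v = tens_lift (fun y n => bct (x * y) (op m n)) v.
Proof. exact: tens_liftE (out_bal v) _ _. Qed.

Lemma bc_opE x m y n : bc_op (bct x m) (bct y n) = bct (x * y) (op m n).
Proof. by rewrite bc_opE_out inE. Qed.

Lemma bc_opDr u : {morph bc_op u : v v' / v + v'}.
Proof.
move=> v v'; move: u; apply: bc_ext => [u u'|u u'|x m]; rewrite ?bc_opDl //.
  by rewrite addrACA.
by rewrite !bc_opE_out inD.
Qed.
End Op.

Let mul_bilin : @O_bilinear A^o A^o A^o *%R.
Proof.
split=> [a b c|a b c|c a b|c a b] /=; rewrite ?mulrDl ?mulrDr //.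
- by rewrite -[LHS]mulrA.
- by rewrite /GRing.scale /= mulrA -alg_centr -mulrA.
Qed.

Definition bc_ring : Type := bc A^o.
HB.instance Definition _ := GRing.Zmodule.on bc_ring.

Definition bc_mul : bc_ring -> bc_ring -> bc_ring :=
  @bc_op A^o A^o A^o *%R.

Let mulE x y (a b : A^o) : bc_mul (bct x a) (bct y b) = bct (x * y) ((a : A) * b : A^o).
Proof. exact: bc_opE mul_bilin _ _ _ _. Qed.

Let mulDl : left_distributive bc_mul +%R.
Proof. by move=> u v w; apply: (bc_opDl mul_bilin). Qed.
Let mulDr : right_distributive bc_mul +%R.
Proof. by move=> u v w; apply: (bc_opDr mul_bilin). Qed.

Let bc_ext3 (M N P : lmodType A) (V : zmodType) (f g : bc M -> bc N -> bc P -> V) :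
  (forall u v, {morph f u v : w w' / w + w'}) ->
  (forall u w, {morph (fun v => f u v w) : v v' / v + v'}) ->
  (forall v w, {morph (fun u => f u v w) : u u' / u + u'}) ->
  (forall u v, {morph g u v : w w' / w + w'}) ->
  (forall u w, {morph (fun v => g u v w) : v v' / v + v'}) ->
  (forall v w, {morph (fun u => g u v w) : u u' / u + u'}) ->
  (forall x m y n z p, f (bct x m) (bct y n) (bct z p) =
                       g (bct x m) (bct y n) (bct z p)) ->
  forall u v w, f u v w = g u v w.
Proof.
move=> f3 f2 f1 g3 g2 g1 e u v w.
apply: (bc_ext (f := fun u => f u v w) (g := fun u => g u v w)) => // x m.
apply: (bc_ext (f := fun v => f _ v w) (g := fun v => g _ v w)) => // y n.
exact: bc_ext.
Qed.

Let mulA : associative bc_mul.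
Proof.
apply: bc_ext3 => [u v w w'|u w v v'|v w u u'|u v w w'|u w v v'|v w u u'|x a y b z c];
  rewrite ?(mulDl, mulDr) //.
by rewrite !mulE !mulrA.
Qed.

Let mul1 : left_id (bct 1 (1 : A^o) : bc_ring) bc_mul.
Proof.
apply: bc_ext => [u v|//|x a]; first by rewrite mulDr.
by rewrite mulE !mul1r.
Qed.
Let mulr1' : right_id (bct 1 (1 : A^o) : bc_ring) bc_mul.
Proof.
apply: bc_ext => [u v|//|x a]; first by rewrite mulDl.
by rewrite mulE !mulr1.
Qed.

HB.instance Definition _ :=
  GRing.Zmodule_isPzRing.Build bc_ring mulA mul1 mulr1' mulDl mulDr.

Definition bc_map (x : k) : bc_ring := bct x (1 : A^o).

Let map_zmod : zmod_morphism bc_map.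
Proof.
by move=> x y; apply: (canRL (addrK _)); rewrite -bctDl subrK.
Qed.
Let map_monoid : monoid_morphism bc_map.
Proof. by split=> // x y; rewrite [RHS]mulE mulr1. Qed.

HB.instance Definition _ := GRing.isZmodMorphism.Build k bc_ring bc_map map_zmod.
HB.instance Definition _ := GRing.isMonoidMorphism.Build k bc_ring bc_map map_monoid.

Let map_centr x (u : bc_ring) : bc_map x * u = u * bc_map x.
Proof.
move: u; apply: bc_ext => [u v|u v|y a]; rewrite ?mulrDl ?mulrDr //.
by rewrite [LHS]mulE [RHS]mulE mulrC mul1r mulr1.
Qed.

Definition bc_algebra : algebra k := @Algebra k bc_ring bc_map map_centr.

Let scale_bilin (M : lmodType A) : @O_bilinear A^o M M (fun (a : A) m => a *: m).
Proof.
split=> [a b m|a m n|c a m|c a m]; rewrite ?scalerDl ?scalerDr ?scalerA //.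
by rewrite alg_centr.
Qed.

Definition bc_scale (M : lmodType A) : bc_algebra -> bc M -> bc M :=
  @bc_op A^o M M (fun (a : A) m => a *: m).

Section BcModule.
Variable M : lmodType A.

Let scE x (a : A^o) y (m : M) :
  bc_scale (bct x a : bc_ring) (bct y m) = bct (x * y) ((a : A) *: m).
Proof. exact: bc_opE (scale_bilin M) _ _ _ _. Qed.
Let scDl (v : bc M) : {morph (@bc_scale M)^~ v : u u' / u + u'}.
Proof. exact: bc_opDl (scale_bilin M) _. Qed.
Let scDr : right_distributive (@bc_scale M) +%R.
Proof. by move=> u v w; apply: bc_opDr (scale_bilin M) _ _ _. Qed.

Let scA a b (v : bc M) : bc_scale a (bc_scale b v) = bc_scale (a * b) v.
Proof.
move: a b v; apply: (@bc_ext3 A^o A^o M) => [u v w w'|u w v v'|v w u u'|u v w w'|u w v v'|v w u u'|x a y b z c].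
- by rewrite !scDr.
- by rewrite scDl scDr.
- by rewrite scDl.
- by rewrite scDr.
- by rewrite [X in bc_scale X _](mulDr u) scDl.
- by rewrite [X in bc_scale X _](mulDl u) scDl.
- by rewrite [X in _ = bc_scale X _]mulE !scE mulrA scalerA.
Qed.

Let sc1 : left_id (1 : bc_algebra) (@bc_scale M).
Proof.
apply: bc_ext => [u v|//|x m]; first by rewrite scDr.
by rewrite scE mul1r scale1r.
Qed.

HB.instance Definition _ :=
  GRing.Zmodule_isLmodule.Build bc_algebra (bc M) scA sc1 scDr scDl.

Lemma bcZ x (a : A^o) y (m : M) :
  (bct x a : bc_algebra) *: bct y m = bct (x * y) ((a : A) *: m) :> bc M.
Proof. exact: scE. Qed.
End BcModule.

Section BcBimod.
Variable M : bimod A.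

Let ract_bilin : @O_bilinear M A^o M (@ract _ _ M).
Proof.
split=> [x y a|x a b|c x a|c x a].
- exact: ractDl.
- exact: ractDr.
- exact: ractZ.
- by rewrite ractM -ract_centr ractZ.
Qed.

Definition bc_ract (u : bc M) (v : bc_algebra) : bc M :=
  @bc_op M A^o M (@ract _ _ M) u v.

Let raE x (m : M) y (a : A^o) :
  bc_ract (bct x m) (bct y a : bc_ring) = bct (x * y) (ract m a).
Proof. exact: bc_opE ract_bilin _ _ _ _. Qed.
Let raDl (v : bc_algebra) : {morph bc_ract^~ v : u u' / u + u'}.
Proof. exact: bc_opDl ract_bilin _. Qed.
Let raDr (u : bc M) : {morph bc_ract u : v v' / v + v'}.
Proof. exact: bc_opDr ract_bilin _. Qed.

Let ra1 u : bc_ract u 1 = u.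
Proof.
move: u; apply: bc_ext => [u v|//|x m]; first by rewrite raDl.
by rewrite raE mulr1 ract1.
Qed.

Let raM u a b : bc_ract u (a * b) = bc_ract (bc_ract u a) b.
Proof.
move: u a b; apply: (@bc_ext3 M A^o A^o) => [u v w w'|u w v v'|v w u u'|u v w w'|u w v v'|v w u u'|x m y a z b].
- by rewrite [X in bc_ract _ X](mulDr v) raDr.
- by rewrite [X in bc_ract _ X](mulDl v) raDr.
- by rewrite raDl.
- by rewrite raDr.
- by rewrite raDr raDl.
- by rewrite !raDl.
- by rewrite [X in bc_ract _ X]mulE !raE mulrA ractM.
Qed.

Let raZ u a b : bc_ract (a *: u) b = a *: bc_ract u b.
Proof.
move: u a b; apply: (@bc_ext3 M A^o A^o) => [u v w w'|u w v v'|v w u u'|u v w w'|u w v v'|v w u u'|x m y a z b].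
- by rewrite raDr.
- by rewrite scalerDl raDl.
- by rewrite scalerDr raDl.
- by rewrite raDr scalerDr.
- by rewrite scalerDl.
- by rewrite raDl scalerDr.
- by rewrite bcZ !raE bcZ ractZ mulrA.
Qed.

Let ra_centr (u : bc M) x :
  alg_map bc_algebra x *: u = bc_ract u (alg_map bc_algebra x).
Proof.
move: u; apply: bc_ext => [u v|u v|y m]; rewrite ?scalerDr ?raDl //.
by rewrite [LHS]bcZ [RHS]raE scale1r ract1 mulrC.
Qed.

Definition bc_bimod : bimod bc_algebra :=
  @Bimod k bc_algebra (bc M) bc_ract
    (fun x y a => raDl a x y) raDr ra1 raM raZ ra_centr.
End BcBimod.
End BaseChange.

Section GroupAlgebra.
Variables (R : comNzRingType) (gT : finGroupType).

Definition gralg : Type := {ffun gT -> R}.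
HB.instance Definition _ := GRing.Zmodule.on gralg.

Definition gr_one : gralg := [ffun g => (g == 1%g)%:R].
Definition gr_mul (x y : gralg) : gralg :=
  [ffun g => \sum_h x h * y (h^-1 * g)%g].

Fact gr_mulA : associative gr_mul.
Proof.
move=> x y z; apply/ffunP => g; rewrite !ffunE.
under eq_bigr do rewrite ffunE mulr_sumr.
under [RHS]eq_bigr do rewrite ffunE mulr_suml.
rewrite [RHS]exchange_big /=; apply: eq_bigr => h _.
rewrite [RHS](reindex_inj (mulgI h)) /=; apply: eq_bigr => i _.
by rewrite mulKg invMg !mulgA mulrA.
Qed.

Fact gr_mul1l : left_id gr_one gr_mul.
Proof.
move=> x; apply/ffunP => g; rewrite ffunE (bigD1 1%g) //= ffunE eqxx mul1r.
rewrite invg1 mul1g big1 ?addr0 // => h /negPf h1.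
by rewrite ffunE h1 mul0r.
Qed.

Fact gr_mul1r : right_id gr_one gr_mul.
Proof.
move=> x; apply/ffunP => g; rewrite ffunE (bigD1 g) //= ffunE mulVg eqxx mulr1.
rewrite big1 ?addr0 // => h hg; rewrite ffunE -eq_invg_mul invgK.
by rewrite (negPf hg) mulr0.
Qed.

Fact gr_mulDl : left_distributive gr_mul +%R.
Proof.
move=> x y z; apply/ffunP => g; rewrite !ffunE -big_split /=.
by apply: eq_bigr => h _; rewrite ffunE mulrDl.
Qed.

Fact gr_mulDr : right_distributive gr_mul +%R.
Proof.
move=> x y z; apply/ffunP => g; rewrite !ffunE -big_split /=.
by apply: eq_bigr => h _; rewrite ffunE mulrDr.
Qed.

HB.instance Definition _ := GRing.Zmodule_isPzRing.Build gralg
  gr_mulA gr_mul1l gr_mul1r gr_mulDl gr_mulDr.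

Definition gr_map (c : R) : gralg := [ffun g => if g == 1%g then c else 0].

Let gr_mapMl c x g : (gr_map c * x) g = c * x g.
Proof.
rewrite ffunE (bigD1 1%g) //= ffunE eqxx invg1 mul1g big1 ?addr0 // => h.
by rewrite ffunE => /negPf ->; rewrite mul0r.
Qed.

Let gr_mapMr c x g : (x * gr_map c) g = c * x g.
Proof.
rewrite ffunE (bigD1 g) //= ffunE mulVg eqxx mulrC big1 ?addr0 // => h hg.
by rewrite ffunE -eq_invg_mul invgK (negPf hg) mulr0.
Qed.

Let gr_map_zmod : zmod_morphism gr_map.
Proof.
by move=> c d; apply/ffunP => g; rewrite !ffunE; case: ifP => // _; rewrite subr0.
Qed.
Let gr_map_monoid : monoid_morphism gr_map.
Proof.
split=> [|c d]; apply/ffunP => g; first by rewrite !ffunE; case: ifP.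
by rewrite gr_mapMl !ffunE; case: ifP => // _; rewrite mulr0.
Qed.
HB.instance Definition _ := GRing.isZmodMorphism.Build R gralg gr_map gr_map_zmod.
HB.instance Definition _ := GRing.isMonoidMorphism.Build R gralg gr_map gr_map_monoid.

Let gr_map_centr c (x : gralg) : gr_map c * x = x * gr_map c.
Proof. by apply/ffunP => g; rewrite gr_mapMl gr_mapMr. Qed.

Definition group_algebra : algebra R := @Algebra R gralg gr_map gr_map_centr.
End GroupAlgebra.

Section Blocks.
Variables (R : comNzRingType) (A : algebra R).

Definition central (z : A) : Prop := forall a, z * a = a * z.

Definition central_idempotent (e : A) : Prop := central e /\ e * e = e.

(* A primitive idempotent of Z(A). *)
Record block := Block {
  block_idem : A;
  block_ci : central_idempotent block_idem;
  block_neq0 : block_idem <> 0;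
  block_prim : forall e f, central_idempotent e -> central_idempotent f ->
    e * f = 0 -> block_idem = e + f -> e = 0 \/ f = 0 }.

Variable b : block.

(* The algebra A b, with unit b. *)
Definition block_car : Type := {x : A | x * block_idem b == x}.
HB.instance Definition _ := SubType.on block_car.
HB.instance Definition _ := Choice.on block_car.

Let bl_zmod : zmod_closed (fun x : A => x * block_idem b == x).
Proof.
split=> [|x y]; rewrite !unfold_in ?mul0r // => /eqP xb /eqP yb.
by rewrite mulrBl xb yb.
Qed.
HB.instance Definition _ :=
  GRing.SubChoice_isSubZmodule.Build A _ block_car bl_zmod.

Let blP (x : block_car) : val x * block_idem b = val x.
Proof. exact: (eqP (valP x)). Qed.
Let bb : block_idem b * block_idem b = block_idem b. Proof. by case: (block_ci b). Qed.
Let bC (a : A) : block_idem b * a = a * block_idem b. Proof. by case: (block_ci b). Qed.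

Let mulP (x y : block_car) : val x * val y * block_idem b == val x * val y.
Proof. by rewrite -mulrA blP. Qed.
Let oneP : block_idem b * block_idem b == block_idem b. Proof. exact/eqP. Qed.

Definition block_mul (x y : block_car) : block_car :=
  exist (fun x : A => x * block_idem b == x) _ (mulP x y).
Definition block_one : block_car :=
  exist (fun x : A => x * block_idem b == x) _ oneP.

Let bl_mulA : associative block_mul.
Proof. by move=> x y z; apply: val_inj; apply: mulrA. Qed.
Let bl_mul1 : left_id block_one block_mul.
Proof. by move=> x; apply: val_inj; rewrite /= bC; apply: blP. Qed.
Let bl_mulr1 : right_id block_one block_mul.
Proof. by move=> x; apply: val_inj; apply: blP. Qed.
Let bl_mulDl : left_distributive block_mul +%R.
Proof. by move=> x y z; apply: val_inj; apply: mulrDl. Qed.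
Let bl_mulDr : right_distributive block_mul +%R.
Proof. by move=> x y z; apply: val_inj; apply: mulrDr. Qed.
HB.instance Definition _ := GRing.Zmodule_isPzRing.Build block_car
  bl_mulA bl_mul1 bl_mulr1 bl_mulDl bl_mulDr.

Let mapP c : alg_map A c * block_idem b * block_idem b == alg_map A c * block_idem b.
Proof. by rewrite -mulrA bb. Qed.
Definition block_map (c : R) : block_car :=
  exist (fun x : A => x * block_idem b == x) _ (mapP c).

Let map_zmod : zmod_morphism block_map.
Proof. by move=> c d; apply: val_inj; rewrite /= rmorphB mulrBl. Qed.
Let map_monoid : monoid_morphism block_map.
Proof.
split=> [|c d]; apply: val_inj; rewrite /= ?rmorph1 ?mul1r //.
by rewrite rmorphM -!mulrA (mulrA (block_idem b)) bC -!mulrA bb.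
Qed.
HB.instance Definition _ := GRing.isZmodMorphism.Build R block_car block_map map_zmod.
HB.instance Definition _ := GRing.isMonoidMorphism.Build R block_car block_map map_monoid.

Let map_centr c (x : block_car) : block_map c * x = x * block_map c.
Proof.
apply: val_inj; rewrite /= -mulrA bC mulrA alg_centr -!mulrA.
by congr (_ * _); rewrite mulrA.
Qed.

Definition block_algebra : algebra R := @Algebra R block_car block_map map_centr.
End Blocks.

Section DefectGroup.
Variables (O k : comNzRingType) (res : {rmorphism O -> k}) (gT : finGroupType).

(* The Brauer homomorphism (OG)^P -> k C_G(P), as a function on OG. *)
Definition brauer (P : {group gT}) (x : gralg O gT) : gralg k (subg_of 'C(P)) :=
  [ffun g => res (x (sgval g))].

Definition defect_group (p : nat) (b : block (group_algebra O gT))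
    (P : {group gT}) : bool :=
  [max P | p.-group P && (brauer P (block_idem b : gralg O gT) != 0)]%g.
End DefectGroup.

Definition is_algebraic_closure_Fp (p : nat) (k : fieldType) : Prop :=
  GRing.closed_field_axiom k /\
  forall x : k, algebraicOver (fun a : 'F_p => (a : nat)%:R : k) x.

(* Main.v *)
(** Out_1(B) is the kernel: if k (x) M is isomorphic to the regular bimodule,
    lift a generator to an element m of M; by Nakayama's lemma and projectivity
    a |-> a m is an isomorphism of left modules, and the right action of B on m
    defines an automorphism which is the identity modulo pi.

    Exponent: as the centre of B is local, some class sum is invertible in it,
    and P is a Sylow p-subgroup of the centralizer of an element x' of that
    class.  This gives c with sum_g g c g^-1 = |P| up to a unit.  If f is the
    identity modulo pi ^ (d + 1), the element sum_g f(g) c g^-1 intertwines f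
    with the identity and is pi ^ d times a unit, so f is inner; and the p-th
    power of an automorphism that is the identity modulo pi ^ r is the identity
    modulo pi ^ (r + 1).

    Finiteness: an invertible bimodule over an n-dimensional algebra has
    dimension at most n ^ 2, so over a finite field there are finitely many of
    them.  When k is algebraic over F_p, an invertible bimodule is given by
    matrices over a finite subfield, and so are its tensor powers, which
    therefore fall into finitely many isomorphism classes. *)
Require Import Defs.
From HB Require Import structures.
From mathcomp Require Import all_boot all_fingroup all_algebra all_solvable.
From mathcomp Require Import boolp classical_sets.
Set Implicit Arguments.
Unset Strict Implicit.
Unset Printing Implicit Defensive.
Import GRing.Theory.
Local Open Scope ring_scope.

(** [induces_morita] quantifies over all modules and gives little hold on a single bimodule. It is
    traded for two algebraic forms: a two-sided inverse, which survives extension of scalars, and a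
    pair of pairings [phi], [psi] whose relation 1 = \sum psi(n_i, m_i) exhibits M as finitely
    generated projective. B is a direct summand of OG without a visible O-basis, so freeness is
    replaced by dual bases: divisibility by pi, limits and reduction are read off coordinates.

    Two requirements of the exponent bound meet at level d + 1. Dividing w by pi ^ d must leave an
    element that is still known modulo pi, and d successive p-th powers lead from level 1 to level d
    + 1 because p lies in pi O. The same level makes Out_1(B) finite when k is finite: up to inner
    automorphisms, an automorphism is determined by its values on the group elements modulo pi ^ (d
    + 1). Finiteness and torsion for Pic(B) combine these facts on the kernel with those over k. *)

Local Notation ract := Defs.ract.

(** * Morita equivalences *)

Section Morita.
Variables (R : comNzRingType) (A : algebra R).
Implicit Types (M N : bimod A) (X Y : lmodType A).

#[local] Arguments bimod_mul : simpl never.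
#[local] Arguments reg_bimod : simpl never.
#[local] Arguments Defs.ract : simpl never.

Lemma lin0 X Y (f : X -> Y) : linear f -> f 0 = 0.
Proof. by move=> fl; rewrite -[0 in LHS](scale0r (0 : X)) (linZ _ _ fl) scale0r. Qed.

Lemma lin_sum X Y (f : X -> Y) (I : Type) (r : seq I) (F : I -> X) :
  linear f -> f (\sum_(i <- r) F i) = \sum_(i <- r) f (F i).
Proof.
by move=> fl; apply: (big_morph f _ (lin0 fl)) => u v; apply: linD.
Qed.

Lemma ract0 M (m : M) : ract m (0 : A) = 0.
Proof. by apply: (@addrI _ (ract m 0)); rewrite -ractDr !addr0. Qed.

Lemma ract_sum M (m : M) (I : Type) (r : seq I) (F : I -> A) :
  ract m (\sum_(i <- r) F i) = \sum_(i <- r) ract m (F i).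
Proof.
by apply: (big_morph (ract m) _ (ract0 m)) => a b; apply: ractDr.
Qed.

Lemma lin_iso_comp X Y (Z : lmodType A) (f : Y -> Z) (g : X -> Y) :
  lin_iso f -> lin_iso g -> lin_iso (f \o g).
Proof. by case=> fl fb [gl gb]; split; [apply: lin_comp | apply: bij_comp]. Qed.

Lemma lin_iso_inv X Y (f : X -> Y) : lin_iso f ->
  exists g, [/\ lin_iso g, cancel f g & cancel g f].
Proof.
case=> fl [g fK gK]; exists g; split=> //; split; last by exists f.
exact: lin_inv fK gK.
Qed.

Lemma right_inverse_nat M N : bimod_iso (bimod_mul M N) (reg_bimod A) ->
  exists t : forall X, btens M (btens N X) -> X,
    (forall X, lin_iso (t X)) /\
    forall X Y (h : X -> Y), linear h ->
      h \o t X =1 t Y \o btens_map (M := M) (btens_map (M := N) h).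
Proof.
move=> iMN; have [f [fl fn]] := assoc_nat M N.
have [p [pl pn _]] := btens_isol iMN; have [q [ql qn]] := unitl_nat A.
pose fi X := projT1 (cid (lin_iso_inv (fl X))).
have fiP X : [/\ lin_iso (fi X), cancel (f X) (fi X) & cancel (fi X) (f X)].
  exact: projT2 (cid (lin_iso_inv (fl X))).
exists (fun X => q X \o p X \o fi X); split=> [X|X Y h hl u].
  have [fil _ _] := fiP X; exact: lin_iso_comp (lin_iso_comp (ql X) (pl X)) fil.
have [_ fKX fiKX] := fiP X; have [_ fKY fiKY] := fiP Y.
rewrite -(fiKX u) /= fKX [LHS](qn X Y h hl) /= [btens_map _ _](pn X Y h hl) /=.
by rewrite [btens_map (M := M) _ _](fn X Y h hl) /= fKY.
Qed.

(** Fullness: conjugating N (x) g by [t] gives h with N (x) (M (x) h) = N (x) g, and N (x) - is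
    faithful because M (x) N (x) - is naturally isomorphic to the identity. *)
Lemma morita_of_inverse M N :
  bimod_iso (bimod_mul M N) (reg_bimod A) ->
  bimod_iso (bimod_mul N M) (reg_bimod A) -> induces_morita M.
Proof.
move=> /right_inverse_nat [s [sl sn]] /right_inverse_nat [t [tl tn]].
split=> [X Y h h' hl hl' e x|X Y g gl|Y].
- have [_ [ti _ tiK]] := tl X.
  rewrite -(tiK x) [LHS](tn X Y h hl) [RHS](tn X Y h' hl') /=.
  by rewrite (eq_btens_map (M := N) e).
- have [ti [[til _] tK tiK]] := lin_iso_inv (tl X).
  have Ng := btens_map_lin (M := N) gl.
  pose h := t Y \o btens_map (M := N) g \o ti.
  have hl : linear h by do 2?apply: lin_comp => //; case: (tl Y).
  exists h => // u; have Mh := btens_map_lin (M := M) hl.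
  have e : btens_map (M := N) (btens_map (M := M) h) =1 btens_map (M := N) g.
    move=> v; apply: (bij_inj (proj2 (tl Y))).
    by rewrite -[LHS](tn X Y h hl) /= /h /= tK.
  have [_ [si _ siK]] := sl (btens M X).
  rewrite -(siK u) [LHS](sn _ _ _ Mh) [RHS](sn _ _ _ gl) /=.
  by rewrite (eq_btens_map (M := M) e).
- by exists (btens N Y), (s Y); apply: sl.
Qed.

Lemma morita_two_sided_inverse M : induces_morita M ->
  exists N, [/\ induces_morita N, bimod_iso (bimod_mul M N) (reg_bimod A)
              & bimod_iso (bimod_mul N M) (reg_bimod A)].
Proof.
move=> hM; have [N [hN iNM]] := morita_inv hM; exists N; split=> //.
apply: (morita_cancel hN).
apply: bimod_iso_trans (bimod_iso_sym (bimod_mulA _ _ _)) _.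
apply: bimod_iso_trans (bimod_mul_isol _ iNM) _.
apply: bimod_iso_trans (bimod_mul1l _) _.
exact: bimod_iso_sym (bimod_mul1r _).
Qed.

(** Half of a Morita context. From 1 = \sum psi(n_i, m_i) and [phi_psi] follows m = \sum phi(m, n_i)
    m_i, so the phi(-, n_i) and the m_i form a dual basis of M as a left A-module. *)
Record context M N (phi : M -> N -> A) (psi : N -> M -> A) : Prop := Context {
  phiDl : forall n, {morph phi^~ n : m m' / m + m'};
  phiZ : forall a m n, phi (a *: m) n = a * phi m n;
  psiDl : forall m, {morph psi^~ m : n n' / n + n'};
  psiZ : forall a n m, psi (a *: n) m = a * psi n m;
  phi_psi : forall m n m', phi m n *: m' = ract m (psi n m');
  psi1 : exists s : seq (N * M), \sum_(q <- s) psi q.1 q.2 = 1 }.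

Lemma btens_seq M X (u : btens M X) :
  exists s : seq (M * X), u = \sum_(q <- s) bt q.1 q.2.
Proof.
move: u; apply: tens_ind => [m x|u v [s ->] [t ->]].
  by exists [:: (m, x)]; rewrite big_seq1.
by exists (s ++ t); rewrite big_cat.
Qed.

(* The two isomorphisms M (x) N -> A and N (x) M -> A need not satisfy
   [phi_psi]; they do so up to an automorphism [th] of M, which is absorbed
   into the second one. *)
Lemma morita_context M : induces_morita M ->
  exists N phi psi, @context M N phi psi.
Proof.
move=> hM; have [N [hN [f [fl fb fr]] [g [gl gb gr]]]] := morita_two_sided_inverse hM.
have [f' fK f'K] := fb; have f'l := lin_inv fl fK f'K.
pose q : btens (bimod_mul M N) M -> M := bt_lift (M := bimod_mul M N)
  (fun w m => (f w : A) *: m).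
have qb : bt_balanced (M := bimod_mul M N) (fun w (m : M) => (f w : A) *: m).
  split=> [w w' m|w m m'|w a m]; first by rewrite (linD fl) scalerDl.
    by rewrite scalerDr.
  by rewrite fr scalerA.
have qE w (m : M) : q (bt (w : bimod_mul M N) m) = (f w : A) *: m.
  exact: bt_liftE qb.
have ql : linear q.
  by apply: bt_lift_lin qb _ => a w m; rewrite (linZ _ _ fl) scalerA.
have qi : lin_iso q.
  split=> //; exists (fun m => bt (f' 1 : bimod_mul M N) m) => [u|m]; last first.
    by rewrite qE f'K scale1r.
  move: u; apply: bt_ext => [u v|//|w m]; first by rewrite (linD ql) btDr.
  rewrite qE -bt_bal; congr bt; apply: (can_inj fK).
  by rewrite fr f'K; apply: mul1r.
have [p0 [p0i p0E]] := unitr_lin_iso M.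
have [gM [gMi gME]] : exists h : btens M (btens N M) -> btens M (reg_bimod A),
    lin_iso h /\ forall m u, h (bt m u) = bt m (g u).
  exists (btens_map (M := M) g); split; last by move=> m u; rewrite btens_mapE.
  split; first exact: btens_map_lin.
  have [g' gK g'K] := gb; have g'l := lin_inv gl gK g'K.
  exists (btens_map (M := M) g') => u.
    rewrite -[LHS](btens_map_comp (M := M) g'l gl) (eq_btens_map (M := M) (h' := idfun) gK).
    exact: btens_map_id.
  rewrite -[LHS](btens_map_comp (M := M) gl g'l) (eq_btens_map (M := M) (h' := idfun) g'K).
  exact: btens_map_id.
have [a0 [a0i a0E]] := assoc_lin_iso M N M.
have [c [[cl cb] cK c'K]] := lin_iso_inv (lin_iso_comp p0i (lin_iso_comp gMi a0i)).
have [h [[hl hb] hK h'K]] := lin_iso_inv (lin_iso_comp qi (conj cl cb : lin_iso c)).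
(* [q] evaluates M (x) N (x) M through [f] on the left, the inverse of [c] evaluates it through [g]
   on the right; [th] is the discrepancy. *)
pose th : M -> M := q \o c; have thl : linear th by apply: lin_comp.
have thE m n m' : th (ract m (g (bt n m'))) = (f (bt m n) : A) *: m'.
  rewrite /th /= -qE; congr q; apply: (can_inj cK); rewrite c'K /=.
  by rewrite a0E gME p0E.
exists N, (fun m n => f (bt m n)), (fun n m => g (bt n (th m))).
split=> [n m m'|a m n|m n n'|a n m|m n m'|].
- by rewrite btDl (linD fl).
- by rewrite -btZ (linZ _ _ fl).
- by rewrite btDl (linD gl).
- by rewrite -btZ (linZ _ _ gl).
- have thi : injective th := can_inj hK.
  by apply: thi; rewrite thE (linZ _ _ thl).
- have [g' gK g'K] := gb; have [s e] := btens_seq (g' 1).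
  exists [seq (x.1, h x.2) | x <- s]; rewrite big_map /=.
  rewrite -[RHS]g'K e (lin_sum s _ gl); apply: eq_bigr => x _.
  by rewrite [th _]h'K.
Qed.

(** As M (x) - is full at the regular module, h comes from an endomorphism of A, that is, from right
    multiplication by the image of 1. *)
Lemma morita_end M (h : M -> M) : induces_morita M -> linear h ->
  exists a, forall m, h m = ract m a.
Proof.
move=> [_ Ms _] hl; have [f [fi fE]] := unitr_lin_iso M.
have [f' [[f'l _] fK f'K]] := lin_iso_inv fi; have fl := proj1 fi.
have [|h0 h0l e] := Ms _ _ (f' \o h \o f).
  by do 2?apply: lin_comp.
exists (h0 1) => m; rewrite -fE -(btens_mapE (M := M) h0l) e /= f'K fE.
by rewrite ract1.
Qed.

(** Faithfulness of M (x) -, applied to the right multiplications by a and b on A. *)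
Lemma morita_ract_inj M (a b : A) : induces_morita M ->
  (forall m : M, ract m a = ract m b) -> a = b.
Proof.
move=> [Mi _ _] e.
have rl c : linear (fun x : reg_bimod A => (x : A) * c : reg_bimod A).
  by apply: linDZ => [u v|d u]; [exact: mulrDl | exact: esym (mulrA _ _ _)].
rewrite -(mul1r a) -(mul1r b); apply: (Mi _ _ _ _ (rl a) (rl b)).
have bl c : linear (btens_map (M := M) (fun x : reg_bimod A => (x : A) * c : reg_bimod A)).
  exact: btens_map_lin.
apply: bt_ext => [||m x]; try exact: linD.
rewrite !btens_mapE //.
have bE c : bt m ((x : A) * c : reg_bimod A) = bt (ract (ract m x) c) (1 : reg_bimod A).
  by rewrite -ractM bt_bal; congr bt; apply: esym (mulr1 _).
by rewrite !bE e.
Qed.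
End Morita.

(** * Picard groups and outer automorphisms *)

Section GrpFacts.
Variable G : grp.
Implicit Types x y z : G.

Lemma gmulIl x y z : gmul x y = gmul x z -> y = z.
Proof. by move=> /(congr1 (gmul (ginv x))); rewrite !gmulA gmulVl !gmul1l. Qed.

Lemma gmulVr x : gmul x (ginv x) = gone.
Proof.
rewrite -[LHS]gmul1l -{1}(gmulVl (ginv x)) -gmulA (gmulA (ginv x)) gmulVl.
by rewrite gmul1l gmulVl.
Qed.

Lemma gmul1r x : gmul x gone = x.
Proof. by rewrite -(gmulVl x) gmulA gmulVr gmul1l. Qed.

Lemma gmulK x y : gmul (gmul x (ginv y)) y = x.
Proof. by rewrite -gmulA gmulVl gmul1r. Qed.

Lemma gmulKV x y : gmul (gmul x y) (ginv y) = x.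
Proof. by rewrite -gmulA gmulVr gmul1r. Qed.

Lemma gexpD x m n : gexp x (m + n) = gmul (gexp x m) (gexp x n).
Proof. by elim: m => [|m IH]; rewrite ?gmul1l //= IH gmulA. Qed.

Lemma gexpM x m n : gexp x (m * n) = gexp (gexp x m) n.
Proof.
by elim: n => [|n IH]; rewrite ?muln0 // mulnS gexpD IH.
Qed.

Lemma gexp1g n : gexp (gone : G) n = gone.
Proof. by elim: n => //= n ->; rewrite gmul1l. Qed.
End GrpFacts.

Lemma group_hom1 (G H : grp) (f : G -> H) : group_hom f -> f gone = gone.
Proof.
by move=> fM; apply: (@gmulIl H (f gone)); rewrite -fM gmul1l gmul1r.
Qed.

Lemma group_homX (G H : grp) (f : G -> H) x n : group_hom f ->
  f (gexp x n) = gexp (f x) n.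
Proof.
by move=> fM; elim: n => [|n /= <-]; [apply: group_hom1 | apply: fM].
Qed.

Section Twisted.
Variables (R : comNzRingType) (A : algebra R).
Implicit Types (M N : bimod A) (f g : alg_aut A) (x y : Pic A).

#[local] Arguments bimod_mul : simpl never.
#[local] Arguments Defs.ract : simpl never.

Lemma pic_memE M x : pic_mem M x <-> bimod_iso (pic_rep x) M.
Proof. by rewrite /pic_mem pic_repE. Qed.

Lemma pic_rep_mem x : pic_mem (pic_rep x) x.
Proof. by apply/pic_memE; apply: bimod_iso_refl. Qed.

Lemma pic_class_mem M (hM : induces_morita M) : pic_mem M (pic_class hM).
Proof. exact: bimod_iso_refl. Qed.

Lemma pic_mem_iso M N x : pic_mem M x -> pic_mem N x -> bimod_iso M N.
Proof.
move=> /pic_memE/bimod_iso_sym iM /pic_memE; exact: bimod_iso_trans.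
Qed.

Lemma pic_mem_trans M N x : bimod_iso M N -> pic_mem M x -> pic_mem N x.
Proof. by move=> iMN /pic_memE iM; apply/pic_memE; apply: bimod_iso_trans iMN. Qed.

Lemma pic_mem_eq M N x y : pic_mem M x -> pic_mem N y -> bimod_iso M N -> x = y.
Proof.
move=> /pic_memE iM /pic_memE iN i; rewrite -(pic_repK x) -(pic_repK y).
apply: pic_eq; apply: bimod_iso_trans iM _; apply: bimod_iso_trans i _.
exact: bimod_iso_sym.
Qed.

Lemma morita_iso M N : bimod_iso M N -> induces_morita M -> induces_morita N.
Proof.
move=> iMN /morita_two_sided_inverse [Q [_ iMQ iQM]]; have iNM := bimod_iso_sym iMN.
by apply: (@morita_of_inverse _ _ N Q);
  [apply: bimod_iso_trans (bimod_mul_isol Q iNM) _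
  |apply: bimod_iso_trans (bimod_mul_isor Q iNM) _].
Qed.

Lemma pic_mem_morita M x : pic_mem M x -> induces_morita M.
Proof. by move=> /pic_memE iM; apply: morita_iso iM (pic_rep_morita x). Qed.

Lemma pic_mem_mul M N x y : pic_mem M x -> pic_mem N y ->
  pic_mem (bimod_mul M N) (gmul x y).
Proof.
move=> /pic_memE iM /pic_memE iN.
apply: pic_mem_trans (bimod_mul_iso iM iN) _; exact: pic_class_mem.
Qed.

Lemma pic_mem1 : pic_mem (reg_bimod A) (gone : Pic A).
Proof. exact: pic_class_mem. Qed.

Lemma twistedE f (m : twisted_bimod f) (a : A) : ract m a = (m : A) * f a.
Proof. by []. Qed.

Lemma twisted_mul f g :
  bimod_iso (bimod_mul (twisted_bimod f) (twisted_bimod g))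
            (twisted_bimod (alg_aut_comp f g)).
Proof.
pose F (a b : A) : A^o := a * f b.
have Fb : bt_balanced (M := twisted_bimod f) (X := twisted_bimod g) F.
  split=> [a b c|a b c|a b c] /=; rewrite /F ?mulrDl ?alg_autD ?mulrDr //.
  by rewrite twistedE -mulrA -alg_autM.
pose h : btens (twisted_bimod f) (twisted_bimod g) -> A^o :=
  bt_lift (M := twisted_bimod f) (X := twisted_bimod g) F.
have hE a b : h (bt (a : twisted_bimod f) (b : twisted_bimod g)) = (a : A) * f b.
  exact: bt_liftE Fb.
have hl : linear h.
  by apply: bt_lift_lin Fb _ => a m x; rewrite /F -mulrA.
exists h; split=> //.
- exists (fun a => bt (a : twisted_bimod f) (1 : twisted_bimod g)) => [u|a].
    move: u; apply: bt_ext => [u v|//|a b]; first by rewrite (linD hl) btDl.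
    rewrite hE -[X in bt X _]/(@Defs.ract _ _ (twisted_bimod f) a b) bt_bal.
    by congr bt; apply: mulr1.
  by rewrite hE alg_aut1 mulr1.
- move=> u c; move: u; apply: bt_ext => [u v|u v|a b].
  + by rewrite ractDl (linD hl).
  + by rewrite (linD hl) ractDl.
  + rewrite bimod_mulE; transitivity ((a : A) * f ((b : A) * g c)).
      exact: hE.
    rewrite alg_autM mulrA.
    exact: esym (f_equal (fun z : A^o => (z : A) * f (g c) : A^o) (hE a b)).
Qed.

Lemma twisted_id : bimod_iso (twisted_bimod (alg_aut_id A)) (reg_bimod A).
Proof. by exists idfun; split=> //; exists idfun. Qed.

(** A left linear map between twisted bimodules is right multiplication by the image u of 1; it
    respects the right actions exactly when f(x) u = u g(x). *)
Lemma twisted_isoP f g :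
  bimod_iso (twisted_bimod f) (twisted_bimod g) <-> inner_eq f g.
Proof.
split=> [[h [hl [h' hK h'K] hr]]|[u [v [uv vu e]]]].
  pose h1 : A := h 1; pose h1' : A := h' 1.
  have h'l := lin_inv hl hK h'K.
  have hE (a : A) : h a = a * h1 :> A.
    by rewrite -[RHS](linZ a _ hl); congr h; apply: esym (mulr1 _).
  have h'E (a : A) : h' a = a * h1' :> A.
    by rewrite -[RHS](linZ a _ h'l); congr h'; apply: esym (mulr1 _).
  have uv : h1 * h1' = 1 by rewrite -h'E; apply: hK.
  have vu : h1' * h1 = 1 by rewrite -hE; apply: h'K.
  exists h1, h1'; split=> // x.
  have /= := hr 1 x; rewrite !twistedE mul1r hE => e.
  by rewrite -[RHS](congr1 (fun z => z * h1') e) -mulrA uv mulr1.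
exists (fun a : A^o => (a : A) * u : A^o); split.
- apply: linDZ => [a b|c a]; [exact: mulrDl | exact: esym (mulrA _ _ _)].
- by exists (fun a : A^o => (a : A) * v : A^o) => a; rewrite -mulrA ?uv ?vu mulr1.
- by move=> a b; rewrite !twistedE e -!mulrA vu mulr1.
Qed.

Lemma inner_eq_ext f g : f =1 g -> inner_eq f g.
Proof. by move=> e; exists 1, 1; split=> [||x]; rewrite ?mul1r ?mulr1. Qed.

Lemma twisted_morita f : induces_morita (twisted_bimod f).
Proof.
apply: (@morita_of_inverse _ _ _ (twisted_bimod (alg_aut_inv f)));
  apply: bimod_iso_trans (twisted_mul _ _) _;
  apply: bimod_iso_trans twisted_id; apply/twisted_isoP; apply: inner_eq_ext => a.
- exact: alg_aut_invK.
- exact: alg_autK.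
Qed.

Lemma out_classP f g : out_class f = out_class g <-> inner_eq f g.
Proof.
split; first by apply: cls_inj; apply: inner_eq_refl.
by apply: cls_eq; [apply: inner_eq_sym | apply: inner_eq_trans].
Qed.

Section OutPic.
Variables (a : R) (r : nat).
Implicit Types u v : Out_congr A a r.

Lemma out_congr_sval_inj u v : sval u = sval v -> u = v.
Proof. by case: u v => [x hx] [y hy] /= e; apply: eq_exist. Qed.

Definition out_rep u : alg_aut A := projT1 (cid (proj2_sig u)).

Lemma out_rep_congr u : alg_aut_congr a r (out_rep u).
Proof. by rewrite /out_rep; case: cid => f []. Qed.

Lemma out_repE u : sval u = out_class (out_rep u).
Proof. by rewrite /out_rep; case: cid => f []. Qed.

Lemma out_congr_eq u v : inner_eq (out_rep u) (out_rep v) -> u = v.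
Proof. by move=> e; apply: out_congr_sval_inj; rewrite !out_repE; apply/out_classP. Qed.

Definition out_to_pic u : Pic A := pic_class (twisted_morita (out_rep u)).

Lemma out_to_pic_mem u f : sval u = out_class f ->
  pic_mem (twisted_bimod f) (out_to_pic u).
Proof.
rewrite out_repE => /out_classP e.
by apply: pic_mem_trans (pic_class_mem _); apply/twisted_isoP.
Qed.

Lemma out_to_pic_hom : group_hom out_to_pic.
Proof.
move=> u v.
have muv : pic_mem (twisted_bimod (alg_aut_comp (out_rep u) (out_rep v)))
    (out_to_pic (gmul u v)).
  by apply: out_to_pic_mem; rewrite /= !out_repE out_mulE.
apply: (pic_mem_eq muv (pic_mem_mul (pic_class_mem _) (pic_class_mem _))).
exact: bimod_iso_sym (twisted_mul _ _).
Qed.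

Lemma out_to_pic_inj : injective out_to_pic.
Proof.
move=> u v e; apply: out_congr_eq; apply/twisted_isoP.
have hu := pic_class_mem (twisted_morita (out_rep u)).
rewrite -/(out_to_pic u) e in hu; exact: pic_mem_iso hu (pic_class_mem _).
Qed.
End OutPic.
End Twisted.

(** * Base change *)

Section BaseChange.
Variables (O k : comNzRingType) (res : {rmorphism O -> k}) (A : algebra O).
Implicit Types (M N : bimod A) (X Y : lmodType A).

#[local] Arguments bimod_mul : simpl never.
#[local] Arguments bc_bimod : simpl never.
#[local] Arguments Defs.ract : simpl never.

Local Notation Ak := (bc_algebra res A).
Local Notation "M ^k" := (bc_bimod res M) (at level 2, format "M ^k").

Lemma bc_tens_lift_bal X (V : zmodType) (F : k -> X -> V) :
  (forall x y m, F (x + y) m = F x m + F y m) ->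
  (forall x m n, F x (m + n) = F x m + F x n) ->
  (forall x c m, F (x * res c) m = F x (alg_map A c *: m)) ->
  exists h : bc res X -> V, {morph h : u v / u + v} /\
    forall x m, h (bct res x m) = F x m.
Proof.
move=> Dl Dr bal.
have Fb : balanced (fun (x : k) c => x * res c) (fun c (m : X) => alg_map A c *: m) F.
  by [].
exists (tens_lift F); split; first exact: tens_liftD Fb.
by move=> x m; apply: tens_liftE Fb _ _.
Qed.

Lemma bc_seq X (u : bc res X) :
  exists s : seq (k * X), u = \sum_(q <- s) bct res q.1 q.2.
Proof.
move: u; apply: tens_ind => [x m|u v [s ->] [t ->]].
  by exists [:: (x, m)]; rewrite big_seq1.
by exists (s ++ t); rewrite big_cat.
Qed.

Lemma bc_ractE M x (m : M) y (a : A) :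
  @Defs.ract _ _ M^k (bct res x m) (bct res y (a : A^o) : Ak)
  = bct res (x * y) (ract m a).
Proof.
apply: bc_opE; split=> [u v b|u b c|c u b|c u b].
- exact: ractDl.
- exact: ractDr.
- exact: ractZ.
- by rewrite ractM -ract_centr ractZ.
Qed.

Lemma bc_mulE x (a : A) y (b : A) :
  (bct res x (a : A^o) : Ak) * (bct res y (b : A^o) : Ak) = bct res (x * y) (a * b : A^o).
Proof.
apply: bc_opE; split=> [u v w|u v w|c u v|c u v]; rewrite ?mulrDl ?mulrDr //.
- by rewrite -[LHS]mulrA.
- by rewrite /GRing.scale /= mulrA -alg_centr -mulrA.
Qed.

Lemma bc_map_lin X Y (f : X -> Y) : linear f ->
  exists h : bc res X -> bc res Y, linear h /\
    forall x m, h (bct res x m) = bct res x (f m).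
Proof.
move=> fl.
have [||| h [hD hE]] := @bc_tens_lift_bal X (bc res Y) (fun x m => bct res x (f m)).
- by move=> *; rewrite bctDl.
- by move=> *; rewrite (linD fl) bctDr.
- by move=> *; rewrite bct_bal (linZ _ _ fl).
exists h; split=> //; apply: linDZ => // a u.
move: a; apply: bc_ext => [a b|a b|y a]; rewrite ?scalerDl ?hD //.
move: u; apply: bc_ext => [u v|u v|x m]; rewrite ?(hD, scalerDr) ?hD //.
by rewrite bcZ !hE bcZ (linZ _ _ fl).
Qed.

Lemma bc_iso M N : bimod_iso M N -> bimod_iso M^k N^k.
Proof.
case=> f [fl [g fK gK] fr]; have gl := lin_inv fl fK gK.
have [h [hl hE]] := bc_map_lin fl; have [h' [h'l h'E]] := bc_map_lin gl.
exists h; split=> //.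
- exists h'; apply: bc_ext => [u v|//|x m];
    rewrite ?(linD h'l) ?(linD hl) ?(linD h'l) //.
  + by rewrite hE h'E fK.
  + by rewrite h'E hE gK.
- move=> u a; move: a; apply: bc_ext => [a b|a b|y a].
  + by rewrite ractDr (linD hl).
  + by rewrite ractDr.
  move: u; apply: bc_ext => [u v|u v|x m].
  + by rewrite ractDl (linD hl).
  + by rewrite (linD hl) ractDl.
  + by rewrite bc_ractE !hE bc_ractE fr.
Qed.

Lemma bc_reg : bimod_iso (reg_bimod A)^k (reg_bimod Ak).
Proof. by exists idfun; split=> //; exists idfun. Qed.

Lemma bc_bt_bilin M N : @O_bilinear _ A M N (btens M N) (fun m n => bt m n).
Proof.
split=> [m m' n|m n n'|c m n|c m n].
- exact: btDl.
- exact: btDr.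
- by rewrite btZ.
- by rewrite btZ (ract_centr m) bt_bal.
Qed.

Lemma bc_mul_iso M N :
  bimod_iso (bimod_mul M^k N^k) (bimod_mul M N)^k.
Proof.
have FDl := @bc_opDl _ _ res _ _ _ _ _ (bc_bt_bilin M N).
have FDr := @bc_opDr _ _ res _ _ _ _ _ (bc_bt_bilin M N).
have FE := @bc_opE _ _ res _ _ _ _ _ (bc_bt_bilin M N).
set F := bc_op _ in FDl FDr FE.
have FZ (a : Ak) (u : M^k) v : F (a *: u) v = a *: (F u v : (bimod_mul M N)^k).
  move: a; apply: bc_ext => [a b|a b|z a]; rewrite ?scalerDl ?FDl //.
  move: u; apply: bc_ext => [u w|u w|x m]; rewrite ?(scalerDr, FDl) ?scalerDr //.
  move: v; apply: bc_ext => [v w|v w|y n]; rewrite ?(scalerDr, FDr) ?scalerDr //.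
  by rewrite bcZ !FE bcZ btZ mulrA.
have FR (a : Ak) (u : M^k) (v : N^k) :
    F u (ract v a) = @Defs.ract _ _ (bimod_mul M N)^k (F u v) a.
  move: a; apply: bc_ext => [a b|a b|z a]; rewrite ?ractDr ?FDr //.
  move: u; apply: bc_ext => [u w|u w|x m]; rewrite ?(ractDl, FDl) ?ractDl //.
  move: v; apply: bc_ext => [v w|v w|y n]; rewrite ?(ractDl, FDr) ?ractDl //.
  by rewrite bc_ractE !FE bc_ractE bimod_mulE mulrA.
have Fb : bt_balanced (M := M^k) (X := N^k) F.
  split=> [u v w|u v w|u a v]; first exact: FDl.
    exact: FDr.
  move: a; apply: bc_ext => [a b|a b|z a]; rewrite ?(ractDr, scalerDl) ?(FDl, FDr) //.
  move: u; apply: bc_ext => [u w|u w|x m]; rewrite ?(ractDl, FDl) ?FDl //.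
  move: v; apply: bc_ext => [v w|v w|y n]; rewrite ?(scalerDr, FDr) ?FDr //.
  by rewrite bc_ractE bcZ !FE bt_bal mulrA.
pose h : btens M^k N^k -> bc res (btens M N) := bt_lift (M := M^k) (X := N^k) F.
have hE (u : M^k) (v : N^k) : h (bt u v) = F u v by apply: bt_liftE Fb.
have hl : linear (h : btens M^k N^k -> (bimod_mul M N)^k) by apply: bt_lift_lin Fb FZ.
have one_bct (x : k) (m : M) (a : A) :
    @Defs.ract _ _ M^k (bct res x m) (bct res 1 (a : A^o) : Ak) = bct res x (ract m a).
  by rewrite bc_ractE mulr1.
(* The inverse map: x (x) (m (x) n) goes to (x (x) m) (x) (1 (x) n). *)
pose G0 x (m : M) (n : N) : btens M^k N^k :=
  bt (bct res x m : M^k) (bct res 1 n : N^k).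
have Gb x : bt_balanced (G0 x).
  split=> [m m' n|m n n'|m a n]; rewrite /G0.
  - by rewrite bctDr btDl.
  - by rewrite bctDr btDr.
  - by rewrite -one_bct bt_bal bcZ mulr1.
pose G x := bt_lift (G0 x).
have GE x m n : G x (bt m n) = G0 x m n by apply: bt_liftE.
have GD x : {morph G x : u v / u + v} by apply: bt_liftD.
have [||| g [gD gE]] := @bc_tens_lift_bal (btens M N) (btens M^k N^k) G.
- move=> x y w; move: w; apply: bt_ext => [u v|u v|m n]; rewrite ?GD //.
    by rewrite addrACA.
  by rewrite !GE /G0 bctDl btDl.
- by move=> x; apply: GD.
- move=> x c w; move: w; apply: bt_ext => [u v|u v|m n]; rewrite ?scalerDr ?GD //.
  by rewrite btZ !GE /G0 bct_bal.
exists h; split=> //.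
- exists g.
    apply: bt_ext => [u v|//|u v]; first by rewrite (linD hl) gD.
    rewrite hE; move: u; apply: bc_ext => [u w|u w|x m]; rewrite ?FDl ?gD ?btDl //.
    move: v; apply: bc_ext => [v w|v w|y n]; rewrite ?FDr ?gD ?btDr //.
    rewrite FE gE GE /G0 -[m in bct _ (x * y) m]ract1.
    by rewrite -(bc_ractE x m y) bt_bal bcZ mulr1 scale1r.
  apply: bc_ext => [u v|//|x w]; first by rewrite gD (linD hl).
  rewrite gE; move: w; apply: bt_ext => [w v|w v|m n]; rewrite ?GD ?(linD hl) ?bctDr //.
  by rewrite GE /G0 hE FE mulr1.
- move=> u a; move: u; apply: bt_ext => [u v|u v|u v].
  + by rewrite ractDl (linD hl).
  + by rewrite (linD hl) ractDl.
  + by rewrite bimod_mulE !hE FR.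
Qed.

(** Modules over [Ak] need not come from A, so the equivalence cannot be transported directly;
    extending scalars in a two-sided inverse of M suffices. *)
Lemma morita_bc M : induces_morita M -> induces_morita M^k.
Proof.
move=> /morita_two_sided_inverse [N [_ iMN iNM]].
by apply: (@morita_of_inverse _ _ _ N^k);
  apply: bimod_iso_trans (bc_mul_iso _ _) _; apply: bimod_iso_trans bc_reg;
  apply: bc_iso.
Qed.

Definition pic_bc (x : Pic A) : Pic Ak :=
  pic_class (morita_bc (pic_rep_morita x)).

Lemma pic_bc_mem M x : pic_mem M x -> pic_mem M^k (pic_bc x).
Proof.
move=> /pic_memE iM; apply: pic_mem_trans (bc_iso iM) _; exact: pic_class_mem.
Qed.

Lemma pic_bc_hom : group_hom pic_bc.
Proof.
move=> x y; have mx := pic_rep_mem x; have my := pic_rep_mem y.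
apply: (pic_mem_eq (pic_bc_mem (pic_mem_mul mx my))
                   (pic_mem_mul (pic_bc_mem mx) (pic_bc_mem my))).
exact: bimod_iso_sym (bc_mul_iso _ _).
Qed.

(** The elements f(a) - a lie in pi A and vanish after base change, so the identity map is an
    isomorphism. *)
Lemma bc_twisted (pi : O) (f : alg_aut A) : res pi = 0 ->
  alg_aut_congr pi 1 f -> bimod_iso (twisted_bimod f)^k (reg_bimod Ak).
Proof.
move=> res0 hf; apply: bimod_iso_trans bc_reg.
exists idfun; split=> //; first by exists idfun.
move=> u a; move: a; apply: bc_ext => [a b|a b|y a]; rewrite ?ractDr //.
move: u; apply: bc_ext => [u v|u v|x m]; rewrite /= ?ractDl //.
rewrite [LHS](bc_ractE (M := twisted_bimod f)) [RHS](bc_ractE (M := reg_bimod A)).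
have [t et] := hf a; have e : ract (m : twisted_bimod f) a =
    ract (m : reg_bimod A) a + alg_map A pi *: ((m : A) * t : A^o).
  rewrite -[LHS]/((m : A) * f a) -[f a](subrK a) et expr1 addrC mulrDr.
  by congr (_ + _); rewrite mulrA -alg_centr -mulrA.
by rewrite e bctDr -bct_bal res0 mulr0 (_ : bct res 0 _ = 0) ?addr0 //;
   apply: (@addrI _ (bct res 0 ((m : A) * t : A^o))); rewrite -bctDl !addr0.
Qed.
End BaseChange.

(** * Lattices over a complete local ring *)

Section Lattices.
Variables (O : idomainType) (k : fieldType) (res : {rmorphism O -> k}) (pi : O).
Hypotheses (compl : adically_complete pi)
  (res_surj : forall x : k, exists c : O, res c = x)
  (res_ker : forall c : O, res c = 0 <-> principal_ideal pi c)
  (pi_neq0 : pi != 0).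

Local Notation "c ** m" := (alg_map _ c *: m) (at level 40, left associativity).

Section OneAlgebra.
Variable A : algebra O.
Implicit Types X : lmodType A.

Definition pdvd X (r : nat) (m : X) : Prop := exists t : X, m = pi ^+ r ** t.

Lemma omul X (c d : O) (m : X) : c ** (d ** m) = (c * d) ** m.
Proof. by rewrite scalerA -rmorphM. Qed.

Lemma omulC X (c : O) (a : A) (m : X) : a *: (c ** m) = c ** (a *: m).
Proof. by rewrite !scalerA alg_centr. Qed.

Lemma pdvd0 X r : pdvd r (0 : X).
Proof. by exists 0; rewrite scaler0. Qed.

Lemma pdvdD X r (m n : X) : pdvd r m -> pdvd r n -> pdvd r (m + n).
Proof. by case=> t -> [u ->]; exists (t + u); rewrite scalerDr. Qed.

Lemma pdvdN X r (m : X) : pdvd r m -> pdvd r (- m).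
Proof. by case=> t ->; exists (- t); rewrite scalerN. Qed.

Lemma pdvdB X r (m n : X) : pdvd r m -> pdvd r n -> pdvd r (m - n).
Proof. by move=> hm hn; apply: pdvdD => //; apply: pdvdN. Qed.

Lemma pdvdZ X r a (m : X) : pdvd r m -> pdvd r (a *: m).
Proof. by case=> t ->; exists (a *: t); rewrite omulC. Qed.

Lemma pdvd_sum X r (I : Type) (s : seq I) (P : pred I) (F : I -> X) :
  (forall i, pdvd r (F i)) -> pdvd r (\sum_(i <- s | P i) F i).
Proof.
move=> hF; elim/big_ind: _ => // [|m n]; [exact: pdvd0 | exact: pdvdD].
Qed.

Lemma pdvd_leq X r r' (m : X) : (r <= r')%N -> pdvd r' m -> pdvd r m.
Proof.
by move=> /subnKC <- [t ->]; exists (pi ^+ (r' - r) ** t); rewrite omul exprD.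
Qed.

Lemma pdvd_mul X r r' (m : X) : pdvd r' m -> pdvd (r + r') (pi ^+ r ** m).
Proof. by case=> t ->; exists t; rewrite omul exprD. Qed.

Lemma pdvdM r r' (a b : A) : pdvd r (a : A^o) -> pdvd r' (b : A^o) ->
  pdvd (r + r') (a * b : A^o).
Proof.
case=> t -> [u ->]; exists ((t : A) * u : A^o).
rewrite exprD rmorphM /GRing.scale /=.
by rewrite !mulrA -[_ * t * _]mulrA -[t * _]alg_centr !mulrA.
Qed.

Lemma pdvdMl r (a b : A) : pdvd r (b : A^o) -> pdvd r (a * b : A^o).
Proof. exact: pdvdZ. Qed.

Lemma pdvdMr r (a b : A) : pdvd r (a : A^o) -> pdvd r (a * b : A^o).
Proof.
by case=> t ->; exists ((t : A) * b : A^o); rewrite /GRing.scale /= mulrA.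
Qed.

Lemma pdvdX r n (a : A) : pdvd r (a : A^o) -> pdvd (r * n) (a ^+ n : A^o).
Proof.
move=> ha; elim: n => [|n IH].
  by rewrite muln0; exists 1; rewrite expr0 rmorph1 scale1r.
by rewrite mulnS exprS; apply: pdvdM.
Qed.

Lemma pdvdP r (a : A) :
  pdvd r (a : A^o) <-> exists y, a = alg_map A (pi ^+ r) * y.
Proof. by []. Qed.

Definition dual_basis X (I : finType) (x : I -> X) (f : I -> X -> O) : Prop :=
  [/\ forall i, {morph f i : m n / m + n}, forall i c m, f i (c ** m) = c * f i m
    & forall m, m = \sum_i f i m ** x i].

Definition lattice X : Prop := exists I x f, @dual_basis X I x f.

Section DualBasis.
Variables (X : lmodType A) (I : finType) (x : I -> X) (f : I -> X -> O).
Hypothesis db : dual_basis x f.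

Lemma dual_basis0 i : f i 0 = 0.
Proof. by case: db => fD _ _; apply: (@addrI _ (f i 0)); rewrite -fD !addr0. Qed.

Lemma dual_basis_sub i m n : f i (m - n) = f i m - f i n.
Proof.
by case: db => fD _ _; apply: (@addIr _ (f i n)); rewrite -fD !subrK.
Qed.

Lemma dual_basis_sum i (J : Type) (s : seq J) (P : pred J) (F : J -> X) :
  f i (\sum_(j <- s | P j) F j) = \sum_(j <- s | P j) f i (F j).
Proof. by case: db => fD _ _; apply: (big_morph (f i) (fD i) (dual_basis0 i)). Qed.

Lemma dual_basis_pdvd r m :
  pdvd r m <-> forall i, principal_ideal (pi ^+ r) (f i m).
Proof.
case: db => fD fZ fE; split=> [[t ->] i|]; first by exists (f i t); rewrite fZ.
move=> /boolp.choice [t ft]; exists (\sum_i t i ** x i).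
by rewrite {1}(fE m) scaler_sumr; apply: eq_bigr => i _; rewrite omul -ft.
Qed.

Lemma dual_basis_eq0 m : (forall i, f i m = 0) -> m = 0.
Proof.
by case: db => _ _ fE h; rewrite (fE m) big1 // => i _; rewrite h rmorph0 scale0r.
Qed.
End DualBasis.

Lemma lattice_sep X (m : X) : lattice X -> (forall r, pdvd r m) -> m = 0.
Proof.
case=> I [x [f db]] h; apply: (dual_basis_eq0 db) => i; apply: (proj1 compl) => r.
by move: (h r) => /(dual_basis_pdvd db)/(_ i).
Qed.

Lemma lattice_tf X r (m : X) : lattice X -> pi ^+ r ** m = 0 -> m = 0.
Proof.
case=> I [x [f db]] h; apply: (dual_basis_eq0 db) => i; case: (db) => _ fZ _.
have /eqP := fZ i (pi ^+ r) m; rewrite h (dual_basis0 db) eq_sym mulf_eq0.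
by rewrite expf_eq0 (negPf pi_neq0) andbF /= => /eqP.
Qed.

Lemma lattice_lim X (u : nat -> X) : lattice X ->
  (forall n, pdvd n (u n.+1 - u n)) -> exists l, forall n, pdvd n (u n - l).
Proof.
case=> I [x [f db]] h; case: (db) => fD fZ fE.
have step n j : pdvd n (u (j + n)%N - u n).
  elim: j => [|j IH]; first by rewrite subrr; apply: pdvd0.
  rewrite -(subrK (u (j + n)%N) (u _)) -addrA; apply: pdvdD => //.
  by apply: pdvd_leq (h _); apply: leq_addl.
have steps n i j : (n <= i)%N -> (n <= j)%N -> pdvd n (u i - u j).
  move=> hi hj; have -> : u i - u j = (u i - u n) - (u j - u n).
    by rewrite opprB addrA subrK.
  by apply: pdvdB; [rewrite -(subnK hi) | rewrite -(subnK hj)].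
have /boolp.choice [l hl] i : exists l, forall r, principal_ideal (pi ^+ r) (f i (u r) - l).
  have [|l hl] := proj2 compl (fun n => f i (u n)).
    move=> r; exists r => m n hm hn; rewrite -(dual_basis_sub db).
    by move/(dual_basis_pdvd db): (steps _ _ _ hm hn); apply.
  (* Completeness gives no rate of convergence; a comparison at the index max N r restores the
     congruence modulo pi ^ r at r itself. *)
  exists l => r; have [N hN] := hl r.
  have [y ey] := hN _ (leq_maxl N r).
  have /(dual_basis_pdvd db)/(_ i) [z ez] := steps _ _ _ (leqnn r) (leq_maxr N r).
  exists (z + y); rewrite mulrDr -ez -ey (dual_basis_sub db).
  by rewrite addrA subrK.
exists (\sum_i l i ** x i) => n.
rewrite {1}(fE (u n)) -sumrB; apply: pdvd_sum => i.
have [y ey] := hl i n; exists (y ** x i).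
by rewrite -scalerBl -rmorphB ey omul.
Qed.

(** Each coordinate, reduced by [res], factors through k (x) X and thus detects divisibility by
    pi. *)
Lemma bct_eq0 X (m : X) : lattice X -> bct res 1 m = 0 <-> pdvd 1 m.
Proof.
case=> I [x [f db]]; case: (db) => fD fZ fE; split=> [e|[t ->]]; last first.
  rewrite expr1 -bct_bal (proj2 (res_ker _)) ?mulr0; last by exists 1; rewrite mulr1.
  by apply: (@addrI _ (bct res 0 t)); rewrite -bctDl !addr0.
apply/(dual_basis_pdvd db) => i; rewrite expr1; apply/res_ker.
have [||| h [hD hE]] := @bc_tens_lift_bal _ _ res A X k (fun c m => c * res (f i m)).
- by move=> *; rewrite mulrDl.
- by move=> *; rewrite fD rmorphD mulrDr.
- by move=> *; rewrite fZ rmorphM mulrA.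
have h0 : h 0 = 0 by apply: (@addrI _ (h 0)); rewrite -hD !addr0.
by rewrite -[LHS]mul1r -hE e h0.
Qed.

Lemma bc_repr X (u : bc res X) : exists m, u = bct res 1 m.
Proof.
have [s ->] := bc_seq u; elim: s => [|[c m] s [n IH]].
  exists 0; rewrite big_nil; apply: (@addrI _ (bct res 1 0)).
  by rewrite -bctDr !addr0.
have [d <-] := res_surj c; exists (d ** m + n).
by rewrite big_cons /= IH bctDr -bct_bal mul1r.
Qed.

Hypothesis latA : lattice A^o.

(** The geometric series in pi t converges, and its limit is the inverse. *)
Lemma one_sub_pi_unit (t : A) : exists s : A,
  s * (1 - alg_map A pi * t) = 1 /\ (1 - alg_map A pi * t) * s = 1.
Proof.
set z := alg_map A pi * t.
have zd n : pdvd n (z ^+ n : A^o).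
  by rewrite -[n in pdvd n]mul1n; apply: pdvdX; exists t; rewrite expr1.
pose u n : A^o := \sum_(i < n) z ^+ i.
have [|l hl] := @lattice_lim _ u latA.
  move=> n; have -> : u n.+1 = u n + (z ^+ n : A^o) by apply: big_ord_recr.
  by rewrite addrC addKr.
have geol n : (u n : A) * (1 - z) = 1 - z ^+ n.
  elim: n => [|n IH]; first by rewrite /u big_ord0 mul0r subrr.
  rewrite [u _]big_ord_recr [LHS]mulrDl IH mulrBr mulr1 -exprSr.
  by rewrite addrA subrK.
have geor n : (1 - z) * (u n : A) = 1 - z ^+ n.
  elim: n => [|n IH]; first by rewrite /u big_ord0 mulr0 subrr.
  rewrite [u _]big_ord_recr [LHS]mulrDr IH mulrBl mul1r -exprS.
  by rewrite addrA subrK.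
exists (l : A); split; apply/eqP; rewrite -subr_eq0; apply/eqP;
  apply: (lattice_sep latA) => r.
- have -> : (l : A) * (1 - z) - 1 = - ((u r - l : A) * (1 - z)) - z ^+ r.
    by rewrite mulrBl geol opprB -addrA -opprD subrK.
  by apply: pdvdB (zd r); apply: pdvdN; apply: pdvdMr.
- have -> : (1 - z) * (l : A) - 1 = - ((1 - z) * (u r - l : A)) - z ^+ r.
    by rewrite mulrBr geor opprB -addrA -opprD subrK.
  by apply: pdvdB (zd r); apply: pdvdN; apply: pdvdMl.
Qed.

(* Nakayama's lemma for cyclic modules, by successive approximation. *)
Lemma lattice_cyclic X (m : X) : lattice X ->
  (forall n : X, exists a : A, pdvd 1 (n - a *: m)) ->
  forall n : X, exists a : A, n = a *: m.
Proof.
move=> latX gen n.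
have /boolp.choice [g hg] : forall n : X, exists q : A * X,
    n = q.1 *: m + pi ** q.2.
  move=> n'; have [a [t et]] := gen n'; exists (a, t).
  by rewrite -[pi]expr1 -et addrC subrK.
(* The state (i, (a, r)) satisfies n = a m + pi ^ i r; one step expands the remainder r by [hg]. *)
pose F (q : nat * (A * X)) :=
  (q.1.+1, (q.2.1 + alg_map A (pi ^+ q.1) * (g q.2.2).1, (g q.2.2).2)).
pose v i := iter i F (0%N, (0 : A, n)).
have v1 i : (v i).1 = i by elim: i => //= i ->.
have vE i : n = (v i).2.1 *: m + pi ^+ i ** (v i).2.2.
  elim: i => [|i IH]; first by rewrite /= scale0r add0r expr0 rmorph1 scale1r.
  rewrite {1}IH {1}(hg (v i).2.2) /= v1 scalerDl scalerDr -addrA scalerA.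
  by rewrite omul -exprSr.
have [|a ha] := @lattice_lim A^o (fun i => (v i).2.1) latA.
  move=> i; rewrite /= v1 addrC addKr; exists ((g (v i).2.2).1 : A^o); reflexivity.
exists (a : A); apply/eqP; rewrite -subr_eq0; apply/eqP; apply: (lattice_sep latX) => r.
rewrite {1}(vE r) addrAC -scalerBl; apply: pdvdD; last by exists (v r).2.2.
have [t et] := ha r; exists ((t : A) *: m); rewrite scalerA.
by congr (_ *: m); apply: et.
Qed.
End OneAlgebra.
End Lattices.

Lemma linear_dependence (K : fieldType) (I : finType) (n : nat)
    (v : 'I_n -> I -> K) : (#|I| < n)%N ->
  exists c : 'I_n -> K, (exists j, c j != 0) /\
    forall i, \sum_j c j * v j i = 0.
Proof.
move=> ltIn; pose V := \matrix_(j < n, i < #|I|) v j (enum_val i).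
have : kermx V != 0.
  rewrite kermx_eq0 /row_free; apply: contraTneq ltIn => <-.
  by rewrite -leqNgt rank_leq_col.
case/rowV0Pn=> c /sub_kermxP cV c0; exists (c 0); split.
  by apply/existsP; rewrite -negb_forall; apply: contra c0 => /forallP h;
     apply/eqP/rowP => j; rewrite mxE; apply/eqP.
move=> i; have /rowP/(_ (enum_rank i)) := cV; rewrite mxE [RHS]mxE => e.
by rewrite -[RHS]e; apply: eq_bigr => j _; rewrite mxE enum_rankK.
Qed.

(** * Units and idempotents in the centre *)

Section CentralElements.
Variables (R : comNzRingType) (A : algebra R).
Implicit Types x y z : A.

Lemma central0 : central (0 : A). Proof. by move=> x; rewrite mul0r mulr0. Qed.
Lemma central1 : central (1 : A). Proof. by move=> x; rewrite mul1r mulr1. Qed.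
Lemma central_map c : central (alg_map A c). Proof. exact: alg_centr. Qed.
Lemma centralD x y : central x -> central y -> central (x + y).
Proof. by move=> hx hy z; rewrite mulrDl mulrDr hx hy. Qed.
Lemma centralN x : central x -> central (- x).
Proof. by move=> hx z; rewrite mulNr mulrN hx. Qed.
Lemma centralB x y : central x -> central y -> central (x - y).
Proof. by move=> hx hy; apply: centralD => //; apply: centralN. Qed.
Lemma centralM x y : central x -> central y -> central (x * y).
Proof. by move=> hx hy z; rewrite -mulrA hy mulrA hx mulrA. Qed.
Lemma centralX x n : central x -> central (x ^+ n).
Proof.
by move=> hx; elim: n => [|n IH]; [apply: central1 | rewrite exprS; apply: centralM].
Qed.
Lemma central_sum (I : Type) (s : seq I) (P : pred I) (F : I -> A) :
  (forall i, P i -> central (F i)) -> central (\sum_(i <- s | P i) F i).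
Proof. by move=> h; elim/big_ind: _ => //; [apply: central0 | apply: centralD]. Qed.
Lemma central_inv x y : central x -> x * y = 1 -> central y.
Proof.
move=> hx xy z; have yx : y * x = 1 by rewrite -hx.
by rewrite -[y * z]mulr1 -xy !mulrA -(mulrA y z) -(hx z) mulrA yx mul1r.
Qed.
End CentralElements.

Section Idempotents.
Variables (O : idomainType) (k : fieldType) (res : {rmorphism O -> k}) (pi : O).
Hypotheses (compl : adically_complete pi)
  (res_surj : forall x : k, exists c : O, res c = x)
  (res_ker : forall c : O, res c = 0 <-> principal_ideal pi c).
Variables (A : algebra O) (latA : lattice (A^o : lmodType A)).
Implicit Types x y z e d : A.

Local Notation pdvd r x := (pdvd pi r (x : A^o)).

Lemma unit_of_mod_pi x y : pdvd 1 (x * y - 1) -> exists s, x * s = 1.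
Proof.
case=> t; rewrite expr1 => et.
have [s [_ es]] := one_sub_pi_unit compl latA (- t).
exists (y * s); rewrite mulrA -[x * y](subrK 1) et addrC -[RHS]es.
by congr (_ * _); rewrite mulrN opprK.
Qed.

(* One Newton step for the equation [e * e = e]. *)
Lemma idempotent_step e d : d = e * e - e ->
  let q := 1 - e - e in
  (e + d * q) * (e + d * q) - (e + d * q) = d * d * (q * q - 1 - 1 - 1 - 1).
Proof.
move=> dE q; set w := d * q.
have [f fE] : exists f, f = 1 - e by exists (1 - e).
have qE : q = f - e by rewrite fE.
have ef : e * f = - d by rewrite fE mulrBr mulr1 dE opprB.
have fe : f * e = - d by rewrite fE mulrBl mul1r dE opprB.
have ee : e * e = e + d by rewrite dE addrC subrK.
have ff : f * f = f + d by rewrite {2}fE mulrBr mulr1 fe opprK.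
have ed : e * d = d * e by rewrite dE mulrBr mulrBl mulrA.
have eq : e * q = q * e by rewrite qE mulrBr mulrBl ef fe.
have dq : d * q = q * d.
  rewrite /q !(mulrBr, mulrBl) mulr1 mul1r. by rewrite ed.
have qq : q * q = 1 + d + d + d + d.
  rewrite qE mulrBr !mulrBl ef fe ee ff opprB !opprK !addrA.
  by rewrite [LHS](ACl (1*4*2*3*5*6)) /= fE subrK.
have ew : e * w = w * e by rewrite /w mulrA ed -!mulrA eq.
have wq : w * q = d + d * d + d * d + d * d + d * d.
  by rewrite /w -mulrA qq !mulrDr mulr1.
have wq' : w * q = w - e * w - e * w by rewrite ew /q !mulrBr mulr1.
have ww : w * w = d * d * (q * q) by rewrite /w mulrA -(mulrA d q) -dq !mulrA.
have -> : (e + w) * (e + w) - (e + w) = d - w * q + w * w.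
  rewrite wq' mulrDl !mulrDr ee ew !opprB opprD !addrA.
  by rewrite [LHS](ACl (2*3*4*7*5*1*6)) /= addrK.
clearbody q w; rewrite wq ww !mulrBr mulr1 !opprD !addrA subrr add0r.
by rewrite [LHS](ACl (5*1*2*3*4)).
Qed.

(** Newton's iteration e |-> 3 e ^ 2 - 2 e ^ 3, written so that the correction is a multiple of the
    error. By [idempotent_step] the new error is a multiple of the square of the old one;
    divisibility by pi ^ (n + 1) after n steps is enough for convergence. *)
Lemma central_idempotent_lift e0 : central e0 -> pdvd 1 (e0 * e0 - e0) ->
  exists e, [/\ central e, e * e = e & pdvd 1 (e - e0)].
Proof.
move=> ce0 id0.
pose F e := e + (e * e - e) * (1 - e - e); pose u n := iter n F e0.
have cu n : central (u n).
  elim: n => //= n IH; have h1 := @central1 _ A.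
  by apply: centralD => //; apply: centralM; do ?[apply: centralB | apply: centralM].
have idu n : pdvd n.+1 (u n * u n - u n).
  elim: n => //= n IH; rewrite [X in pdvd _ X](idempotent_step (erefl _)).
  apply: pdvdMr; apply: pdvd_leq (pdvdM IH IH).
  by rewrite addSn addnS !ltnS leq_addr.
have [|e he] := @lattice_lim _ pi compl A _ (u : nat -> A^o) latA.
  move=> n; have -> : u n.+1 - u n = (u n * u n - u n) * (1 - u n - u n) :> A.
    by rewrite /= /F addrC addKr.
  by apply: pdvdMr; apply: pdvd_leq (idu n).
have eq0 (x : A) : (forall r, pdvd r x) -> x = 0.
  exact: (lattice_sep compl latA).
exists (e : A); split.
- move=> x; apply/eqP; rewrite -subr_eq0; apply/eqP; apply: eq0 => r.
  have -> : (e : A) * x - x * (e : A) = x * (u r - (e : A)) - (u r - (e : A)) * x.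
    rewrite mulrBr mulrBl cu opprB !addrA.
    by rewrite [RHS](ACl (3*2*1*4)) /= addrK.
  by apply: pdvdB; [apply: pdvdMl | apply: pdvdMr]; apply: he.
- apply/eqP; rewrite -subr_eq0; apply/eqP; apply: eq0 => r.
  have -> : (e : A) * e - e = (u r * u r - u r) - (u r - (e : A)) * u r
      - e * (u r - (e : A)) + (u r - (e : A)) :> A.
    rewrite mulrBl mulrBr !opprB !addrA.
    by rewrite [RHS](ACl (5*8*1*4*3*6*7*2)) /= !addrK.
  apply: pdvdD; last exact: he.
  apply: pdvdB; last by apply: pdvdMl; apply: he.
  apply: pdvdB; last by apply: pdvdMr; apply: he.
  exact: pdvd_leq (idu r).
have -> : (e : A) - e0 = (u 1%N - e0) - (u 1%N - (e : A)).
  by rewrite opprB [RHS]addrC addrA subrK.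
apply: pdvdB; last exact: he.
by rewrite /= /F addrC addKr; apply: pdvdMr.
Qed.

(* A linear dependence modulo [pi] between the powers of z yields
   z ^ m = z ^ (m + 1) s modulo [pi] with s central; then (z s) ^ (m + 1) is
   idempotent modulo [pi], and its lift is 0 or 1. *)
Lemma central_dichotomy (z : A) :
  (forall e, central e -> e * e = e -> e = 0 \/ e = 1) -> central z ->
  (exists y, z * y = 1) \/ (exists n, pdvd 1 (z ^+ n)).
Proof.
move=> triv cz.
pose poly n (c : nat -> O) : A := \sum_(j < n) alg_map A (c j) * z ^+ j.
have cpoly n c : central (poly n c).
  by apply: central_sum => j _; apply: centralM; [apply: central_map | apply: centralX].
(* A constant term that vanishes modulo pi is dropped and a factor z moves into z ^ m; one that is
   nonzero modulo pi is divided out. *)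
have reduce n : forall c m, (exists2 j, (j < n)%N & res (c j) != 0) ->
    pdvd 1 (z ^+ m * poly n c) ->
    exists m' s, central s /\ pdvd 1 (z ^+ m' - z ^+ m'.+1 * s).
  elim: n => [|n IH] c m [j ltjn cj] hP; first by [].
  have polyS : poly n.+1 c = alg_map A (c 0%N) + z * poly n (fun i => c i.+1).
    rewrite /poly big_ord_recl expr0 mulr1; congr (_ + _).
    by rewrite mulr_sumr; apply: eq_bigr => i _; rewrite /= exprS !mulrA cz.
  have zmC (a : A) : z ^+ m * a = a * z ^+ m by apply: centralX.
  have [c0|c0] := eqVneq (res (c 0%N)) 0.
    apply: (IH (fun i => c i.+1) m.+1).
      by case: j ltjn cj => [|j] ltjn cj; [rewrite c0 eqxx in cj | exists j].
    have -> : z ^+ m.+1 * poly n (fun i => c i.+1) =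
        z ^+ m * poly n.+1 c - alg_map A (c 0%N) * z ^+ m.
      by rewrite polyS mulrDr -alg_centr addrC addKr exprSr mulrA.
    apply: pdvdB => //; have /res_ker [t ->] := c0.
    by rewrite rmorphM -mulrA; exists (alg_map A t * z ^+ m); rewrite expr1.
  have [u ru] := res_surj (res (c 0%N))^-1.
  have /res_ker [t et] : res (1 - u * c 0%N) = 0.
    by rewrite rmorphB rmorph1 rmorphM ru mulVf ?subrr.
  exists m, (- (alg_map A u * poly n (fun i => c i.+1))); split.
    by apply/centralN/centralM => //; apply: central_map.
  have -> : z ^+ m - z ^+ m.+1 * - (alg_map A u * poly n (fun i => c i.+1)) =
      alg_map A (1 - u * c 0%N) * z ^+ m + alg_map A u * (z ^+ m * poly n.+1 c).
    set Q := poly n _; have -> : alg_map A u * (z ^+ m * poly n.+1 c) =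
        alg_map A (u * c 0%N) * z ^+ m + z ^+ m.+1 * (alg_map A u * Q).
      rewrite polyS !mulrDr -(alg_centr (c 0%N) (z ^+ m)) rmorphM !mulrA.
      by rewrite -(mulrA (alg_map A u) _ z) -exprSr (alg_centr u (z ^+ _)).
    by rewrite rmorphB rmorph1 mulrBl mul1r mulrN opprK addrA subrK.
  apply: pdvdD; last exact: pdvdMl.
  by rewrite et rmorphM -mulrA; exists (alg_map A t * z ^+ m); rewrite expr1.
have [I [x [f db]]] := latA.
(* The |I| + 1 powers of z have only |I| coordinates over k. *)
have [c [[j cj] hc]] := @linear_dependence k I #|I|.+1
  (fun j i => res (f i (z ^+ j))) (ltnSn _).
have /boolp.choice [C hC] : forall i, exists d : O, res d = c i by move=> i; apply: res_surj.
pose C' i := C (inord i).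
have [||m [s [cs hs]]] := reduce #|I|.+1 C' 0%N.
- by exists j => //; rewrite /C' inord_val hC.
- rewrite expr0 mul1r; apply/(dual_basis_pdvd pi db) => i; apply/res_ker.
  rewrite (dual_basis_sum db) rmorph_sum -[RHS](hc i) /=; apply: eq_bigr => l _.
  by case: (db) => _ fZ _; rewrite [f i _]fZ rmorphM /C' inord_val hC.
have zs i : pdvd 1 (z ^+ m.+1 - z ^+ m.+1 * (z * s) ^+ i).
  elim: i => [|i IH]; first by rewrite expr0 mulr1 subrr; apply: pdvd0.
  have -> : z ^+ m.+1 - z ^+ m.+1 * (z * s) ^+ i.+1 =
     z ^+ m.+1 - z ^+ m.+1 * (z * s) ^+ i + z * (z ^+ m - z ^+ m.+1 * s) * (z * s) ^+ i.
    rewrite mulrBr -exprS mulrBl addrA subrK; congr (_ - _).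
    by rewrite [(z * s) ^+ i.+1]exprS !mulrA -exprSr -exprS.
  by apply: pdvdD => //; apply: pdvdMr; apply: pdvdMl.
have czs : central (z * s) by apply: centralM.
have [|e [ce ee he]] := central_idempotent_lift (centralX m.+1 czs).
  have -> : (z * s) ^+ m.+1 * (z * s) ^+ m.+1 - (z * s) ^+ m.+1 =
      - (s ^+ m.+1 * (z ^+ m.+1 - z ^+ m.+1 * (z * s) ^+ m.+1)).
    have sz : s ^+ m.+1 * z ^+ m.+1 = (z * s) ^+ m.+1.
      by rewrite [RHS]exprMn_comm //; apply: centralX.
    by rewrite mulrBr mulrA sz opprB.
  by apply: pdvdN; apply: pdvdMl.
(* If the lift is 0, then z ^ (m + 1) is congruent to z ^ (m + 1) (z s) ^ (m + 1), hence to 0; if it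
   is 1, then s (z s) ^ m inverts z modulo pi. *)
case: (triv e ce ee) he => -> he; [right|left].
  exists m.+1; rewrite -[z ^+ _](subrK (z ^+ m.+1 * (z * s) ^+ m.+1)).
  apply: pdvdD => //; apply: pdvdMl.
  by have := pdvdN he; rewrite sub0r opprK.
have [|y zy] := @unit_of_mod_pi z (s * (z * s) ^+ m); last by exists y.
by rewrite mulrA -exprS -opprB; apply: pdvdN.
Qed.
End Idempotents.

(** * The valuation of O *)

Section LocalRing.
Variables (O : idomainType) (k : fieldType) (res : {rmorphism O -> k}) (pi : O).
Hypotheses (compl : adically_complete pi)
  (res_surj : forall x : k, exists c : O, res c = x)
  (res_ker : forall c : O, res c = 0 <-> principal_ideal pi c)
  (pi_neq0 : pi != 0).

(** O over itself, so that [one_sub_pi_unit] also inverts scalars. *)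
Definition self_algebra : algebra O := @Algebra O O idfun (@mulrC O).

Lemma self_lattice : lattice (self_algebra^o : lmodType self_algebra).
Proof.
exists unit, (fun=> 1), (fun=> idfun); split=> // m.
by rewrite big_const card_unit /= addr0; apply: esym (mulr1 _).
Qed.

Lemma res_unit u : res u != 0 -> exists v, u * v = 1.
Proof.
move=> u0; have [w rw] := res_surj (res u)^-1.
have /res_ker [t et] : res (1 - u * w) = 0.
  by rewrite rmorphB rmorph1 rmorphM rw mulfV ?subrr.
have [s [_ es]] := @one_sub_pi_unit O pi compl self_algebra self_lattice t.
exists (w * s); rewrite mulrA -[RHS]es; congr (_ * s).
by rewrite /= -et opprB addrC subrK.
Qed.

Lemma res_pi : res pi = 0.
Proof. by apply/res_ker; exists 1; rewrite mulr1. Qed.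

(** Factors pi are split off until the cofactor is nonzero in k; otherwise every power of pi would
    divide x, and x would be 0 by separatedness. *)
Lemma pi_valuation x : x != 0 -> exists d u, res u != 0 /\ x = pi ^+ d * u.
Proof.
move=> x0; apply: contrapT => hx.
suff h r : principal_ideal (pi ^+ r) x.
  by case/eqP: x0; apply: (proj1 compl).
elim: r => [|r [y ey]]; first by exists x; rewrite expr0 mul1r.
have [/res_ker [t et]|y0] := eqVneq (res y) 0.
  by exists t; rewrite exprSr -mulrA -et.
by case: hx; exists r, y.
Qed.

Lemma principal_ideal_pi d e u : res u != 0 ->
  principal_ideal (pi ^+ d) = principal_ideal (pi ^+ e * u) -> d = e.
Proof.
move=> u0 eI; have [v uv] := res_unit u0.
have pd (m n : nat) t : pi ^+ m = pi ^+ n * t -> (n <= m)%N.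
  move=> eq; rewrite leqNgt; apply/negP => ltmn.
  move: eq; rewrite -(subnKC (ltnW ltmn)) exprD -mulrA -[LHS]mulr1.
  move/(mulfI (expf_neq0 m pi_neq0))/(congr1 res).
  rewrite rmorph1 rmorphM rmorphXn res_pi expr0n subn_eq0 leqNgt ltmn /= mul0r.
  by move/eqP; rewrite oner_eq0.
apply/eqP; rewrite eqn_leq; apply/andP; split.
  have : principal_ideal (pi ^+ d) (pi ^+ e * u) by rewrite eI; exists 1; rewrite mulr1.
  by case=> t et; apply: (pd e d (t * v)); rewrite mulrA -et -mulrA uv mulr1.
have : principal_ideal (pi ^+ e * u) (pi ^+ d) by rewrite -eI; exists 1; rewrite mulr1.
by case=> t et; apply: (pd d e (u * t)); rewrite mulrA.
Qed.

Lemma principal_ideal_unit d u : res u != 0 ->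
  principal_ideal (pi ^+ d * u) = principal_ideal (pi ^+ d).
Proof.
move=> /res_unit [v uv]; apply/seteqP; split=> x [t ->].
  by exists (u * t); rewrite mulrA.
by exists (v * t); rewrite mulrA -(mulrA _ u) uv mulr1.
Qed.
End LocalRing.

(** * Blocks and defect groups *)

Section BlockAlgebra.
Variables (O : idomainType) (gT : finGroupType).
Variable b : block (group_algebra O gT).
Local Notation B := (block_algebra b).
Local Notation A := (group_algebra O gT).
Local Notation b0 := (block_idem b : A).

Definition delta (g : gT) : A := [ffun h => (h == g)%:R] : gralg O gT.

Lemma deltaM g h : delta g * delta h = delta (g * h).
Proof.
apply/ffunP => x; rewrite ffunE (bigD1 g) //= !ffunE eqxx mul1r.
rewrite big1 ?addr0 => [|i ig]; last by rewrite ffunE (negPf ig) mul0r.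
by congr (nat_of_bool _)%:R; rewrite -(inj_eq (mulgI g)) mulKVg.
Qed.

Lemma gr_mapE c (x : A) g : ((alg_map A c * x : A) : gralg O gT) g = c * (x : gralg O gT) g.
Proof.
rewrite ffunE (bigD1 1%g) //= ffunE eqxx invg1 mul1g big1 ?addr0 // => h.
by rewrite ffunE => /negPf ->; rewrite mul0r.
Qed.

Lemma delta_span (x : A) : x = \sum_g alg_map A ((x : gralg O gT) g) * delta g.
Proof.
apply/ffunP => h; rewrite sum_ffunE (bigD1 h) //= gr_mapE ffunE eqxx mulr1.
by rewrite big1 ?addr0 // => g gh; rewrite gr_mapE ffunE eq_sym (negPf gh) mulr0.
Qed.

Lemma bidem : b0 * b0 = b0. Proof. by case: (block_ci b). Qed.
Lemma bcentral (a : A) : b0 * a = a * b0. Proof. by case: (block_ci b). Qed.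

Definition bval (x : B) : A := sval x.

Lemma bval_idem (x : B) : bval x * b0 = bval x.
Proof. exact: (eqP (valP x)). Qed.

Lemma bval_inj : injective bval. Proof. exact: val_inj. Qed.

Fact bprojP (a : A) : a * b0 * b0 == a * b0.
Proof. by rewrite -mulrA bidem. Qed.

Definition bproj (a : A) : B := exist (fun x : A => x * b0 == x) _ (bprojP a).

Lemma bprojE a : bval (bproj a) = a * b0. Proof. by []. Qed.
Lemma bvalD x y : bval (x + y) = bval x + bval y. Proof. by []. Qed.
Lemma bvalM x y : bval (x * y) = bval x * bval y. Proof. by []. Qed.
Lemma bval1 : bval 1 = b0. Proof. by []. Qed.
Lemma bval_map c : bval (alg_map B c) = alg_map A c * b0. Proof. by []. Qed.

Lemma bprojK x : bproj (bval x) = x.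
Proof. by apply: bval_inj; apply: bval_idem. Qed.

Lemma bprojD a a' : bproj (a + a') = bproj a + bproj a'.
Proof. by apply: bval_inj; rewrite bvalD !bprojE mulrDl. Qed.

Lemma bproj0 : bproj 0 = 0.
Proof. by apply: (@addrI _ (bproj 0)); rewrite -bprojD !addr0. Qed.

Lemma bproj_sum (I : Type) (s : seq I) (Q : pred I) (F : I -> A) :
  bproj (\sum_(i <- s | Q i) F i) = \sum_(i <- s | Q i) bproj (F i).
Proof. exact: (big_morph bproj bprojD bproj0). Qed.

Lemma bprojM a a' : bproj (a * a') = bproj a * bproj a'.
Proof.
apply: bval_inj; rewrite bvalM !bprojE -!mulrA; congr (_ * _).
by rewrite [RHS]mulrA bcentral -mulrA bidem.
Qed.

Lemma bproj_map c : bproj (alg_map A c) = alg_map B c.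
Proof. exact: bval_inj. Qed.

Definition gelt (g : gT) : B := bproj (delta g).

Lemma geltM g h : gelt g * gelt h = gelt (g * h).
Proof. by rewrite -bprojM deltaM. Qed.

Lemma gelt_span (x : B) : x = \sum_g alg_map B ((bval x : gralg O gT) g) * gelt g.
Proof.
rewrite -{1}(bprojK x) {1}(delta_span (bval x)) bproj_sum.
by apply: eq_bigr => g _; rewrite bprojM bproj_map.
Qed.

(** The elements g b may be dependent in B; the coefficients of x in OG still serve as coordinates,
    since x = x b. *)
Lemma block_dual_basis : @dual_basis O B B^o gT gelt (fun g x => (bval x : gralg O gT) g).
Proof.
split=> [g x y|g c x|x]; last exact: gelt_span.
- by rewrite /= ffunE.
- rewrite -gr_mapE; congr (fun_of_fin _ g).
  transitivity (bval (alg_map B c) * bval x); first by [].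
  by rewrite bval_map -mulrA bcentral bval_idem.
Qed.

Lemma block_lattice : lattice (B^o : lmodType B).
Proof. by exists gT, gelt, (fun g x => (bval x : gralg O gT) g); apply: block_dual_basis. Qed.

Lemma block_one_neq0 : (1 : B) <> 0.
Proof. by move=> /(congr1 bval); rewrite bval1; apply: (block_neq0 (b := b)). Qed.

Lemma bval_central (e : B) : central e -> central (bval e).
Proof.
move=> ce a; transitivity (bval (e * bproj a)).
  by rewrite bvalM bprojE -bcentral mulrA bval_idem.
by rewrite ce bvalM bprojE -mulrA bcentral bval_idem.
Qed.

Lemma central_coef_conj (x : A) g h : central x ->
  (x : gralg O gT) (g ^ h)%g = (x : gralg O gT) g.
Proof.
move=> cx; have := cx (delta h) => /ffunP/(_ (g * h)%g).
rewrite ffunE [RHS]ffunE (bigD1 g) //= mulKg ffunE eqxx mulr1 big1 => [|i ig].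
  rewrite (bigD1 h) //= ffunE eqxx mul1r big1 => [|i ih].
    by rewrite !addr0 -conjgE => ->.
  by rewrite ffunE (negPf ih) mul0r.
rewrite ffunE (_ : (_ == h) = false) ?mulr0 //; apply: contraNF ig.
by move=> /eqP /(congr1 (mulg i)); rewrite mulKVg => /mulIg ->.
Qed.

(** In OG, e and b - e are orthogonal central idempotents with sum b, and b is primitive. *)
Lemma block_central_idem (e : B) : central e -> e * e = e -> e = 0 \/ e = 1.
Proof.
move=> ce ee; have cv := bval_central ce.
have vv : bval e * bval e = bval e by rewrite -bvalM ee.
have cb : central (b0 - bval e).
  by apply: centralB => //; apply: bcentral.
have [| | | |h|h] := @block_prim _ _ b (bval e) (b0 - bval e).
- by split.
- split=> //; rewrite mulrBl !mulrBr bidem vv bval_idem bcentral bval_idem subrr.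
  by rewrite subr0.
- by rewrite mulrBr vv bval_idem subrr.
- by rewrite addrC subrK.
- by left; apply: bval_inj; rewrite h.
- by right; apply: bval_inj; rewrite bval1; apply/esym/eqP; rewrite -subr_eq0 h.
Qed.

Lemma central_gelt (z : B) : (forall g, gelt g * z = z * gelt g) -> central z.
Proof.
move=> h x; rewrite (gelt_span x) mulr_suml mulr_sumr; apply: eq_bigr => g _.
by rewrite -mulrA h !mulrA (alg_centr _ z).
Qed.
End BlockAlgebra.

(** The fibres of g |-> x ^ g are cosets of the centralizer of x. *)
Lemma sum_class (V : nmodType) (gT : finGroupType) (F : gT -> V) (x : gT) :
  \sum_(g : gT) F (x ^ g)%g = (\sum_(y in (x ^: [set: gT])%g) F y) *+ #|'C[x]%g|.
Proof.
rewrite (partition_big (conjg x) (mem (x ^: [set: gT])%g)) /=; last first.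
  by move=> g _; apply: imset_f; rewrite inE.
rewrite -sumrMnl; apply: eq_bigr => _ /imsetP[h _ ->].
rewrite (eq_bigr (fun=> F (x ^ h)%g)) => [|g /eqP -> //].
rewrite sumr_const; congr (_ *+ _).
rewrite -(card_rcoset 'C[x]%g h) -sum1_card -sum1_card; apply: eq_bigl => g.
rewrite mem_rcoset cent1C; apply/eqP/cent1P => [e|/commgP/conjg_fixP].
  by apply/commgP/conjg_fixP; rewrite conjgM e -conjgM mulgV conjg1.
by move=> /(congr1 (conjg^~ h)); rewrite /= -!conjgM mulgKV.
Qed.

(** A nontrivial orbit of P under conjugation has length divisible by p and contributes 0 in k; the
    other orbits are the elements of C(P). *)
Lemma sum_fixed_points (k : fieldType) (p : nat) (gT : finGroupType)
    (P : {group gT}) (F : gT -> k) : p \in [pchar k] -> (p.-group P)%g ->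
  (forall h t, t \in P -> F (h ^ t)%g = F h) ->
  (forall h, h \in 'C(P)%g -> F h = 0) -> \sum_h F h = 0.
Proof.
move=> pk pP Fc F0.
have aP : [acts P, on [set: gT] | 'J]%g by apply/actsP => a _ x; rewrite !inE.
have tr := orbit_partition aP.
rewrite (eq_bigl (mem [set: gT])); last by move=> x; rewrite !inE.
rewrite (set_partition_big _ tr) /= big1 // => X /imsetP[x _ ->].
rewrite (eq_bigr (fun=> F x)) => [|_ /orbitP[t tP <-]]; last exact: Fc.
rewrite sumr_const; have [n Pn] := p_natP pP.
have /dvdn_pfactor : (#|orbit 'J%act P x| %| p ^ n)%N by rewrite -Pn; apply: dvdn_orbit.
move=> /(_ (pcharf_prime pk)) [[|m] _ cO]; last first.
  by rewrite cO expnS mulrnA (mulrn_pchar pk) mul0rn.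
rewrite F0 ?mul0rn //; have /orbit1P := card_orbit1 cO.
by rewrite afixJ.
Qed.

(** * The trace of a block and its defect group *)

Section Higman.
Variables (O : idomainType) (k : fieldType) (res : {rmorphism O -> k}) (pi : O).
Variables (p : nat) (gT : finGroupType) (b : block (group_algebra O gT)) (P : {group gT}).
Hypotheses (compl : adically_complete pi)
  (res_surj : forall x : k, exists c : O, res c = x)
  (res_ker : forall c : O, res c = 0 <-> principal_ideal pi c)
  (k_char : p \in [pchar k]) (P_defect : defect_group res p b P).

Local Notation B := (block_algebra b).
Local Notation A := (group_algebra O gT).
Local Notation b0 := (block_idem b : gralg O gT).
Local Notation gelt := (gelt b).
Local Notation pdvd r x := (pdvd pi r (x : B^o)).

Let latB := block_lattice b.

(** Divide by the sum, so that it becomes 1. By [central_dichotomy] the first summand x is a unit or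
    nilpotent modulo pi; in the second case 1 - x, the sum of the others, is a unit. *)
Lemma local_center (I : Type) (s : seq I) (F : I -> B) :
  (forall i, central (F i)) -> (exists y, (\sum_(i <- s) F i) * y = 1) ->
  exists i y, F i * y = 1.
Proof.
move=> cF; elim: s => [|i s IH] [y].
  by rewrite big_nil mul0r => /esym/(block_one_neq0 (b := b)).
have cS (r : seq I) : central (\sum_(i <- r) F i) by apply: central_sum.
move=> hy; have cy := central_inv (cS _) hy; move: hy; rewrite big_cons mulrDl => hy.
have [[z hz]|[n hn]] := central_dichotomy compl res_surj res_ker latB
    (@block_central_idem _ _ b) (centralM (cF i) cy).
  by exists i, (y * z); rewrite mulrA.
apply: IH; set x := F i * y in hy hn.
have [|z hz] := @unit_of_mod_pi _ pi compl _ latB (1 - x) (\sum_(j < n) x ^+ j).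
  have -> : (1 - x) * (\sum_(j < n) x ^+ j) - 1 = - x ^+ n.
    by rewrite -[1 - x]opprB mulNr -subrX1 opprB addrAC subrr add0r.
  exact: pdvdN.
by exists (y * z); rewrite mulrA -[_ * y](addKr x) hy addrC.
Qed.

Lemma block_coef_conj g h : b0 (g ^ h)%g = b0 g.
Proof. by apply: central_coef_conj; apply: bcentral. Qed.

Let K x := (x ^: [set: gT])%g.
(** The component of the block idempotent supported on X, projected to B. The components on the
    conjugacy classes are central and add up to 1. *)
Definition class_part (X : {set gT}) : B := \sum_(g in X) alg_map B (b0 g) * gelt g.

Lemma class_part_central x : central (class_part (K x)).
Proof.
apply: central_gelt => h; rewrite /class_part mulr_sumr mulr_suml.
rewrite (reindex_inj (conjg_inj h)); apply: eq_big => [g|g _].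
  by rewrite /K class_sym classGidl ?inE // class_sym.
by rewrite block_coef_conj mulrA -alg_centr -!mulrA !geltM conjgE mulKVg.
Qed.

Lemma class_part_const x : class_part (K x) =
  alg_map B (b0 x) * \sum_(g in K x) gelt g.
Proof.
rewrite mulr_sumr; apply: eq_bigr => _ /imsetP[h _ ->].
by rewrite block_coef_conj.
Qed.

Lemma one_class_parts : \sum_(X in classes [set: gT]%g) class_part X = 1.
Proof.
rewrite -(set_partition_big _ (classes_partition [set: gT]%G)).
rewrite (eq_bigl xpredT) => [|g]; last by rewrite inE.
by rewrite -[RHS](bprojK (1 : B)) (gelt_span (bproj b (bval 1))) bprojK.
Qed.

Lemma unit_class_part : exists x y, class_part (K x) * y = 1.
Proof.
(* For a class X, [K (repr X)] is X; this form makes the summand central for every set X, as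
   [local_center] demands. *)
have [X||X [y hy]] := @local_center _ (enum (classes [set: gT]%g))
    (fun X => class_part (K (repr X))).
- exact: class_part_central.
- exists 1; rewrite mulr1 big_enum /= -[RHS]one_class_parts.
  apply: eq_bigr => _ /imsetP[x _ ->]; congr class_part.
  by apply: class_eqP; apply: mem_repr (class_refl _ _).
by exists (repr X), y.
Qed.

(* Otherwise P acts by conjugation without fixed points on the class, and every
   coefficient of the block idempotent at an element of C(P) is divisible by p. *)
Lemma class_meets_defect_centralizer x y : class_part (K x) * y = 1 ->
  brauer res P b0 != 0 -> (p.-group P)%g -> exists2 x', x' \in K x & x' \in 'C(P)%g.
Proof.
move=> xy br pP; have cz := class_part_central x; have cy := central_inv cz xy.
apply: contrapT => none; case/eqP: br; apply/ffunP => g; rewrite !ffunE.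
have cP : sgval g \in 'C(P)%g by apply: valP.
pose w : A := \sum_(h in K x) alg_map A (b0 h) * delta O h.
have wE h : (w : gralg O gT) h = if h \in K x then b0 h else 0.
  rewrite /w sum_ffunE; case: ifP => hK.
    rewrite (bigD1 h) //= gr_mapE ffunE eqxx mulr1 big1 ?addr0 // => i /andP[_ ih].
    by rewrite gr_mapE ffunE eq_sym (negPf ih) mulr0.
  rewrite big1 // => i iK; rewrite gr_mapE ffunE (_ : h == i = false) ?mulr0 //.
  by apply: contraFF hK => /eqP ->.
have wz : bproj b w = class_part (K x).
  by rewrite bproj_sum; apply: eq_bigr => h _; rewrite bprojM bproj_map.
have -> : b0 = w * bval y.
  rewrite -[LHS](bval1 b) -xy bvalM -wz bprojE -mulrA bcentral; congr (_ * _).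
  exact: bval_idem.
have vyC (h t : gT) : (bval y : gralg O gT) (h ^ t)%g = (bval y : gralg O gT) h.
  by apply: central_coef_conj; apply: bval_central.
(* As g centralizes P, the term w(h) y(h^-1 g) is unchanged when h is conjugated by an element of
   P. *)
rewrite ffunE rmorph_sum; apply: (sum_fixed_points k_char pP) => h.
  move=> t tP; rewrite !wE class_sym classGidl ?inE // class_sym block_coef_conj.
  suff -> : (bval y : gralg O gT) ((h ^ t)^-1 * sgval g)%g =
      (bval y : gralg O gT) (h^-1 * sgval g)%g by [].
  rewrite -[RHS](vyC _ t) conjMg conjVg; congr (fun_of_fin _ (_ * _)%g).
  by apply/esym/conjg_fixP/commgP; apply: (centP cP).
move=> hC; rewrite wE ifF ?mul0r ?rmorph0 //; apply/negP => hK.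
by apply: none; exists h.
Qed.

(** Enlarge P to a Sylow subgroup Q of C(x'). If the Brauer homomorphism of Q killed b, the
    coefficient of b at x' would be divisible by pi, and so would the unit [class_part (K x)]. Hence
    Q = P by maximality of P. *)
Lemma defect_sylow x y : class_part (K x) * y = 1 ->
  exists2 x', x' \in K x & p.-Sylow('C[x'])%g P.
Proof.
move=> xy; have /maxgroupP[/andP[pP br] maxP] := P_defect.
have [x' xx' x'C] := class_meets_defect_centralizer xy br pP.
exists x' => //; have PC : P \subset 'C[x']%G by rewrite sub_cent1.
have [Q sylQ PQ] := Sylow_superset PC pP.
rewrite -(maxP Q) // (pHall_pgroup sylQ) /=; apply/eqP => brQ.
have x'Q : x' \in 'C(Q)%g by rewrite -sub_cent1 (pHall_sub sylQ).
have /eqP := congr1 (fun f : {ffun _ -> k} => f (subg 'C(Q)%G x')) brQ.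
rewrite !ffunE subgK // => /eqP/res_ker[t et].
have x'E : class_part (K x) = alg_map B pi * (alg_map B t * \sum_(g in K x) gelt g).
  have Kx : K x = K x' := esym (class_eqP xx').
  by rewrite Kx class_part_const et rmorphM mulrA.
have x10 : pdvd 1 (1 : B).
  rewrite -xy x'E -mulrA; exists ((alg_map B t * \sum_(g in K x) gelt g) * y : B).
  by rewrite expr1.
case: (block_one_neq0 (b := b)); apply: (lattice_sep compl latB) => r.
by have := pdvdX r x10; rewrite mul1n expr1n.
Qed.

(* With [c = x' y] up to a scalar, where [P] is a Sylow subgroup of C(x'), the
   sum is [|C(x')|] times a class sum times its inverse in the centre. *)
Lemma defect_trace : exists (c : B) (u : O), res u != 0 /\
  \sum_g gelt g * c * gelt (g^-1)%g = alg_map B (#|P|%:R * u).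
Proof.
have [x [y xy]] := unit_class_part.
have [x' xx' sylP] := defect_sylow xy.
have cy := central_inv (class_part_central x) xy.
(* The scalar [b0 x'] turns the class sum into the class part with inverse [y]; the index is prime
   to p because P is a Sylow subgroup of C(x'). *)
exists (alg_map B (b0 x') * (gelt x' * y)), #|'C[x']%g : P|%g%:R; split.
  rewrite rmorph_nat -(dvdn_pcharf k_char).
  by have /and3P[_ _] := sylP; rewrite p'natE // (pcharf_prime k_char).
rewrite -natrM Lagrange ?(pHall_sub sylP) //.
rewrite (reindex_inj invg_inj).
rewrite (eq_bigr (fun g => alg_map B (b0 x') * gelt (x' ^ g)%g * y)) => [|g _].
  have Kx : K x' = K x := class_eqP xx'.
  rewrite -mulr_suml -mulr_sumr sum_class mulrnAr -class_part_const.
  by rewrite Kx mulrnAl xy rmorph_nat.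
rewrite invgK mulrA -alg_centr -!mulrA; congr (_ * _).
by rewrite cy !mulrA !geltM conjgE mulgA.
Qed.
End Higman.

(** * Automorphisms congruent to the identity *)

Section Automorphisms.
Variables (R : comNzRingType) (A : algebra R).
Implicit Type f : alg_aut A.

Lemma alg_aut0 f : f 0 = 0.
Proof. by apply: (@addrI _ (f 0)); rewrite -alg_autD !addr0. Qed.

Lemma alg_autB f x y : f (x - y) = f x - f y.
Proof. by apply: (@addIr _ (f y)); rewrite -alg_autD !subrK. Qed.

Lemma alg_aut_sum f (I : Type) (s : seq I) (F : I -> A) :
  f (\sum_(i <- s) F i) = \sum_(i <- s) f (F i).
Proof. exact: (big_morph f (alg_autD f) (alg_aut0 f)). Qed.

Definition aut_iter f n : alg_aut A := iter n (alg_aut_comp f) (alg_aut_id A).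

Lemma aut_iterE f n x : aut_iter f n x = iter n f x.
Proof. by elim: n => //= n <-. Qed.

Lemma aut_iterM f m n x : aut_iter (aut_iter f m) n x = aut_iter f (m * n) x.
Proof.
elim: n => [|n IH]; first by rewrite muln0.
by rewrite mulnS [LHS]/= IH !aut_iterE iterD.
Qed.

Lemma gexp_out_rep (a : R) r (u : Out_congr A a r) n :
  sval (gexp u n) = out_class (aut_iter (out_rep u) n).
Proof.
elim: n => //= n IH; rewrite -out_mulE -IH -out_repE; reflexivity.
Qed.
End Automorphisms.

Section CongruenceSubgroups.
Variables (O : idomainType) (k : fieldType) (res : {rmorphism O -> k}) (pi : O).
Variables (p : nat) (A : algebra O).
Hypotheses (res_ker : forall c : O, res c = 0 <-> principal_ideal pi c)
  (k_char : p \in [pchar k]).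

Local Notation pdvd r x := (pdvd pi r (x : A^o)).

Lemma aut_congr_iter (f : alg_aut A) r n :
  alg_aut_congr pi r f -> alg_aut_congr pi r (aut_iter f n).
Proof.
move=> hf; elim: n => [|n IH]; first exact: alg_aut_congr_id.
exact: alg_aut_congr_comp.
Qed.

(** With f(x) - x = pi ^ r y, telescoping gives f^p(x) - x = pi ^ r \sum_(i < p) f^i(y). Modulo pi
    the sum is p y, because r > 0, and pi divides p. *)
Lemma aut_congr_pow (f : alg_aut A) r : (0 < r)%N ->
  alg_aut_congr pi r f -> alg_aut_congr pi r.+1 (aut_iter f p).
Proof.
move=> r0 hf x; have [y ey] := hf x.
have tele n : aut_iter f n x - x = alg_map A (pi ^+ r) * \sum_(i < n) aut_iter f i y.
  elim: n => [|n IH]; first by rewrite big_ord0 mulr0 /= subrr.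
  rewrite big_ord_recr mulrDr -IH -[X in _ + X * _](alg_autC (aut_iter f n)).
  rewrite -[X in _ = _ + X]alg_autM -ey alg_autB !aut_iterE -iterSr.
  by rewrite [RHS]addrC addrA subrK.
rewrite tele; apply/(pdvdP pi); rewrite -[r.+1]addn1; apply: (@pdvd_mul _ pi A A^o).
have -> : \sum_(i < p) aut_iter f i y = \sum_(i < p) (aut_iter f i y - y) + p%:R * y.
  by rewrite sumrB sumr_const card_ord mulr_natl subrK.
apply: pdvdD.
  apply: pdvd_sum => i; apply: (@pdvd_leq _ _ _ _ _ r) => //.
  exact: (aut_congr_iter i hf).
have /res_ker [t et] : res p%:R = 0 by rewrite rmorph_nat (pcharf0 k_char).
rewrite -(rmorph_nat (alg_map A)) et rmorphM -mulrA.
by exists (alg_map A t * y); rewrite expr1.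
Qed.

Lemma aut_congr_exp (f : alg_aut A) d :
  alg_aut_congr pi 1 f -> alg_aut_congr pi d.+1 (aut_iter f (p ^ d)).
Proof.
move=> hf; elim: d => [|d IH]; first by rewrite expn0; apply: aut_congr_iter.
move=> x; have [y ey] := aut_congr_pow (ltn0Sn d) IH x; exists y.
by rewrite -ey aut_iterM expnSr.
Qed.
End CongruenceSubgroups.

Section InnerCongruence.
Variables (O : idomainType) (k : fieldType) (res : {rmorphism O -> k}) (pi : O).
Variables (p : nat) (gT : finGroupType) (b : block (group_algebra O gT)) (P : {group gT}).
Hypotheses (compl : adically_complete pi)
  (res_surj : forall x : k, exists c : O, res c = x)
  (res_ker : forall c : O, res c = 0 <-> principal_ideal pi c)
  (pi_neq0 : pi != 0)
  (k_char : p \in [pchar k]) (P_defect : defect_group res p b P).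

Local Notation B := (block_algebra b).
Local Notation gelt := (gelt b).
Local Notation pdvd r x := (pdvd pi r (x : B^o)).

Let latB := block_lattice b.

(* [w = \sum_g f(g) c g^-1] intertwines [f] and the identity; by [defect_trace]
   it is [pi ^+ d] times a unit. *)
Lemma aut_congr_inner (d : nat) (v : O) (f : alg_aut B) : res v != 0 ->
  #|P|%:R = pi ^+ d * v -> alg_aut_congr pi d.+1 f -> inner_eq f (alg_aut_id B).
Proof.
move=> v0 Pd hf.
have [c [u [u0 cu]]] := defect_trace compl res_surj res_ker k_char P_defect.
pose w : B := \sum_g f (gelt g) * c * gelt g^-1%g.
have fw h : f (gelt h) * w = w * gelt h.
  rewrite /w mulr_sumr mulr_suml [RHS](reindex_inj (mulgI h)).
  apply: eq_bigr => g _; rewrite !mulrA -alg_autM geltM -!mulrA geltM.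
  by rewrite invMg mulgKV.
(* Replacing f(g) by g changes w by a multiple of pi ^ (d + 1) and leaves the trace of c, which is
   pi ^ d v u. *)
have [t et] : pdvd d.+1 (w - alg_map B (pi ^+ d * (v * u))).
  rewrite mulrA -Pd -cu /w -sumrB; apply: pdvd_sum => g.
  by rewrite -!mulrBl; do 2![apply: pdvdMr]; apply: hf.
(* The quotient of w by pi ^ d; it is a unit, being congruent to v u modulo pi. *)
pose w' : B := alg_map B (v * u) + alg_map B pi * t.
have ww' : w = alg_map B (pi ^+ d) * w'.
  rewrite mulrDr -rmorphM mulrA -rmorphM -exprSr -[w](subrK (alg_map B (pi ^+ d * (v * u)))).
  by rewrite addrC; congr (_ + _).
have [|r vur] := @res_unit _ _ _ _ compl res_surj res_ker (v * u).
  by rewrite rmorphM mulf_neq0.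
have [s [s1 s2]] := one_sub_pi_unit compl latB (- (alg_map B r * t)).
have w'r : alg_map B r * w' = 1 - alg_map B pi * - (alg_map B r * t).
  rewrite mulrDr -rmorphM (mulrC r) vur rmorph1 mulrN opprK; congr (_ + _).
  by rewrite !mulrA -!rmorphM (mulrC r).
have w's : w' * (alg_map B r * s) = 1 by rewrite mulrA -alg_centr w'r.
have sw' : alg_map B r * s * w' = 1 by rewrite alg_centr -mulrA w'r.
have fw' x : f x * w' = w' * x.
  apply/eqP; rewrite -subr_eq0; apply/eqP.
  apply: (@lattice_tf _ pi pi_neq0 B B^o d _ latB).
  rewrite -[LHS]/(alg_map B (pi ^+ d) * (f x * w' - w' * x)) mulrBr !mulrA.
  rewrite alg_centr -mulrA -ww'; apply/eqP; rewrite subr_eq0; apply/eqP.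
  rewrite (gelt_span x) alg_aut_sum mulr_suml mulr_sumr; apply: eq_bigr => g _.
  by rewrite alg_autM alg_autC -mulrA fw !mulrA alg_centr.
exists w', (alg_map B r * s); split=> // x.
by rewrite -fw' -mulrA w's mulr1.
Qed.

Lemma out_congr_exponent (d : nat) (v : O) (x : Out_congr B pi 1) : res v != 0 ->
  #|P|%:R = pi ^+ d * v -> gexp x (p ^ d)%N = gone.
Proof.
move=> v0 Pd; apply: out_congr_sval_inj; rewrite gexp_out_rep; apply/out_classP.
apply: aut_congr_inner v0 Pd _; apply: (aut_congr_exp res_ker k_char).
exact: out_rep_congr.
Qed.
End InnerCongruence.

(** * The kernel of reduction modulo pi *)

Section ContextGeneration.
Variables (R : comNzRingType) (A : algebra R) (M N : bimod A).
Variables (phi : M -> N -> A) (psi : N -> M -> A).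
Hypothesis ctx : context phi psi.

#[local] Arguments Defs.ract : simpl never.

Lemma context_gen (s : seq (N * M)) : \sum_(q <- s) psi q.1 q.2 = 1 ->
  forall m, m = \sum_(q <- s) phi m q.1 *: q.2.
Proof.
move=> e m; rewrite -[LHS]ract1 -e ract_sum; apply: eq_bigr => q _.
by rewrite (phi_psi ctx).
Qed.

End ContextGeneration.

Section Exactness.
Variables (O : idomainType) (k : fieldType) (res : {rmorphism O -> k}) (pi : O).
Hypotheses (compl : adically_complete pi)
  (res_surj : forall x : k, exists c : O, res c = x)
  (res_ker : forall c : O, res c = 0 <-> principal_ideal pi c).
Variables (A : algebra O) (latA : lattice (A^o : lmodType A)).
Variable M : bimod A.
Hypothesis hM : induces_morita M.

#[local] Arguments bc_bimod : simpl never.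
#[local] Arguments Defs.ract : simpl never.

(** Products of the dual basis of M over A, given by the context, with that of A over O. *)
Lemma lattice_morita : lattice M.
Proof.
have [N [phi [psi ctx]]] := morita_context hM; have [s es] := psi1 ctx.
have [I [x [f [fD fZ fE]]]] := latA.
exists (I * 'I_(size s))%type, (fun ij => (x ij.1 : A) *: (tnth (in_tuple s) ij.2).2),
  (fun ij m => f ij.1 (phi m (tnth (in_tuple s) ij.2).1)).
split=> [[i j] m n|[i j] c m|m] /=.
- by rewrite (phiDl ctx) fD.
- by rewrite (phiZ ctx) -fZ.
rewrite {1}(context_gen ctx es m) (big_tnth _ _ s).
rewrite -(pair_bigA _ (fun i j => alg_map A (f i (phi m (tnth (in_tuple s) j).1)) *:
   ((x i : A) *: (tnth (in_tuple s) j).2))) /= exchange_big /=.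
apply: eq_bigr => j _; rewrite {1}(fE (phi m _)) scaler_suml.
by apply: eq_bigr => i _; rewrite scalerA.
Qed.

Lemma pic_kernel_twisted :
  bimod_iso (bc_bimod res M) (reg_bimod (bc_algebra res A)) ->
  exists f : alg_aut A, alg_aut_congr pi 1 f /\ bimod_iso (twisted_bimod f) M.
Proof.
case=> h [hl [h' hK h'K] hr]; have h'l := lin_inv hl hK h'K.
have latM := lattice_morita.
pose one_bc : bc_algebra res A := 1.
have [m em] := bc_repr res_surj (h' (one_bc : reg_bimod (bc_algebra res A))).
have hm : h (bct res 1 m) = one_bc by rewrite -em h'K.
have hbc (a : A) : h (bct res 1 (a *: m)) = bct res 1 (a : A^o) :> bc_algebra res A.
  rewrite -{1}[1 in LHS]mulr1 -(bcZ res 1 (a : A^o)) (linZ _ _ hl) hm.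
  exact: mulr1.
have sub1 (X : lmodType A) (x y : X) : lattice X ->
    bct res 1 x = bct res 1 y -> pdvd pi 1 (x - y).
  move=> latX e; apply/(bct_eq0 res_ker _ latX).
  by rewrite bctDr e -bctDr subrr; apply: (@addrI _ (bct res 1 0)); rewrite -bctDr !addr0.
have ann (a c : A) : bct res 1 (a *: m) = bct res 1 (c *: m) -> pdvd pi 1 (a - c : A^o).
  by move=> e; apply: (sub1 A^o) => //; rewrite -!hbc e.
have gen : forall n, exists a : A, n = a *: m.
  apply: (lattice_cyclic compl latA latM) => n.
  have [a ea] := bc_repr res_surj (h (bct res 1 n) : bc res A^o).
  exists a; apply: sub1 => //; apply: (can_inj hK).
  by rewrite ea -hbc.
have [N [phi [psi ctx]]] := morita_context hM; have [s es] := psi1 ctx.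
have /boolp.choice [g hg] := gen.
(* Projectivity of M: the surjection a |-> a m is split by lifting each generator [q.2] to
   [g q.2]. *)
pose sec (x : M) : A^o := \sum_(q <- s) phi x q.1 * g q.2.
have secl : linear sec.
  move=> a x y; rewrite /sec scaler_sumr -big_split; apply: eq_bigr => q _ /=.
  by rewrite (phiDl ctx) (phiZ ctx) mulrDl -mulrA.
have secK x : (sec x : A) *: m = x.
  rewrite [RHS](context_gen ctx es) scaler_suml; apply: eq_bigr => q _.
  by rewrite -scalerA -hg.
(* The idempotent 1 - sec(m) annihilates m, hence is divisible by pi; as it equals all its positive
   powers, it is 0. *)
have e1 : sec m = 1.
  apply/esym/eqP; rewrite -subr_eq0; apply/eqP; set e : A := 1 - sec m.
  have em0 : e *: m = 0 by rewrite scalerBl scale1r secK subrr.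
  have ee : e * e = e.
    have es0 : e * (sec m : A) = 0 by rewrite -[LHS](linZ e m secl) em0 (lin0 secl).
    by rewrite {2}/e mulrBr mulr1 es0 subr0.
  have de : pdvd pi 1 (e : A^o).
    by rewrite -[e]subr0; apply: ann; rewrite em0 scale0r.
  apply: (lattice_sep compl latA) => r.
  case: r => [|r]; first by exists (e : A^o); rewrite expr0 rmorph1 scale1r.
  have -> : e = e ^+ r.+1 by elim: r => // r IH; rewrite exprS -IH ee.
  by have := pdvdX r.+1 de; rewrite mul1n.
have inj (a c : A) : a *: m = c *: m -> a = c.
  have E (d : A) : sec (d *: m) = d by rewrite (linZ d m secl) e1; apply: mulr1.
  by move=> eq; rewrite -(E a) eq E.
pose al (a : A) := sec (ract m a) : A.
have alE a : al a *: m = ract m a by apply: secK.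
have alP : is_alg_aut al.
  split=> [x y|x y|c|].
  - by apply: inj; rewrite scalerDl !alE ractDr.
  - by apply: inj; rewrite -scalerA !alE ractM -(alE x) ractZ.
  - by apply: inj; rewrite alE ract_centr.
  have al_inj : injective al.
    move=> x y exy; apply: (morita_ract_inj hM) => n.
    by rewrite (hg n) !ractZ -!alE exy.
  (* The left linear map x m |-> x y m is the right action of some a by [morita_end]; at m this says
     al(a) = y. *)
  have /boolp.choice [be hbe] y : exists a, al a = y.
    have [|a ha] := @morita_end _ _ _ (fun x => ((sec x : A) * y) *: m) hM.
      move=> a u v; rewrite secl -[a *: sec u]/(a * (sec u : A)).
      by rewrite mulrDl scalerDl -mulrA scalerA.
    by exists a; apply: inj; rewrite alE -ha e1 mul1r.
  by exists be => // x; apply: al_inj; rewrite hbe.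
pose f := AlgAut alP; exists f; split.
  (* Over k, m corresponds to 1 in the regular bimodule, where left and right multiplication by a
     agree. *)
  move=> a; apply/(pdvdP pi); apply: ann; apply: (can_inj hK).
  rewrite [RHS]hbc [f a *: m]alE.
  have -> : bct res 1 (ract m a) = @Defs.ract _ _ (bc_bimod res M) (bct res 1 m)
      (bct res 1 (a : A^o) : bc_algebra res A) by rewrite bc_ractE mulr1.
  rewrite (hr (bct res 1 m)) hm; exact: mul1r.
exists (fun a : A^o => (a : A) *: m); split.
- by move=> a u v; rewrite scalerDl scalerA.
- exists sec => x; last exact: secK.
  by apply: inj; rewrite secK.
- by move=> x a; rewrite twistedE -scalerA [al a *: m]alE ractZ.
Qed.
End Exactness.

(** * Bimodules over a field *)

Section Presentations.
Variables (K : fieldType) (A : algebra K) (I : finType) (e : I -> A).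
Hypothesis span : forall a : A, exists c : I -> K, a = \sum_i alg_map A (c i) * e i.
Implicit Types M N : bimod A.

#[local] Arguments bimod_mul : simpl never.
#[local] Arguments Defs.ract : simpl never.

Local Notation "c ** m" := (alg_map A c *: m) (at level 40, left associativity).

(* A linear dependence between the [psi (n j) (m j)] allows one term of the
   expression of 1 to be absorbed into the others. *)
Lemma morita_few_generators M : induces_morita M ->
  exists t (y : 'I_t -> M), (t <= #|I|)%N /\
    forall m, exists a : 'I_t -> A, m = \sum_j a j *: y j.
Proof.
move=> hM; have [N [phi [psi ctx]]] := morita_context hM; have [s es] := psi1 ctx.
suff few t : forall (n : 'I_t -> N) (m : 'I_t -> M), \sum_j psi (n j) (m j) = 1 ->
    exists t' (n' : 'I_t' -> N) (m' : 'I_t' -> M),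
      (t' <= #|I|)%N /\ \sum_j psi (n' j) (m' j) = 1.
  have [|t [n [m [let1 e1]]]] := few (size s)
      (fun j => (tnth (in_tuple s) j).1) (fun j => (tnth (in_tuple s) j).2).
    by rewrite -es (big_tnth _ _ s).
  exists t, m; split=> // x; exists (fun j => phi x (n j)).
  rewrite -[LHS]ract1 -e1 ract_sum; apply: eq_bigr => j _.
  by rewrite (phi_psi ctx).
elim: t => [|t IH] n m e1; first by exists 0%N, n, m.
have [le_t|lt_t] := leqP t.+1 #|I|; first by exists t.+1, n, m.
have /boolp.choice [c hc] j := span (psi (n j) (m j)).
have [d [[l dl0] hd]] := linear_dependence c lt_t.
pose d' j := - (d l)^-1 * d (lift l j).
have el : psi (n l) (m l) = \sum_j psi (d' j ** n (lift l j)) (m (lift l j)).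
  have : \sum_j alg_map A (d j) * psi (n j) (m j) = 0.
    under eq_bigr do rewrite hc mulr_sumr.
    rewrite exchange_big big1 // => i _.
    under eq_bigr do rewrite mulrA -rmorphM.
    by rewrite -mulr_suml -rmorph_sum hd rmorph0 mul0r.
  rewrite (bigD1_ord l) //= => /(congr1 (fun z => alg_map A (- (d l)^-1) * z)).
  rewrite mulr0 mulrDr mulrA -rmorphM mulNr mulVf // rmorphN1 mulN1r.
  move/eqP; rewrite addrC subr_eq0 => /eqP <-; rewrite mulr_sumr.
  by apply: eq_bigr => j _; rewrite (psiZ ctx) mulrA -rmorphM.
apply: (IH (fun j => n (lift l j) + d' j ** n (lift l j)) (fun j => m (lift l j))).
rewrite -e1 [RHS](bigD1_ord l) //= el addrC -big_split /=.
by apply: eq_bigr => j _; rewrite (psiDl ctx).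
Qed.

Definition lincomb M s (y : 'I_s -> M) (c : 'rV[K]_s) : M := \sum_j c 0 j ** y j.

Lemma lincombD M s (y : 'I_s -> M) : {morph lincomb y : u v / u + v}.
Proof.
move=> u v; rewrite /lincomb -big_split; apply: eq_bigr => j _ /=.
by rewrite mxE rmorphD scalerDl.
Qed.

Lemma lincombZ M s (y : 'I_s -> M) c u : lincomb y (c *: u) = c ** lincomb y u.
Proof.
rewrite /lincomb scaler_sumr; apply: eq_bigr => j _.
by rewrite mxE rmorphM scalerA.
Qed.

Lemma basis_extraction M D (y : 'I_D -> M) :
  (forall m, exists c, m = lincomb y c) ->
  exists s (z : 'I_s -> M), (s <= D)%N /\ bijective (lincomb z).
Proof.
elim: D y => [|D IH] y gen.
  exists 0%N, y; split=> //; exists (fun=> 0) => [u|m]; first by rewrite [RHS]thinmx0.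
  by have [c ->] := gen m; rewrite /lincomb !big_ord0.
have [inj|] := pselect (forall c, lincomb y c = 0 -> c = 0).
  have /boolp.choice [g hg] := gen; exists D.+1, y; split=> //; exists g => // c.
  apply/eqP; rewrite -subr_eq0; apply/eqP; apply: inj.
  by rewrite lincombD -scaleN1r lincombZ -hg rmorphN1 scaleN1r subrr.
move/existsNP=> [c /not_implyP[c0 /eqP cn0]].
have [l cl] : exists l, c 0 l != 0.
  apply/existsP; rewrite -negb_forall; apply: contra cn0 => /forallP h.
  by apply/eqP/rowP => j; rewrite mxE; apply/eqP.
have [m|s [z [les bz]]] := IH (fun j => y (lift l j)); last first.
  by exists s, z; split=> //; apply: leq_trans les _.
have [d ->] := gen m.
exists (\row_j (d 0 (lift l j) - d 0 l / c 0 l * c 0 (lift l j))).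
have -> : lincomb y d = lincomb y (d - (d 0 l / c 0 l) *: c).
  by rewrite lincombD -scaleNr lincombZ c0 scaler0 addr0.
rewrite /lincomb (bigD1_ord l) //= !mxE divfK // subrr rmorph0 scale0r add0r.
by apply: eq_bigr => j _; rewrite !mxE.
Qed.

(** Linear coordinates on M with the matrices of both actions of the spanning family. These matrices
    determine M up to isomorphism, so counting bimodules becomes counting matrices. *)
Record presents M s (L R : I -> 'M[K]_s) (sigma : 'rV[K]_s -> M) : Prop := Presents {
  pres_bij : bijective sigma;
  presD : {morph sigma : u v / u + v};
  presZ : forall c u, sigma (c *: u) = c ** sigma u;
  presL : forall i u, e i *: sigma u = sigma (u *m L i);
  presR : forall i u, ract (sigma u) (e i) = sigma (u *m R i) }.

Lemma ract_omul M (m : M) c (a : A) : ract m (alg_map A c * a) = c ** ract m a.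
Proof. by rewrite ractM -ract_centr ractZ. Qed.

Lemma presents_iso M N s (L R : I -> 'M[K]_s) sM sN :
  @presents M s L R sM -> @presents N s L R sN -> bimod_iso M N.
Proof.
move=> hM hN; have [tM sMK tMK] := pres_bij hM; have [tN sNK tNK] := pres_bij hN.
pose f m := sN (tM m).
have fE u : f (sM u) = sN u by rewrite /f sMK.
have fD : {morph f : x y / x + y}.
  by move=> x y; rewrite -(tMK x) -(tMK y) -(presD hM) !fE (presD hN).
have fO c x : f (c ** x) = c ** f x.
  by rewrite -(tMK x) -(presZ hM) !fE (presZ hN).
have f0 : f 0 = 0 by apply: (@addrI _ (f 0)); rewrite -fD !addr0.
have f_sum (F : I -> M) : f (\sum_i F i) = \sum_i f (F i) := big_morph f fD f0 _ _ F.
exists f; split.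
- apply: linDZ => // a x; have [c ->] := span a.
  rewrite !scaler_suml f_sum; apply: eq_bigr => i _; rewrite -!scalerA fO.
  by congr (_ *: _); rewrite -(tMK x) (presL hM) !fE (presL hN).
- exists (fun n => sM (tN n)) => x; first by rewrite /f sNK tMK.
  by rewrite fE tNK.
- move=> x a; have [c ->] := span a.
  rewrite !ract_sum f_sum; apply: eq_bigr => i _; rewrite !ract_omul fO.
  by congr (_ *: _); rewrite -(tMK x) (presR hM) !fE (presR hN).
Qed.

(** Invariance of dimension; it carries the bound of [presents_exists] over to any other
    presentation of M. *)
Lemma presents_size M s s' (L R : I -> 'M[K]_s) (L' R' : I -> 'M[K]_s') sg sg' :
  @presents M s L R sg -> @presents M s' L' R' sg' -> (s <= s')%N.
Proof.
move=> h h'; rewrite leqNgt; apply/negP => lt.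
have [t sK tK] := pres_bij h; have [t' s'K t'K] := pres_bij h'.
have tD : {morph t' \o sg : u v / u + v}.
  by move=> u v /=; rewrite (presD h) -{1}(t'K (sg u)) -{1}(t'K (sg v)) -(presD h') s'K.
have tZ c u : (t' \o sg) (c *: u) = c *: (t' \o sg) u.
  by rewrite /= (presZ h) -{1}(t'K (sg u)) -(presZ h') s'K.
have t0 : (t' \o sg) 0 = 0 by apply: (@addrI _ ((t' \o sg) 0)); rewrite -tD !addr0.
have lt' : (#|'I_s'| < s)%N by rewrite card_ord.
have [c [[j cj] hc]] := linear_dependence (fun j l => (t' \o sg) (delta_mx 0 j) 0 l) lt'.
have : (t' \o sg) (\row_j c j) = 0.
  rewrite (row_sum_delta (\row_j c j)) (big_morph _ tD t0); apply/rowP => l.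
  rewrite summxE mxE -[RHS](hc l); apply: eq_bigr => i _.
  by rewrite tZ !mxE.
have ti : injective (t' \o sg) by apply: inj_comp (can_inj t'K) (can_inj sK).
rewrite -[RHS]t0 => /ti /rowP/(_ j); rewrite !mxE => /eqP.
by rewrite (negPf cj).
Qed.

(** M has at most |I| generators over A, and each generates a subspace of dimension at most |I|. *)
Lemma presents_exists M : induces_morita M ->
  exists s L R sg, (s <= #|I| * #|I|)%N /\ @presents M s L R sg.
Proof.
move=> /morita_few_generators [t [y [let_ gen]]].
pose J : finType := (I * 'I_t)%type; pose z (j : 'I_#|J|) : M :=
  e (enum_val j).1 *: y (enum_val j).2.
have [m|s [x [les [g xK gK]]]] := @basis_extraction M #|J| z.
  have [a ->] := gen m; have /boolp.choice [c hc] j := span (a j).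
  exists (\row_j c (enum_val j).2 (enum_val j).1); rewrite /lincomb.
  rewrite (reindex (@enum_rank J)) /=; last first.
    by exists (@enum_val J _) => j _; rewrite (enum_rankK, enum_valK).
  under [RHS]eq_bigr do rewrite mxE /z enum_rankK.
  rewrite -(pair_bigA _ (fun i j => c j i ** (e i *: y j))) exchange_big.
  apply: eq_bigr => j _ /=; rewrite {1}hc scaler_suml.
  by apply: eq_bigr => i _; rewrite scalerA.
have gD : {morph g : u v / u + v} by move=> u v; apply: (can_inj xK); rewrite lincombD !gK.
have gZ c u : g (c ** u) = c *: g u by apply: (can_inj xK); rewrite lincombZ !gK.
pose mat (f : M -> M) := \matrix_(j < s) g (f (x j)).
have matP (f : M -> M) : {morph f : u v / u + v} -> (forall c u, f (c ** u) = c ** f u) ->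
    forall u, f (lincomb x u) = lincomb x (u *m mat f).
  move=> fD fZ u; apply: (can_inj gK); rewrite xK mulmx_sum_row.
  have f0 : g (f 0) = 0 by apply: (@addrI _ (g (f 0))); rewrite -gD -fD !addr0.
  have gfD : {morph g \o f : u v / u + v} by move=> a b /=; rewrite fD gD.
  rewrite -[LHS]/((g \o f) _) (big_morph _ gfD f0); apply: eq_bigr => j _.
  by rewrite /= fZ gZ rowK.
exists s, (fun i => mat (fun m => e i *: m)),
  (fun i => mat (fun m => ract m (e i))), (lincomb x).
split.
  apply: leq_trans les _; rewrite card_prod card_ord leq_mul2l.
  by rewrite let_ orbT.
split=> [|u v|c u|i u|i u].
- by exists g.
- exact: lincombD.
- exact: lincombZ.
- apply: (matP (fun m => e i *: m)) => [m n|c m]; first exact: scalerDr.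
  by rewrite !scalerA alg_centr.
- apply: (matP (fun m => ract m (e i))) => [m n|c m]; first exact: ractDl.
  exact: ractZ.
Qed.

(** * Tensor products in coordinates *)

Section Tensor.
Variables (F : fieldType) (iota : {rmorphism F -> K}).

Local Notation "X ^i" := (map_mx iota X) (at level 2, format "X ^i").

(* The relations defining the tensor product have coefficients in [F], so it is
   the scalar extension of a quotient of a matrix space over [F]. *)
Lemma relation_quotient (d : nat) (Lam : I -> 'M[F]_d) : exists r (Q : 'M[F]_(d, r)) S T,
  [/\ forall i, Lam i *m Q = 0, S *m Q = 1%:M & 1%:M - Q *m S = \sum_i T i *m Lam i].
Proof.
(* Q is a full-rank column base of the cokernel of W, so X Q = 0 exactly when the rows of X lie in
   the relation space W. *)
pose W := (\sum_i <<Lam i>>)%MS; pose C := cokermx W.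
have /row_fullP [S SQ] := col_base_full C.
have rf := row_base_free C; have CE := mulmx_base C.
have Q0 m (X : 'M_(m, d)) : (X *m col_base C == 0) = (X <= W)%MS.
  by rewrite submxE -/C -[X in _ = (_ *m X == _)]CE mulmxA (mulmx_free_eq0 _ rf).
have LamW i : (Lam i <= W)%MS by rewrite (sumsmx_sup i) // genmxE.
have /sub_sumsmxP [u hu] : (1%:M - col_base C *m S <= W)%MS.
  by rewrite -Q0 mulmxBl mul1mx -mulmxA SQ mulmx1 subrr.
have /boolp.choice [v hv] i : exists v, u i *m <<Lam i>>%MS = v *m Lam i.
  by apply/submxP; rewrite (submx_trans (submxMl _ _)) // genmxE.
exists (\rank C), (col_base C), S, v; split=> // [i|].
  by apply/eqP; rewrite Q0.
by rewrite hu; apply: eq_bigr => i _.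
Qed.

(** An s x t matrix X stands for the sum of the X_jl e_j (x) e_l. Balancing by [e i] becomes the
    relation R_i^T X - X L'_i, so M (x) N is a quotient of the matrix space by relations defined
    over F; Q is the projection and S a section. *)
Lemma presents_tensor M N s t (L R : I -> 'M[F]_s) (L' R' : I -> 'M[F]_t) sM sN :
  @presents M s (fun i => (L i)^i) (fun i => (R i)^i) sM ->
  @presents N t (fun i => (L' i)^i) (fun i => (R' i)^i) sN ->
  exists r (L2 R2 : I -> 'M[F]_r) sg,
    @presents (bimod_mul M N) r (fun i => (L2 i)^i) (fun i => (R2 i)^i) sg.
Proof.
move=> hM hN; have [tM sMK tMK] := pres_bij hM; have [tN sNK tNK] := pres_bij hN.
pose Lam0 i := lin_mulmx (R i)^T - lin_mulmxr (L' i) : 'M[F]_(s * t).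
have [r [Q0 [S0 [T0 [LQ0 SQ0 QS0]]]]] := relation_quotient Lam0.
pose Q := Q0^i; pose S := S0^i; pose T j := (T0 j)^i.
have mapl i : (lin_mulmx (L i)^T : 'M_(s * t))^i = lin_mulmx ((L i)^i)^T.
  by apply: map_lin_mx => X; rewrite map_mxM map_trmx.
have mapl' i : (lin_mulmx (R i)^T : 'M_(s * t))^i = lin_mulmx ((R i)^i)^T.
  by apply: map_lin_mx => X; rewrite map_mxM map_trmx.
have mapr i : (lin_mulmxr (L' i) : 'M_(s * t))^i = lin_mulmxr (L' i)^i.
  by apply: map_lin_mx => X; rewrite /mulmxr map_mxM.
have mapr' i : (lin_mulmxr (R' i) : 'M_(s * t))^i = lin_mulmxr (R' i)^i.
  by apply: map_lin_mx => X; rewrite /mulmxr map_mxM.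
pose Lam i := lin_mulmx ((R i)^i)^T - lin_mulmxr (L' i)^i : 'M[K]_(s * t).
have LamE i : Lam i = (Lam0 i)^i by rewrite map_mxB mapl' mapr.
have LQ i : Lam i *m Q = 0 by rewrite LamE -map_mxM LQ0 map_mx0.
have SQ : S *m Q = 1%:M by rewrite -map_mxM SQ0 map_mx1.
have QS : Q *m S = 1%:M - \sum_i T i *m Lam i.
  apply/eqP; rewrite eq_sym subr_eq addrC -subr_eq; apply/eqP.
  rewrite -map_mxM -(map_mx1 iota) -map_mxB QS0 map_mx_sum.
  by apply: eq_bigr => i _; rewrite map_mxM LamE.
have LamM i (X : 'M[K]_(s, t)) :
    mxvec X *m Lam i = mxvec (((R i)^i)^T *m X - X *m (L' i)^i).
  by rewrite mulmxBr !mul_vec_lin linearB.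

have outer_ext (V : zmodType) (G H : 'M[K]_(s, t) -> V) :
    {morph G : X Y / X + Y} -> {morph H : X Y / X + Y} ->
    (forall (u : 'rV_s) (v : 'rV_t), G (u^T *m v) = H (u^T *m v)) -> G =1 H.
  move=> GD HD GH X; have G0 : G 0 = 0 by apply: (@addrI _ (G 0)); rewrite -GD !addr0.
  have H0 : H 0 = 0 by apply: (@addrI _ (H 0)); rewrite -HD !addr0.
  rewrite (matrix_sum_delta X) (big_morph G GD G0) (big_morph H HD H0).
  apply: eq_bigr => i _; rewrite (big_morph G GD G0) (big_morph H HD H0).
  apply: eq_bigr => j _; rewrite -(mul_delta_mx (0 : 'I_1)) -trmx_delta scalemxAl.
  have -> : X i j *: ('e_i)^T = (X i j *: 'e_i)^T :> 'M[K]_(s, 1) by rewrite linearZ.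
  exact: GH.
have [tMD tMZ] : {morph tM : u v / u + v} /\ forall c u, tM (c ** u) = c *: tM u.
  by split=> [u v|c u]; apply: (can_inj sMK); rewrite (presD hM, presZ hM) !tMK.
have [tND tNZ] : {morph tN : u v / u + v} /\ forall c u, tN (c ** u) = c *: tN u.
  by split=> [u v|c u]; apply: (can_inj sNK); rewrite (presD hN, presZ hN) !tNK.
pose Tm (X : 'M[K]_(s, t)) : bimod_mul M N :=
  \sum_j \sum_l X j l ** bt (sM 'e_j) (sN 'e_l).
have TmD : {morph Tm : X Y / X + Y}.
  move=> X Y; rewrite -big_split; apply: eq_bigr => j _ /=.
  by rewrite -big_split; apply: eq_bigr => l _ /=; rewrite mxE rmorphD scalerDl.
have TmZ c X : Tm (c *: X) = c ** Tm X.
  rewrite scaler_sumr; apply: eq_bigr => j _; rewrite scaler_sumr.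
  by apply: eq_bigr => l _; rewrite mxE rmorphM scalerA.
have Tm0 : Tm 0 = 0 by apply: (@addrI _ (Tm 0)); rewrite -TmD !addr0.
have btl (n : N) : {morph (fun m : M => bt m n) : u v / u + v} by move=> u v; apply: btDl.
have btr (m : M) : {morph (fun n : N => bt m n) : u v / u + v} by move=> u v; apply: btDr.
have bt0l (n : N) : bt (0 : M) n = 0 by apply: (@addrI _ (bt 0 n)); rewrite -btDl !addr0.
have bt0r (m : M) : bt m (0 : N) = 0 by apply: (@addrI _ (bt m 0)); rewrite -btDr !addr0.
have sM0 : sM 0 = 0 by apply: (@addrI _ (sM 0)); rewrite -(presD hM) !addr0.
have sN0 : sN 0 = 0 by apply: (@addrI _ (sN 0)); rewrite -(presD hN) !addr0.
have Tm_outer u v : Tm (u^T *m v) = bt (sM u) (sN v).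
  rewrite {2}(row_sum_delta u) (big_morph sM (presD hM) sM0) (big_morph _ (btl _) (bt0l _)).
  apply: eq_bigr => j _; rewrite (presZ hM) -btZ {2}(row_sum_delta v).
  rewrite (big_morph sN (presD hN) sN0) (big_morph _ (btr _) (bt0r _)) scaler_sumr.
  apply: eq_bigr => l _; rewrite (presZ hN) -bt_bal -ract_centr -btZ scalerA -rmorphM.
  by rewrite !mxE big_ord1 mxE.
have TmL i X : e i *: Tm X = Tm (((L i)^i)^T *m X).
  move: X; apply: outer_ext => [X Y|X Y|u v]; rewrite ?mulmxDr ?TmD ?scalerDr //.
  by rewrite mulmxA -trmx_mul !Tm_outer btZ (presL hM).
have TmR i X : ract (Tm X) (e i) = Tm (X *m (R' i)^i).
  move: X; apply: outer_ext => [X Y|X Y|u v]; rewrite ?mulmxDl ?TmD ?ractDl //.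
  by rewrite -mulmxA !Tm_outer bimod_mulE (presR hN).
have Tm_rel i X : Tm (((R i)^i)^T *m X - X *m (L' i)^i) = 0.
  have TmB Y Z : Tm (Y - Z) = Tm Y - Tm Z.
    by apply: (@addIr _ (Tm Z)); rewrite -TmD !subrK.
  apply/eqP; rewrite TmB subr_eq0; apply/eqP; move: X.
  apply: outer_ext => [X Y|X Y|u v]; rewrite ?mulmxDl ?mulmxDr ?TmD //.
  by rewrite mulmxA -trmx_mul -mulmxA !Tm_outer -(presR hM) bt_bal (presL hN).
have TmLam i (w : 'rV_(s * t)) : Tm (vec_mx (w *m Lam i)) = 0.
  by rewrite -(vec_mxK w) LamM mxvecK Tm_rel.
(* 1 - Q S is a combination of the relations, which [Tm] kills. *)
have TmQS (v : 'rV_(s * t)) : Tm (vec_mx (v *m Q *m S)) = Tm (vec_mx v).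
  have TvD : {morph Tm \o vec_mx : a b / a + b} by move=> a c /=; rewrite linearD TmD.
  have Tv0 : (Tm \o vec_mx) 0 = 0 by rewrite /= linear0 Tm0.
  have e1 : v = v *m Q *m S + \sum_i v *m T i *m Lam i.
    rewrite -mulmxA QS mulmxBr mulmx1 mulmx_sumr.
    by under [X in _ + X]eq_bigr do rewrite -mulmxA; rewrite subrK.
  rewrite [in RHS]e1 [RHS](TvD _ _) (big_morph _ TvD Tv0) [X in _ = _ + X]big1 ?addr0 //.
  by move=> i _; apply: TmLam.
(* This induces the inverse of [sg]; it is balanced because Q annihilates the relations. *)
pose psi0 (m : M) (n : N) := mxvec ((tM m)^T *m tN n) *m Q.
have psi0Dl m m' n : psi0 (m + m') n = psi0 m n + psi0 m' n.
  by rewrite /psi0 tMD !linearD /= mulmxDl linearD mulmxDl.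
have psi0Dr m n n' : psi0 m (n + n') = psi0 m n + psi0 m n'.
  by rewrite /psi0 tND mulmxDr linearD mulmxDl.
have psi0Zl c m n : psi0 (c ** m) n = c *: psi0 m n.
  by rewrite /psi0 tMZ !linearZ /= -scalemxAl linearZ -scalemxAl.
have psi0Zr c m n : psi0 m (c ** n) = c *: psi0 m n.
  by rewrite /psi0 tNZ -scalemxAr linearZ -scalemxAl.
have psi0b : bt_balanced psi0.
  split=> // m a n; have [c ->] := span a.
  have p0l : psi0 0 n = 0 by apply: (@addrI _ (psi0 0 n)); rewrite -psi0Dl !addr0.
  have p0r : psi0 m 0 = 0 by apply: (@addrI _ (psi0 m 0)); rewrite -psi0Dr !addr0.
  rewrite ract_sum scaler_suml (big_morph (psi0^~ n) (fun u v => psi0Dl u v n) p0l).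
  rewrite (big_morph (psi0 m) (psi0Dr m) p0r); apply: eq_bigr => i _.
  rewrite ract_omul -scalerA psi0Zl psi0Zr; congr (_ *: _).
  apply/eqP; rewrite -subr_eq0 -mulmxBl -linearB /=; apply/eqP.
  rewrite -(tMK m) -(tNK n) (presR hM) (presL hN) !sMK !sNK trmx_mul.
  by rewrite mulmxA -[X in X - _]mulmxA -LamM -mulmxA LQ mulmx0.
pose psi := bt_lift psi0.
have psiE m n : psi (bt m n) = psi0 m n by apply: bt_liftE.
have psiD : {morph psi : u v / u + v} by apply: bt_liftD.
have psiT X : psi (Tm X) = mxvec X *m Q.
  move: X; apply: outer_ext => [X Y|X Y|u v].
  - by rewrite TmD psiD.
  - by rewrite linearD mulmxDl.
  - by rewrite Tm_outer psiE /psi0 sMK sNK.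
pose sg (w : 'rV[K]_r) := Tm (vec_mx (w *m S)).
have TmS X : sg (mxvec X *m Q) = Tm X by rewrite /sg TmQS mxvecK.
exists r, (fun i => S0 *m lin_mulmx (L i)^T *m Q0),
  (fun i => S0 *m lin_mulmxr (R' i) *m Q0), sg.
split=> [|u v|c u|i u|i u].
- exists psi => [w|x]; first by rewrite /sg psiT vec_mxK -mulmxA SQ mulmx1.
  move: x; apply: bt_ext => [u v|//|m n].
    by rewrite psiD /sg mulmxDl linearD TmD.
  by rewrite -(tMK m) -(tNK n) -Tm_outer psiT TmS.
- by rewrite /sg mulmxDl linearD TmD.
- by rewrite /sg -scalemxAl linearZ TmZ.
- rewrite TmL /sg !map_mxM mapl !mulmxA TmQS -[in RHS](vec_mxK (u *m S)).
  by rewrite mul_vec_lin mxvecK.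
- rewrite TmR /sg !map_mxM mapr' !mulmxA TmQS -[in RHS](vec_mxK (u *m S)).
  by rewrite mul_vec_lin mxvecK.
Qed.
End Tensor.
End Presentations.

(** * Finiteness *)

Lemma finite_type_inj (T : Type) (F : finType) (f : T -> F) :
  injective f -> finite_type T.
Proof.
move=> fI; pose S := [set y : F | `[< exists x, f x = y >]].
have /boolp.choice [g hg] (i : 'I_#|S|) : exists x, f x = enum_val i.
  by apply/asboolP; have := enum_valP i; rewrite inE.
have fS x : f x \in S by rewrite inE; apply/asboolP; exists x.
have gI : injective g by move=> i j /(congr1 f); rewrite !hg => /enum_val_inj.
have /boolp.choice [h hh] x : exists i, g i = x.
  by exists (enum_rank_in (fS x) (f x)); apply: fI; rewrite hg enum_rankK_in.
by exists #|S|, g; exists h => // i; apply: gI.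
Qed.

Lemma finite_type_enc (T : Type) : finite_type T ->
  exists (F : finType) (f : T -> F), injective f.
Proof. by case=> n [f [g fK gK]]; exists 'I_n, g; apply: can_inj gK. Qed.

Section GrpToFinGroup.
Variables (G : grp) (n : nat) (f : 'I_n -> G) (g : G -> 'I_n).
Hypotheses (fK : cancel f g) (gK : cancel g f).

Let fin_mul i j := g (gmul (f i) (f j)).
Let fin_inv i := g (ginv (f i)).

Let fin_mulA : associative fin_mul.
Proof. by move=> i j l; rewrite /fin_mul !gK gmulA. Qed.
Let fin_mul1 : left_id (g gone) fin_mul.
Proof. by move=> i; rewrite /fin_mul gK gmul1l fK. Qed.
Let fin_mulV : left_inverse (g gone) fin_inv fin_mul.
Proof. by move=> i; rewrite /fin_mul gK gmulVl. Qed.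

(* The [let] makes the group structure depend on [f], [g], [fK] and [gK]. *)
Definition fin_grp : Type := let _ := (fK, gK) in 'I_n.
HB.instance Definition _ := Finite.on fin_grp.
HB.instance Definition _ := Finite_isGroup.Build fin_grp fin_mulA fin_mul1 fin_mulV.

Lemma fin_grpX (x : fin_grp) m : f (x ^+ m)%g = gexp (f x) m.
Proof. by elim: m => [|m IH]; [apply: gK | rewrite expgS /= -IH; apply: gK]. Qed.

(** By Cauchy's theorem each prime divisor of n is the order of an element, hence divides p ^ d. *)
Lemma p_exponent_card p d : prime p -> (forall x : G, gexp x (p ^ d) = gone) ->
  exists m, n = (p ^ m)%N.
Proof.
move=> pp ex; have : (p.-group [set: fin_grp])%g.
  apply/pgroupP => q qp /(Cauchy qp)[x _ ox].
  have : (#[x]%g %| p ^ d)%N.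
    by rewrite order_dvdn; apply/eqP/(can_inj fK); rewrite fin_grpX ex [RHS]gK.
  by rewrite ox Euclid_dvdX // dvdn_prime2 // inE /= => /andP[].
by case/p_natP=> m; rewrite cardsT card_ord; exists m.
Qed.
End GrpToFinGroup.

Section Residues.
Variables (O : idomainType) (k : fieldType) (res : {rmorphism O -> k}) (pi : O).
Hypotheses (res_ker : forall c : O, res c = 0 <-> principal_ideal pi c)
  (res_surj : forall x : k, exists c : O, res c = x).

(** [tau] records the first r digits of the pi-adic expansion with respect to a section of [res]. *)
Lemma finite_residues r : finite_type k -> exists (F : finType) (tau : O -> F),
  forall a b, tau a = tau b -> principal_ideal (pi ^+ r) (a - b).
Proof.
move=> /finite_type_enc [E [enc encI]]; elim: r => [|r [F [tau htau]]].
  by exists unit, (fun=> tt) => a b _; exists (a - b); rewrite expr0 mul1r.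
have /boolp.choice [s hs] := res_surj.
have /boolp.choice [q hq] a : exists t, a = s (res a) + pi * t.
  have /res_ker [t et] : res (a - s (res a)) = 0 by rewrite rmorphB hs subrr.
  by exists t; rewrite -et addrC subrK.
exists (E * F)%type, (fun a => (enc (res a), tau (q a))) => a b [/encI eab /htau[t et]].
exists t; rewrite (hq a) (hq b) eab opprD addrACA subrr add0r -mulrBr et.
by rewrite exprS mulrA.
Qed.
End Residues.

(** * Frobenius and finite subfields *)

Section FixedField.
Variables (k : fieldType) (p : nat) (kp : p \in [pchar k]) (n : nat).

(* The [let] makes the field structure depend on [kp]. *)
Definition fixed_field : Type := let _ := kp in {x : k | x ^+ (p ^ n) == x}.
HB.instance Definition _ := SubType.on fixed_field.
HB.instance Definition _ := Choice.on fixed_field.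

Let ff_closed : divring_closed (fun x : k => x ^+ (p ^ n) == x).
Proof.
have pn : ([pchar k].-nat (p ^ n))%N.
  by rewrite (eq_pnat _ (pcharf_eq kp)) pnatX pnat_id // (pcharf_prime kp).
split=> [|x y|x y]; rewrite !unfold_in ?expr1n // => /eqP ex /eqP ey.
  by rewrite exprDn_pchar // exprNn_pchar // ex ey.
by rewrite exprMn exprVn ex ey.
Qed.
HB.instance Definition _ :=
  GRing.SubChoice_isSubIntegralDomain.Build k _ fixed_field ff_closed.
Let ff_unit : {mono (val : fixed_field -> k) : u / u \in GRing.unit}.
Proof. by []. Qed.
HB.instance Definition _ :=
  GRing.SubIntegralDomain_isSubField.Build k _ fixed_field ff_unit.
Definition fixed_val : {rmorphism fixed_field -> k} := val.

Lemma fixed_val_onto (x : k) : x ^+ (p ^ n) = x -> exists y, fixed_val y = x.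
Proof. by move/eqP=> e; exists (exist (fun x : k => x ^+ (p ^ n) == x) x e). Qed.
End FixedField.

Lemma pigeonhole (F : finType) (u : nat -> F) : exists i j, (i < j)%N /\ u i = u j.
Proof.
have : ~~ injectiveb (fun i : 'I_#|F|.+1 => u i).
  by apply/negP => /injectiveP/leq_card; rewrite card_ord ltnn.
case/injectivePn=> i [j]; case: (ltngtP i j) => [lt|lt|/ord_inj ->] ne e.
- by exists i, j.
- by exists j, i.
- by rewrite eqxx in ne.
Qed.

Section FrobeniusFixed.
Variables (k : fieldType) (p : nat) (kp : p \in [pchar k]).

Let p_prime : prime p := pcharf_prime kp.

Lemma expn_frobenius_sub (x y : k) n : (x - y) ^+ (p ^ n) = x ^+ (p ^ n) - y ^+ (p ^ n).
Proof.
have pn : ([pchar k].-nat (p ^ n))%N.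
  by rewrite (eq_pnat _ (pcharf_eq kp)) pnatX pnat_id.
by rewrite exprDn_pchar // exprNn_pchar.
Qed.

Lemma frobenius_fixed_mul (x : k) n m : x ^+ (p ^ n) = x -> x ^+ (p ^ (n * m)) = x.
Proof.
by move=> e; elim: m => [|m IH]; rewrite ?muln0 ?expr1 // mulnS expnD exprM e.
Qed.

(** The elements are roots of X^(p^n) - X, which is nonzero as n > 0; a duplicate-free list of roots
    of maximal length contains them all. *)
Lemma fixed_finite n : (0 < n)%N -> finite_type (fixed_field kp n).
Proof.
move=> n0; pose q : {poly k} := 'X^(p ^ n) - 'X.
have q1 : (1 < p ^ n)%N by rewrite -(exp1n n) ltn_exp2r // prime_gt1.
have qN0 : q != 0.
  rewrite -lead_coef_eq0 lead_coefDl ?lead_coefXn ?oner_eq0 //.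
  by rewrite size_polyN size_polyX size_polyXn ltnS.
pose rts i := `[< exists s : seq k, [/\ uniq s, all (root q) s & size s = i] >].
have rts0 : exists i, rts i by exists 0%N; apply/asboolP; exists [::].
have rtsb i : rts i -> (i <= size q)%N.
  by move=> /asboolP[s [us rs <-]]; apply: ltnW; apply: max_poly_roots.
case: (ex_maxnP rts0 rtsb) => i /asboolP[s [us rs ss]] max_s.
have mem_s (x : k) : x ^+ (p ^ n) = x -> x \in s.
  move=> ex; apply: contraT => xs; have := max_s i.+1; rewrite ltnn => -> //.
  apply/asboolP; exists (x :: s); split; rewrite /= ?xs ?ss //.
  by rewrite rs andbT rootE /q hornerD hornerN hornerX hornerXn ex subrr.
pose enc (x : fixed_field kp n) : 'I_(size s).+1 := inord (index (val x) s).
apply: (@finite_type_inj _ _ enc) => x y /(congr1 (@nat_of_ord _)).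
have xs (z : fixed_field kp n) : val z \in s by apply: mem_s; apply/eqP; apply: (valP z).
rewrite !inordK ?ltnS ?index_size // => /(congr1 (nth 0 s)).
by rewrite !nth_index ?xs // => /val_inj.
Qed.

Let prime_val (a : 'F_p) : k := (a : nat)%:R.

Let natr_modp m : (m %% p)%:R = m%:R :> k.
Proof.
by rewrite {2}(divn_eq m p) natrD natrM (pcharf0 kp) mulr0 add0r.
Qed.

Let prime_val_modn (a : 'F_p) m : (a : nat) = (m %% (Zp_trunc (pdiv p)).+2)%N ->
  prime_val a = m%:R.
Proof.
by move=> e; rewrite /prime_val e -[RHS]natr_modp; congr (_ %% _)%:R; apply: Fp_cast.
Qed.

Let prime_val_zmod : zmod_morphism prime_val.
Proof.
move=> a c; apply: (canRL (addrK _)); rewrite -natrD.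
by rewrite -(@prime_val_modn (a - c + c)) // subrK.
Qed.

Let prime_val_monoid : monoid_morphism prime_val.
Proof.
split=> [|a c]; first exact: (@prime_val_modn 1 1).
by rewrite -natrM; apply: prime_val_modn.
Qed.

HB.instance Definition _ := GRing.isZmodMorphism.Build 'F_p k prime_val prime_val_zmod.
HB.instance Definition _ := GRing.isMonoidMorphism.Build 'F_p k prime_val prime_val_monoid.

(** There are finitely many residues modulo f over F_p, so x ^ (p ^ i) = x ^ (p ^ j) for some i < j;
    injectivity of Frobenius then gives x = x ^ (p ^ (j - i)). *)
Lemma algebraic_frobenius_fixed (x : k) :
  algebraicOver (fun a : 'F_p => (a : nat)%:R : k) x ->
  exists2 n, (0 < n)%N & x ^+ (p ^ n) = x.
Proof.
case=> f f0 fx; have {}fx : root (map_poly prime_val f) x by [].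
pose g i := 'X^(p ^ i) %% f.
have gx i : (map_poly prime_val (g i)).[x] = x ^+ (p ^ i).
  rewrite -[RHS]hornerXn -(map_polyXn prime_val) [X in _ = (map_poly _ X).[_]](divp_eq _ f).
  by rewrite rmorphD rmorphM /= hornerD hornerM (eqP fx) mulr0 add0r.
have [i [j [ltij e]]] := pigeonhole (fun i => poly_rV (g i) : 'rV['F_p]_(size f)).
have gE l : rVpoly (poly_rV (g l) : 'rV['F_p]_(size f)) = g l.
  by apply: poly_rV_K; apply: ltnW; rewrite ltn_modp.
exists (j - i)%N; first by rewrite subn_gt0.
apply/eqP; rewrite -subr_eq0; have : (x ^+ (p ^ (j - i)) - x) ^+ (p ^ i) == 0.
  rewrite expn_frobenius_sub -exprM -expnD subnK 1?ltnW // -!gx.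
  by rewrite -(gE j) -e gE subrr.
by rewrite expf_eq0 => /andP[].
Qed.

Lemma common_frobenius_fixed (J : finType) (x : J -> k) :
  (forall j, exists2 n, (0 < n)%N & x j ^+ (p ^ n) = x j) ->
  exists2 n, (0 < n)%N & forall j, x j ^+ (p ^ n) = x j.
Proof.
move=> h; have /boolp.choice [n hn] j : exists n, (0 < n)%N /\ x j ^+ (p ^ n) = x j.
  by have [n n0 e] := h j; exists n.
exists (\prod_j n j)%N; first by apply: prodn_gt0 => j; case: (hn j).
by move=> j; rewrite (bigD1 j) //=; apply: frobenius_fixed_mul; case: (hn j).
Qed.
End FrobeniusFixed.

Section RationalClasses.
Variables (K : fieldType) (A : algebra K) (I : finType) (e : I -> A).
Hypothesis span : forall a : A, exists c : I -> K, a = \sum_i alg_map A (c i) * e i.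
Variables (F : fieldType) (iota : {rmorphism F -> K}).
Implicit Types x y : Pic A.

(** Only the action matrices are required to lie over F: the relations of a tensor product are built
    from them, which keeps products rational. *)
Definition rational x : Prop := exists (M : bimod A) s (L R : I -> 'M[F]_s) sg,
  pic_mem M x /\
  @presents K A I e M s (fun i => map_mx iota (L i)) (fun i => map_mx iota (R i)) sg.

Lemma rational_mul x y : rational x -> rational y -> rational (gmul x y).
Proof.
case=> M [s [L [R [sM [Mx pM]]]]] [N [t [L' [R' [sN [Ny pN]]]]]].
have [r [L2 [R2 [sg h]]]] := presents_tensor span pM pN.
by exists (bimod_mul M N), r, L2, R2, sg; split=> //; apply: pic_mem_mul.
Qed.

Lemma rational_exp x n : rational x -> rational (gexp x n.+1).
Proof.
move=> rx; elim: n => [|n IH]; first by have -> : gexp x 1 = x by apply: gmul1r.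
exact: rational_mul.
Qed.

Hypothesis F_finite : finite_type F.

(** A class is coded by the matrices of a rational presentation: their entries lie in a finite
    field, and their size is bounded by |I| ^ 2. *)
Lemma rational_finite : exists (D : finType) (code : Pic A -> D),
  forall x y, rational x -> rational y -> code x = code y -> x = y.
Proof.
have [E [enc encI]] := finite_type_enc F_finite.
pose bnd := (#|I| * #|I|)%N.
pose D : finType := {s : 'I_bnd.+1 & ({ffun I -> 'M[E]_s} * {ffun I -> 'M[E]_s})%type}.
pose coded x (d : D) := exists (M : bimod A) (L R : I -> 'M[F]_(tag d)) sg,
  [/\ pic_mem M x,
      @presents K A I e M (tag d) (fun i => map_mx iota (L i)) (fun i => map_mx iota (R i)) sg
    & tagged d = ([ffun i => map_mx enc (L i)], [ffun i => map_mx enc (R i)])].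
have coded_ex x : rational x -> exists d, coded x d.
  case=> M [s [L [R [sg [Mx pM]]]]].
  have hM : induces_morita M by apply: pic_mem_morita Mx.
  have [s' [L' [R' [sg' [les' pM']]]]] := presents_exists span hM.
  have les : (s < bnd.+1)%N by rewrite ltnS (leq_trans (presents_size pM pM')).
  exists (Tagged (fun s : 'I_bnd.+1 => ({ffun I -> 'M[E]_s} * {ffun I -> 'M[E]_s})%type)
    (i := Ordinal les) ([ffun i => map_mx enc (L i)], [ffun i => map_mx enc (R i)])).
  by exists M, L, R, sg.
(* [None] is the default code of a class that is not rational. *)
have /boolp.choice [code hcode] x :
    exists od : option D, rational x -> exists2 d, od = Some d & coded x d.
  have [/coded_ex[d hd]|nr] := pselect (rational x); last by exists None.
  by exists (Some d); exists d.
exists (option D), code => x y /hcode[d xd [M [L [R [sg [Mx pM dM]]]]]].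
move=> /hcode[d' yd] hd'; rewrite xd yd => -[dd']; move: hd'.
rewrite -dd' => -[N [L' [R' [sg' [Ny pN dN]]]]].
have mapI s (X Y : 'M[F]_s) : map_mx enc X = map_mx enc Y -> X = Y.
  by move=> eXY; apply/matrixP => i j; apply: encI; have /matrixP/(_ i j) := eXY; rewrite !mxE.
have [/ffunP eL /ffunP eR] : ([ffun i => map_mx enc (L i)], [ffun i => map_mx enc (R i)]) =
   ([ffun i => map_mx enc (L' i)], [ffun i => map_mx enc (R' i)]) by rewrite -dM dN.
have LL' : L = L' by apply/funext => i; apply: mapI; have := eL i; rewrite !ffunE.
have RR' : R = R' by apply/funext => i; apply: mapI; have := eR i; rewrite !ffunE.
rewrite -LL' -RR' in pN; apply: pic_mem_eq Mx Ny _; exact: presents_iso pM pN.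
Qed.
End RationalClasses.

Lemma exponent_p_power (G : grp) (p d : nat) : prime p ->
  (forall x : G, gexp x (p ^ d) = gone) ->
  exists m, exponent_is G (p ^ m) /\ (p ^ m %| p ^ d)%N.
Proof.
move=> pp ex; pose Q n := (0 < n)%N && `[< forall x : G, gexp x n = gone >].
have Qd : exists n, Q n.
  by exists (p ^ d)%N; rewrite /Q expn_gt0 prime_gt0 //; apply/asboolP.
case: (ex_minnP Qd) => e /andP[e0 /asboolP xe] min_e.
have e_dvd : (e %| p ^ d)%N.
  rewrite /dvdn; apply/negPn/negP => r0.
  suff /min_e : Q (p ^ d %% e)%N by rewrite leqNgt ltn_mod e0.
  rewrite /Q lt0n r0; apply/asboolP => x; have := ex x.
  by rewrite {1}(divn_eq (p ^ d) e) gexpD mulnC gexpM xe gexp1g gmul1l.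
have [m _ eE] := dvdn_pfactor e d pp e_dvd.
exists m; rewrite -eE; split=> //; split=> // n n0 xn.
by apply: min_e; rewrite /Q n0; apply/asboolP.
Qed.

(** An element x is determined by the code of g(x) and by its quotient with the chosen element of
    that code, which lies in the kernel. *)
Lemma finite_extension (G H K : grp) (f : G -> H) (g : H -> K) (D : finType)
    (code : K -> D) : group_hom g -> exact_seq f g ->
  (forall x y, code (g x) = code (g y) -> g x = g y) ->
  finite_type G -> finite_type H.
Proof.
move=> gM [_ ex] codeI /finite_type_enc [E [enc encI]].
have /boolp.choice [base hbase] d : exists y, (exists z, code (g z) = d) -> code (g y) = d.
  have [[z hz]|n] := pselect (exists z, code (g z) = d); first by exists z.
  by exists gone.
have /boolp.choice [o ho] x : exists u, f u = gmul x (ginv (base (code (g x)))).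
  apply/ex; have e : g (base (code (g x))) = g x by apply: codeI; apply: hbase; exists x.
  by rewrite -[LHS](gmulKV _ (g (base (code (g x))))) -gM gmulK e gmulVr.
apply: (@finite_type_inj _ _ (fun x => (code (g x), enc (o x)))) => x y [cxy /encI oxy].
by rewrite -(gmulK x (base (code (g x)))) -ho oxy ho cxy gmulK.
Qed.

(** * The Picard group of a block *)

Section BlockPicard.
Variables (p : nat) (O : idomainType) (k : fieldType) (res : {rmorphism O -> k}) (pi : O).
Variables (gT : finGroupType) (b : block (group_algebra O gT)) (P : {group gT}).
Hypotheses (compl : adically_complete pi)
  (res_surj : forall x : k, exists c : O, res c = x)
  (res_ker : forall c : O, res c = 0 <-> principal_ideal pi c)
  (pi_neq0 : pi != 0)
  (k_char : p \in [pchar k]) (P_defect : defect_group res p b P).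

Local Notation B := (block_algebra b).
Local Notation Bbar := (bc_algebra res B).

Let latB := block_lattice b.

Lemma out_pic_exact : exact_seq (@out_to_pic _ B pi 1) (@pic_bc _ _ res B).
Proof.
split=> [|y]; first exact: out_to_pic_inj.
split=> [y1|[x <-]].
  have My := pic_rep_mem y; have := pic_bc_mem res My; rewrite y1 => My1.
  have [f [hf i]] := pic_kernel_twisted compl res_surj res_ker latB (pic_rep_morita y)
    (pic_mem_iso My1 (pic_mem1 Bbar)).
  exists (out_congr_class hf).
  exact: (pic_mem_eq (out_to_pic_mem (u := out_congr_class hf) (erefl _)) My i).
apply: pic_mem_eq (pic_bc_mem res (out_to_pic_mem (out_repE x))) (pic_mem1 _) _.
by apply: (@bc_twisted _ _ res B pi); [apply: res_pi res_ker | apply: out_rep_congr].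
Qed.

Definition bc_gelt (g : gT) : Bbar := bct res 1 (gelt b g : B^o).

Lemma bc_gelt_span (a : Bbar) : exists c : gT -> k, a = \sum_g alg_map Bbar (c g) * bc_gelt g.
Proof.
have [x ->] := bc_repr res_surj (a : bc res B^o).
exists (fun g => res ((bval x : gralg O gT) g)).
rewrite {1}(gelt_span (x : B)).
have bct0 : bct res 1 (0 : B^o) = 0 by apply: (@addrI _ (bct res 1 0)); rewrite -bctDr !addr0.
rewrite (big_morph (fun m : B^o => bct res 1 m) (fun u v => @bctDr _ _ res B B^o 1 u v) bct0).
apply: eq_bigr => g _; rewrite [RHS]bc_mulE mul1r mulr1.
by rewrite -[in RHS](mul1r (res _)) bct_bal.
Qed.

(** If f and f' agree on the group elements modulo pi ^ (d + 1), then f'^-1 f is the identity at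
    that level, hence inner by [aut_congr_inner]. *)
Lemma out_congr_finite (d : nat) (v : O) : res v != 0 -> #|P|%:R = pi ^+ d * v ->
  finite_type k -> finite_type (Out_congr B pi 1).
Proof.
move=> v0 Pd /(finite_residues res_ker res_surj d.+1) [F [tau htau]].
pose code (u : Out_congr B pi 1) := [ffun gh : gT * gT =>
  tau ((bval (out_rep u (gelt b gh.1)) : gralg O gT) gh.2)].
apply: (@finite_type_inj _ _ code) => u u' /ffunP e; apply: out_congr_eq.
set f := out_rep u; set f' := out_rep u'.
have ffg g : pdvd pi d.+1 (f (gelt b g) - f' (gelt b g) : B^o).
  apply/(dual_basis_pdvd pi (block_dual_basis b)) => h.
  rewrite (dual_basis_sub (block_dual_basis b)); apply: htau.
  by have := e (g, h); rewrite !ffunE.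
have ffx x : pdvd pi d.+1 (f x - f' x : B^o).
  rewrite (gelt_span x) !alg_aut_sum -sumrB; apply: pdvd_sum => g.
  by rewrite !alg_autM !alg_autC -mulrBr; apply: pdvdMl.
have hc : alg_aut_congr pi d.+1 (alg_aut_comp (alg_aut_inv f') f).
  move=> x; have [t et] := ffx x; exists (alg_aut_inv f' t).
  have e1 : f x = f' x + alg_map B (pi ^+ d.+1) * t by rewrite -[LHS](subrK (f' x)) et addrC.
  by rewrite /= e1 alg_autD alg_autM alg_autC alg_autK addrC addKr.
have i := aut_congr_inner compl res_surj res_ker pi_neq0 k_char P_defect v0 Pd hc.
apply: inner_eq_trans (inner_eq_trans (inner_eq_comp (inner_eq_refl f') i) _).
  by apply: inner_eq_ext => x; rewrite /= alg_aut_invK.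
exact: inner_eq_ext.
Qed.

Lemma pic_finite (d : nat) (v : O) : res v != 0 -> #|P|%:R = pi ^+ d * v ->
  finite_type k -> finite_type (Pic B).
Proof.
move=> v0 Pd kfin; have [D [code codeI]] := rational_finite bc_gelt_span idfun kfin.
(* Here the finite field is k itself, embedded by the identity. *)
have rat_all y : rational bc_gelt idfun y.
  have [s [L [R [sg [_ h]]]]] := presents_exists bc_gelt_span (pic_rep_morita y).
  exists (pic_rep y), s, L, R, sg; split; first exact: pic_rep_mem.
  have idE (X : gT -> 'M[k]_s) : (fun i => map_mx idfun (X i)) = X.
    by apply/funext => i; apply/matrixP => l m; rewrite mxE.
  by rewrite !idE.
apply: (finite_extension (code := code) (@pic_bc_hom _ _ res B) out_pic_exact).
  by move=> x y; apply: codeI.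
exact: out_congr_finite v0 Pd kfin.
Qed.

(* The image of x in the Picard group over k is rational over a finite field,
   and so are all its powers; hence two of them coincide. *)
Lemma pic_torsion (d : nat) (v : O) : res v != 0 -> #|P|%:R = pi ^+ d * v ->
  (forall x : k, algebraicOver (fun a : 'F_p => (a : nat)%:R : k) x) ->
  forall x : Pic B, exists n, (0 < n)%N /\ gexp x n = gone.
Proof.
move=> v0 Pd alg x; have p_prime := pcharf_prime k_char; pose y := pic_bc res x.
have [s [L [R [sg [_ h]]]]] := presents_exists bc_gelt_span (pic_rep_morita y).
pose entry (j : bool * gT * 'I_s * 'I_s) : k :=
  (if j.1.1.1 then L j.1.1.2 else R j.1.1.2) j.1.2 j.2.
have [n n0 hn] := common_frobenius_fixed
  (fun j => algebraic_frobenius_fixed k_char (alg (entry j))).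
have /boolp.choice [lift liftE] (c : k) :
    exists y, c ^+ (p ^ n) = c -> fixed_val k_char n y = c.
  have [/(fixed_val_onto k_char)[z ez]|nc] := pselect (c ^+ (p ^ n) = c); first by exists z.
  by exists 0.
have liftK (X : gT -> 'M[k]_s) : (forall g i j, X g i j ^+ (p ^ n) = X g i j) ->
    (fun g => map_mx (fixed_val k_char n) (map_mx lift (X g))) = X.
  move=> hX; apply/funext => g; apply/matrixP => i j; rewrite !mxE.
  by apply: liftE; apply: hX.
have ry : rational bc_gelt (fixed_val k_char n) y.
  exists (pic_rep y), s, (fun g => map_mx lift (L g)), (fun g => map_mx lift (R g)), sg.
  split; first exact: pic_rep_mem.
  rewrite !liftK //; move=> g i j; first exact: (hn (false, g, i, j)).
  exact: (hn (true, g, i, j)).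
have [D [code codeI]] := rational_finite bc_gelt_span (fixed_val k_char n)
  (fixed_finite k_char n0).
(* Exponents are shifted by 1 because [rational_exp] covers positive powers. *)
have [i [j [ltij]]] := pigeonhole (fun i => code (gexp y i.+1)).
move/codeI=> /(_ (rational_exp bc_gelt_span i ry) (rational_exp bc_gelt_span j ry)) eij.
have y1 : gexp y (j - i) = gone.
  by apply: (@gmulIl _ (gexp y i.+1)); rewrite -gexpD addSn subnKC 1?ltnW // gmul1r.
have /(proj2 out_pic_exact)[o ho] : pic_bc res (gexp x (j - i)) = gone.
  by rewrite (group_homX _ _ (@pic_bc_hom _ _ res B)).
(* The power j - i brings x into the image of Out_1(B), which p ^ d annihilates. *)
exists ((j - i) * p ^ d)%N; split.
  by rewrite muln_gt0 subn_gt0 ltij expn_gt0 prime_gt0.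
rewrite gexpM -ho -(group_homX _ _ (@out_to_pic_hom _ B pi 1)).
rewrite (out_congr_exponent compl res_surj res_ker pi_neq0 k_char P_defect o v0 Pd).
exact: group_hom1 (@out_to_pic_hom _ B pi 1).
Qed.
End BlockPicard.

Theorem theorem6p2
    (p : nat) (p_prime : prime p)
    (O : idomainType) (k : fieldType) (res : {rmorphism O -> k}) (pi : O)
    (O_char0 : [pchar O] =i pred0)
    (O_pid : principal_ideal_ring O)
    (O_local : local_ring O)
    (O_complete : adically_complete pi)
    (O_rad : jacobson_radical O = principal_ideal pi)
    (res_surj : forall x : k, exists c : O, res c = x)
    (res_ker : forall c : O, res c = 0 <-> jacobson_radical O c)
    (k_char : p \in [pchar k])
    (gT : finGroupType) (b : block (group_algebra O gT)) (P : {group gT})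
    (P_defect : defect_group res p b P) :
  let B := block_algebra b in
  let Bbar := bc_algebra res B in
  let Out1 := Out_congr B pi 1 in
  [/\ exists (f : Out1 -> Pic B) (g : Pic B -> Pic Bbar),
        [/\ group_hom f, group_hom g,
            forall (a : alg_aut B) (ha : alg_aut_congr pi 1 a),
              pic_mem (twisted_bimod a) (f (out_congr_class ha)),
            forall (M : bimod B) (x : Pic B),
              pic_mem M x -> pic_mem (bc_bimod res M) (g x)
          & exact_seq f g],
      (exists! d : nat,
         principal_ideal (pi ^+ d) = principal_ideal (#|P|%:R : O)) /\
      (forall d : nat,
         principal_ideal (pi ^+ d) = principal_ideal (#|P|%:R : O) ->
         (P :!=: 1%g -> (0 < d)%N) /\
         exists m : nat, exponent_is Out1 (p ^ m) /\ (p ^ m %| p ^ d)%N),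
      finite_type k ->
        finite_type (Pic B) /\ (exists n : nat, has_card Out1 (p ^ n))
    & is_algebraic_closure_Fp p k ->
        forall x : Pic B, exists n : nat, (0 < n)%N /\ gexp x n = gone].
Proof.
move=> B Bbar Out1.
have res_ker' c : res c = 0 <-> principal_ideal pi c by rewrite -O_rad; apply: res_ker.
have natO_neq0 m : (0 < m)%N -> m%:R != 0 :> O.
  by move=> m0; rewrite ((pcharf0P O).1 O_char0) -lt0n.
(* p lies in pi O and is nonzero in characteristic 0. *)
have pi_neq0 : pi != 0.
  have /res_ker'[t et] : res p%:R = 0 by rewrite rmorph_nat (pcharf0 k_char).
  have := natO_neq0 p (prime_gt0 p_prime); rewrite et.
  by apply: contra_neq => ->; rewrite mul0r.
have [d0 [v [v0 Pd]]] := pi_valuation O_complete res_ker' (natO_neq0 #|P| (cardG_gt0 P)).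
have PI : principal_ideal (#|P|%:R : O) = principal_ideal (pi ^+ d0).
  by rewrite Pd (principal_ideal_unit O_complete res_surj res_ker' _ v0).
have d_eq d : principal_ideal (pi ^+ d) = principal_ideal (#|P|%:R : O) -> d = d0.
  by rewrite Pd; apply: (principal_ideal_pi O_complete res_surj res_ker' pi_neq0 v0).
have exO x : gexp (x : Out1) (p ^ d0) = gone.
  have := out_congr_exponent O_complete res_surj res_ker' pi_neq0 k_char P_defect x v0 Pd.
  by [].
have pP : (p.-group P)%g by have /maxgroupP[/andP[]] := P_defect.
split.
- exists (@out_to_pic _ B pi 1), (@pic_bc _ _ res B); split.
  + exact: out_to_pic_hom.
  + exact: pic_bc_hom.
  + by move=> a ha; apply: out_to_pic_mem.
  + by move=> M x; apply: pic_bc_mem.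
  + exact: out_pic_exact O_complete res_surj res_ker'.
- split; first by exists d0; split=> // d /d_eq.
  move=> d /d_eq ->; split; last exact: exponent_p_power p_prime exO.
  (* With d = 0 the order of P would be v, nonzero in k, whereas p divides the order of a nontrivial
     p-group. *)
  move=> PN1; rewrite lt0n; apply: contra_neq PN1 => d00.
  apply/eqP; rewrite trivg_card1; have [m Pm] := p_natP pP.
  case: m Pm => [-> //|m Pm]; case/eqP: v0.
  by rewrite -[v]mul1r -(expr0 pi) -d00 -Pd rmorph_nat Pm expnS natrM (pcharf0 k_char) mul0r.
- move=> kfin; split.
    exact: pic_finite O_complete res_surj res_ker' pi_neq0 k_char P_defect d0 v v0 Pd kfin.
  have [n hn] :=
    out_congr_finite O_complete res_surj res_ker' pi_neq0 k_char P_defect v0 Pd kfin.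
  have [f [g fK gK]] := hn.
  by have [m nE] := p_exponent_card fK gK p_prime exO; exists m; rewrite -nE.
- case=> _ alg x.
  exact: pic_torsion O_complete res_surj res_ker' pi_neq0 k_char P_defect d0 v v0 Pd alg x.
Qed.
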